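(* Let $V\in C_b^4(\mathbb R^m,\mathcal L(\mathbb R^d,\mathbb R^m))$ and $p>1/H$, and let $y^n$ be the Euler scheme defined in the context. Take $r,r'\ge0$ and let $k_0,k_0'\in\mathbb N$ be such that $r\in(t_{k_0},t_{k_0+1}]$ and $r'\in(t_{k_0'},t_{k_0'+1}]$. Define the Malliavin derivative vector $$\xi^n_t=(D_ry^n_t,\ D_rD_{r'}y^n_t)=:(\xi^{n,1}_t,\xi^{n,2}_t).$$ Then $\xi^{n,L}$, $L=1,2$, satisfies the iterative equation (with all coefficients $c_{L,i}=1$ in the operators and $\tilde c_{L,i}=0$, i.e. without the terms carrying $\tilde c$) $$\delta\xi^{n,L}_{t_kt_{k+1}}=\mathcal L^LV(y^n_{t_k})\,\delta x_{t_kt_{k+1}}+\frac12\sum_{j=1}^d\bar{\mathcal L}^L(\partial V_j\cdot V_j)(y^n_{t_k})\,\Delta^{2H},$$ for $t_k\ge r$ if $L=1$ and for $t_k\ge r\vee r'$ if $L=2$. Furthermore, with the control $$\omega(s,t)=\|\mathbf w\|^p_{p\text{-var};[\![s,t]\!]}+\|q\|^{p/2}_{p/2\text{-var};[\![s,t]\!]}+\|q^b\|^{p/2}_{p/2\text{-var};[\![s,t]\!]},\qquad(s,t)\in\mathcal S_2([\![0,T]\!]),$$ and $\alpha$, $s_j$, $S_i$, $\mathcal M_i$ as in the context, there is a constant $K$ independent of $r,r',j$ and $n$ such that $$\|\xi^{n,1}\|_{p\text{-var};[\![s,t]\!]}+\|\xi^{n,2}\|_{p\text{-var};[\![s,t]\!]}\le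 K\,\omega(s,t)^{1/p}\,|S_0\cup S_1\cup S_2|\,(\mathcal M_0\mathcal M_1\mathcal M_2)^2$$ for all $(s,t)\in\mathcal S_2([\![0,T]\!])$. Moreover, for $(s,t)\in\mathcal S_2([\![s_j,s_{j+1}]\!])$ such that $s_j\in S_0\cup S_1$ and for $L=1,2$, $$\big|\delta\xi^{n,L}_{st}-\mathcal L^LV(y^n_s)\,\delta x_{st}\big|\le K\,\omega(s,t)^{2/p}\,P^L_s.$$
   Context: **Grid and scheme.** $T>0$, $n\in\mathbb N$, $\Delta=T/n$, $t_k=k\Delta$; $[\![s,t]\!]=\{t_k:s\le t_k\le t\}$; $\mathcal S_2(I)=\{(u,v):u,v\in I,\ u\le v\}$; $\delta f_{st}=f_t-f_s$. $x,b$ are independent $d$-dimensional fractional Brownian motions on $[0,T]$ with Hurst parameter $H\in(\frac13,\frac12)$. $V=(V_j^i)_{i\le m,j\le d}$, $V_j=(V_j^1,\dots,V_j^m)$, $\partial V_iV_j=\partial V_i\cdot V_j=(\sum_\ell\partial_\ell V_i^kV_j^\ell)_{k\le m}$. The Euler scheme is $y^n_0=a\in\mathbb R^m$, $\delta y^n_{t_kt_{k+1}}=V(y^n_{t_k})\delta x_{t_kt_{k+1}}+\frac12\sum_{j=1}^d\partial V_jV_j(y^n_{t_k})\Delta^{2H}$. **Derivatives.** $D_r$ is the function-valued Malliavin derivative with respect to $x$ at the point $r$, taken as the sum $\sum_{j=1}^dD^{(j)}_r$ over the coordinates, so $D_ry^n_t\in\mathbb R^m$; it is determined by the chain rule and $D^{(j)}_r[\delta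 x^i_{t_kt_{k+1}}]=\mathbf 1_{\{i=j\}}\mathbf 1_{(t_k,t_{k+1}]}(r)$. **Operators.** $\langle\partial^kf(y),a^{(1)}\otimes\cdots\otimes a^{(k)}\rangle$ is the $k$-th derivative of $f$ at $y$ applied to $a^{(1)},\dots,a^{(k)}$ (componentwise for vector- or matrix-valued $f$), and $\partial^{k+1}f\cdot g$ means that the last slot of $\partial^{k+1}f$ is contracted with $g$. Writing $\xi^L=\xi^{n,L}$, at a grid time $s$ (all derivatives and functions evaluated at $y^n_s$), $\mathcal L^1f=\langle\partial f,\xi^1_s\rangle$, $\quad\mathcal L^2f=\langle\partial^2f,\xi^1_s\otimes\xi^1_s\rangle+\langle\partial f,\xi^2_s\rangle$, $\bar{\mathcal L}^1(\partial f\cdot g)=\langle\partial^2f\cdot g,\xi^1_s\rangle+\langle\partial f,\mathcal L^1g\rangle$, $\bar{\mathcal L}^2(\partial f\cdot g)=\langle\partial^3f\cdot g,\xi^1_s\otimes\xi^1_s\rangle+\langle\partial^2f\cdot g,\xi^2_s\rangle+\langle\partial^2f,\mathcal L^1g\otimes\xi^1_s\rangle+\langle\partial^2f,\xi^1_s\otimes\mathcal L^1g\rangle+\langle\partial f,\mathcal L^2g\rangle$. Also $\mathcal L^0=\bar{\mathcal L}^0=\mathrm{Id}$, $\bar{\mathcal L}^{-1}=0$. $P^0\equiv1$, $P^1_s=\max(1,|\xi^1_s|)$, $P^2_s=\max(1,|\xi^1_s|,|\xi^1_s|^2,|\xi^2_s|)$. For the threshold below, $\tilde{\mathcal L}^0=0$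 and, for $M=1,2$, $\tilde{\mathcal L}^M$ is the sum over the terms of $\mathcal L^M f$ and over the factors $\xi^{\ell}_s$ in each term, with $\xi^\ell_s$ replaced by $\mathcal L^{\ell-1}_{\tilde c}g$, where $\mathcal L_{\tilde c}$ is $\mathcal L$ with its coefficients $1$ replaced by $\tilde c=0$. **Rough path quantities.** $\mathrm w=(x^1,\dots,x^d,b^1,\dots,b^d)$, $\mathbf w=(\mathrm w^1,\mathrm w^2)$ with $\mathrm w^1=\delta\mathrm w$ is its geometric rough path lift (via piecewise linear approximations), $x^2,b^2$ are the second levels of the lifts of $x,b$; $q^{ij}_{st}=\sum_{s\le t_k<t}(x^{2,ij}_{t_kt_{k+1}}-\frac12\Delta^{2H}\mathbf 1_{\{i=j\}})$, $q^{b,ij}_{st}=\sum_{s\le t_k<t}(b^{2,ij}_{t_kt_{k+1}}-\frac12\Delta^{2H}\mathbf 1_{\{i=j\}})$. Variation norms are over the discrete interval: $\|g\|^\rho_{\rho\text{-var};[\![s,t]\!]}=\sup\sum_l|g_{u_lu_{l+1}}|^\rho$ over finite sequences $u_0\le u_1\le\cdots$ in $[\![s,t]\!]$ (with $g=\delta f$ for a path $f$), and $\|\mathbf w\|^p_{p\text{-var};[\![s,t]\!]}$ uses $|\mathrm w^1_{uv}|+|\mathrm w^2_{uv}|^{1/2}$ in place of $|g_{uv}|$, with $\rho=p$. **Greedy times.** $s_0=0$; given $s_j<T$, $s_{j+1}=s_j+\Delta$ if $\omega(s_j,s_j+\Delta)>\alpha$, and $s_{j+1}=\max\{u\in[\![0,T]\!]:u>s_j,\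 \omega(s_j,u)\le\alpha\}$ otherwise. $S_0=\{s_j:\alpha/2\le\omega(s_j,s_{j+1})\le\alpha\}$, $S_1=\{s_j:\omega(s_j,s_{j+1})<\alpha/2\}$, $S_2=\{s_j:\omega(s_j,s_{j+1})>\alpha\}$. $\mathcal M_i=\prod_{s_j\in S_i}(K\omega(s_j,s_{j+1})^{1/p}+1)$ for $i=0,1$, and $\mathcal M_2=\prod_{s_j\in S_2}(K|\delta\mathrm w_{s_js_{j+1}}|+K\Delta^{2H}+1)$. **Threshold $\alpha$.** $\mathcal A_1=\{(1)\}$, with $\alpha_{(1)}=2$, $\ell_2=1$; $\mathcal A_2=\{(1,1),(1,2)\}$, with $\alpha_{(1,1)}=3$, $\ell_2=\ell_3=1$ and $\alpha_{(1,2)}=2$, $\ell_2=2$; all $c_{M,i}=1$. Let $C^0=\sup_{\tau\le4}\|\partial^\tau V\|_\infty$. For $M=1,2$ (sums over $i\in\mathcal A_M$): $C^1_M=\sum_ic_{M,i}C^0$; $C^2_M=\sum_ic_{M,i}C^0(C^0+\sum_{r=2}^{\alpha_i}C^1_{\ell_r})$; $C^3_M=\sum_i\sum_{r=2}^{\alpha_i}c_{M,i}C^0C^1_{\ell_r-1}$; $C^1_0=C^0$, $C^2_0=2(C^0)^2$, $C^3_0=0$, $C^1_{-1}=C^2_{-1}=C^3_{-1}=0$. $K_1^M=C^1_M+C^1_{M-1}+1$, $K_2^M=C^2_M+C^2_{M-1}+C^3_M+C^3_{M-1}+1$ for $M=0,1,2$. $C^4_M=\max2^{M+1}K_1^{\ell_1}\cdots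 K_1^{\ell_{L'}}$ over $L'\ge1$ and positive integers $\ell_1,\dots,\ell_{L'}$ with sum $M$. $C^8_M=2\sum_ic_{M,i}C^0\big(K_1^0K_1^0+K_2^0+K_1^0C^4_M+\sum_{r=2}^{\alpha_i}(K_2^{\ell_r}+K_1^{\ell_r}C^4_M)\big)$ for $M=1,2$, $C^8_0=C^0(K_1^0K_1^0+K_2^0)$, $C^8_{-1}=0$. $C^6_M,C^7_M$ are constants such that $|\delta(\bar{\mathcal L}^M(\partial VV)(y^n_\cdot))_{su}|\le C^6_MP^M_s\omega(s,u)^{1/p}$ and $|\delta(\tilde{\mathcal L}^M(\partial VV)(y^n_\cdot))_{su}|\le C^7_MP^M_s\omega(s,u)^{1/p}$ whenever $\omega(s,u)^{1/p}\le\frac12$, $|\delta y^n_{su}|\le K_1^0\omega(s,u)^{1/p}$ and $|\delta\xi^{n,M'}_{su}|\le K_1^{M'}P^{M'}_s\omega(s,u)^{1/p}$ for $M'=1,2$. $K_4^M=(C^8_M+C^8_{M-1}+4C^6_M+4C^7_M)\vee1$, $K_3^M=(K_\mu K_4^M)\vee1$ with $K_\mu=2^\mu\sum_{l\ge1}l^{-\mu}$, $\mu=3/p$. Finally $\alpha^{1/p}=\min\{1/2,\,1/K_2^M,\,1/K_3^M:\ M=0,1,2\}$.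
   Formalization: In L², L̄², P² and the C⁶, C⁷ conditions, the two copies of ξ¹ are read as D_r y and D_{r'} y (P² also includes |D_{r'} y|); the p-variation and the last estimate use only grid points ≥ r (L=1) or ≥ r∨r' (L=2), leaving out the order-one jump at creation. *)

(* Defs.v *)
From HB Require Import structures.
From mathcomp Require Import all_boot all_order all_algebra.
From mathcomp Require Import all_classical all_reals all_analysis.

Set Implicit Arguments.
Unset Strict Implicit.
Unset Printing Implicit Defensive.

Import Order.TTheory GRing.Theory Num.Theory.
Import numFieldNormedType.Exports.

Local Open Scope classical_set_scope.
Local Open Scope ring_scope.

(* |.| is the Euclidean norm of the array of coordinates. *)
Definition enorm {R : realType} {k l : nat} (A : 'M[R]_(k, l)) : R :=
  Num.sqrt (\sum_i \sum_j A i j ^+ 2).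

(* ------------------------------------------------------------------------ *)
(* Differential calculus on R^m                                             *)
(* ------------------------------------------------------------------------ *)
Section Calculus.
Context {R : realType} {m : nat}.
Implicit Types (f : 'cV[R]_m -> R) (y : 'cV[R]_m).

Definition pder (l : 'I_m) f : 'cV[R]_m -> R :=
  fun y => derive f y (delta_mx l 0).

Definition pders (ls : seq 'I_m) f : 'cV[R]_m -> R := foldr pder f ls.

(* The class C_b^k: f and its partial derivatives up to order k exist, are
   continuous and bounded. *)
Fixpoint Cb (k : nat) f : Prop :=
  continuous f /\ (exists B : R, forall y, `|f y| <= B) /\
  (if k is k'.+1 then
     forall l : 'I_m,
       (forall y, derivable f y (delta_mx l 0)) /\ Cb k' (pder l f)
   else True).

(* < d^k f(y), a_1 (x) ... (x) a_k > ; contracting the last slot with g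
   amounts to taking a_k = g y. *)
Definition dapp f y (k : nat) (a : k.-tuple 'cV[R]_m) : R :=
  \sum_(ls : k.-tuple 'I_m)
    pders ls f y * \prod_(i < k) tnth a i (tnth ls i) 0.

End Calculus.

Section Coefficients.
Context {R : realType} {m d : nat}.
Variable V : 'cV[R]_m -> 'M[R]_(m, d).

(* vcoef i j is the scalar function V_j^i ; vfield j is V_j. *)
Definition vcoef (i : 'I_m) (j : 'I_d) : 'cV[R]_m -> R := fun y => V y i j.
Definition vfield (j : 'I_d) : 'cV[R]_m -> 'cV[R]_m := fun y => col j (V y).

Definition CbV (k : nat) : Prop := forall i j, Cb k (vcoef i j).

Definition dV_norm (tau : nat) (y : 'cV[R]_m) : R :=
  Num.sqrt (\sum_(ls : tau.-tuple 'I_m) \sum_i \sum_j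
              (pders ls (vcoef i j) y) ^+ 2).

Definition C0sup : R :=
  sup [set z | exists tau y, (tau <= 4)%N /\ z = dV_norm tau y].

(* the vector dV_i V_j = dV_i . V_j *)
Definition dVV (i j : 'I_d) (y : 'cV[R]_m) : 'cV[R]_m :=
  \col_k dapp (vcoef k i) y [tuple vfield j y].

End Coefficients.

(* ------------------------------------------------------------------------ *)
(* Grid, Euler scheme and its Malliavin derivatives                         *)
(* ------------------------------------------------------------------------ *)
Section Scheme.
Context {R : realType} {m d : nat}.
Variables (T H : R) (V : 'cV[R]_m -> 'M[R]_(m, d)) (a : 'cV[R]_m).
Variable n : nat.

Definition mesh : R := T / n%:R.
Definition tgrid (k : nat) : R := k%:R * mesh.

Definition grid_incr {D : nat} (f : R -> 'cV[R]_D) (k l : nat) : 'cV[R]_D :=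
  f (tgrid l) - f (tgrid k).

(* y^n_{t_k} as a function of the increments z_k of the driving path over
   the grid intervals [t_k, t_{k+1}]. *)
Fixpoint euler (k : nat) (z : nat -> 'cV[R]_d) : 'cV[R]_m :=
  if k is k'.+1 then
    let y := euler k' z in
    y + V y *m z k' + (mesh `^ (2 * H) / 2) *: \sum_(j < d) dVV V j j y
  else a.

(* d F / d z_k^i for a functional F of the increments *)
Definition incr_pder (k : nat) (i : 'I_d) (F : (nat -> 'cV[R]_d) -> R)
    (z : nat -> 'cV[R]_d) : R :=
  derive1 (fun h : R =>
    F (fun l => z l + (if l == k then h *: delta_mx i 0 else 0))) 0.

(* D^{(j)}_r [delta x^i_{t_k t_{k+1}}] *)
Definition malliavin_incr (j : 'I_d) (r : R) (k : nat) (i : 'I_d) : R :=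
  ((i == j) && (tgrid k < r <= tgrid k.+1))%:R.

(* chain rule for functionals of the n grid increments *)
Definition malliavin_coord (j : 'I_d) (r : R) (F : (nat -> 'cV[R]_d) -> R)
    (z : nat -> 'cV[R]_d) : R :=
  \sum_(k < n) \sum_(i < d) incr_pder k i F z * malliavin_incr j r k i.

Definition malliavin (r : R) (F : (nat -> 'cV[R]_d) -> R)
    (z : nat -> 'cV[R]_d) : R :=
  \sum_(j < d) malliavin_coord j r F z.

Definition malliavin_y (r : R) (k : nat) (z : nat -> 'cV[R]_d) : 'cV[R]_m :=
  \col_i malliavin r (fun z' => euler k z' i 0) z.

Definition malliavin2_y (r r' : R) (k : nat) (z : nat -> 'cV[R]_d)
    : 'cV[R]_m :=
  \col_i malliavin r (malliavin r' (fun z' => euler k z' i 0)) z.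

End Scheme.

(* ------------------------------------------------------------------------ *)
(* The operators L^M, bar L^M, tilde L^M                                    *)
(* ------------------------------------------------------------------------ *)

(* jy = y^n, ju = D_r y^n, ju' = D_{r'} y^n, jz = D_r D_{r'} y^n at a common
   grid time. Thus xi^1 = ju and xi^2 = jz. In the second order operators the
   tensor xi^1 (x) xi^1 stands for D_r y^n (x) D_{r'} y^n, the first slot
   coming from D_r and the second one from D_{r'}; the two slots coincide when
   r and r' belong to the same grid interval. *)
Record jet (R : realType) (m : nat) := Jet {
  jy : 'cV[R]_m; ju : 'cV[R]_m; ju' : 'cV[R]_m; jz : 'cV[R]_m }.

Definition jswap {R : realType} {m : nat} (J : jet R m) : jet R m :=
  Jet (jy J) (ju' J) (ju J) (jz J).

Section Operators.
Context {R : realType} {m d : nat}.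
Implicit Types (J : jet R m) (f : 'cV[R]_m -> R) (g : 'cV[R]_m -> 'cV[R]_m).

Definition jxi (L : nat) J : 'cV[R]_m := if L is 1 then ju J else jz J.

Definition opL (M : nat) J f : R :=
  match M with
  | 0 => f (jy J)
  | 1 => dapp f (jy J) [tuple ju J]
  | _ => dapp f (jy J) [tuple ju J; ju' J] + dapp f (jy J) [tuple jz J]
  end.

Definition opLv (M : nat) J g : 'cV[R]_m :=
  \col_i opL M J (fun y => g y i 0).

Definition opLbar (M : nat) J f g : R :=
  let y := jy J in
  match M with
  | 0 => dapp f y [tuple g y]
  | 1 => dapp f y [tuple ju J; g y] + dapp f y [tuple opLv 1 J g]
  | _ => dapp f y [tuple ju J; ju' J; g y]
         + dapp f y [tuple jz J; g y]
         + dapp f y [tuple opLv 1 J g; ju' J]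
         + dapp f y [tuple ju J; opLv 1 (jswap J) g]
         + dapp f y [tuple opLv 2 J g]
  end.

(* Each factor xi^1 is replaced in turn by L^0 g = g; the factor xi^2 of
   < df, xi^2 > is replaced by L^1_{tilde c} g, which vanishes as
   tilde c = 0. *)
Definition opLtilde (M : nat) J f g : R :=
  let y := jy J in
  match M with
  | 0 => 0
  | 1 => dapp f y [tuple g y]
  | _ => dapp f y [tuple g y; ju' J] + dapp f y [tuple ju J; g y]
  end.

Variable V : 'cV[R]_m -> 'M[R]_(m, d).

Definition opLV (M : nat) J : 'M[R]_(m, d) :=
  \matrix_(i, j) opL M J (vcoef V i j).

(* bar L^M (dV_i . V_j) *)
Definition opLbarVV (M : nat) J (i j : 'I_d) : 'cV[R]_m :=
  \col_k opLbar M J (vcoef V k i) (vfield V j).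

(* P^2 = max(1, |xi^1|, |xi^1|^2, |xi^2|), with the same convention on the
   two occurrences of xi^1 as above. *)
Definition Pmax (M : nat) J : R :=
  match M with
  | 0 => 1
  | 1 => Num.max 1 (enorm (ju J))
  | _ => Num.max (Num.max (Num.max 1 (Num.max (enorm (ju J)) (enorm (ju' J))))
                          (enorm (ju J) * enorm (ju' J)))
                 (enorm (jz J))
  end.

(* | op(dVV)(J') - op(dVV)(J) |, where dVV is the array (dV_i V_j)_{i,j} *)
Definition opVV_dist
    (op : jet R m -> ('cV[R]_m -> R) -> ('cV[R]_m -> 'cV[R]_m) -> R)
    (J J' : jet R m) : R :=
  Num.sqrt (\sum_(k < m) \sum_(i < d) \sum_(j < d)
    (op J' (vcoef V k i) (vfield V j) - op J (vcoef V k i) (vfield V j)) ^+ 2).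

End Operators.

Definition xi_jet {R : realType} {m d : nat} (T H : R)
    (V : 'cV[R]_m -> 'M[R]_(m, d)) (a : 'cV[R]_m) (n : nat)
    (x : R -> 'cV[R]_d) (r r' : R) (k : nat) : jet R m :=
  let z := fun l => grid_incr T n x l l.+1 in
  Jet (euler T H V a n k z)
      (malliavin_y T H V a n r k z)
      (malliavin_y T H V a n r' k z)
      (malliavin2_y T H V a n r r' k z).

(* The grid points t_k at which the equation of xi^L is in force. *)
Definition after {R : realType} (T : R) (n : nat) (r r' : R) (L k : nat)
    : bool :=
  (if L is 1 then r else Num.max r r') <= tgrid T n k.

(* ------------------------------------------------------------------------ *)
(* Discrete variation and the control omega                                 *)
(* ------------------------------------------------------------------------ *)
Section Control.
Context {R : realType}.

(* rho-th power of the rho-variation of g over the set I of grid indices *)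
Definition varpow (rho : R) (I : set nat) (g : nat -> nat -> R) : R :=
  sup [set v | exists u : seq nat,
    sorted leq u /\ (forall k, k \in u -> I k) /\
    v = \sum_(i < (size u).-1) g (nth 0%N u i) (nth 0%N u i.+1) `^ rho].

Definition grid_itv (k l : nat) : set nat := [set i | (k <= i <= l)%N].

Variable d : nat.
Variables (p T H : R) (n : nat).
Variables (w : R -> 'cV[R]_(d + d)) (w2 : R -> R -> 'M[R]_(d + d)).

Definition qsum (A : R -> R -> 'M[R]_d) (k l : nat) : 'M[R]_d :=
  \sum_(k <= i < l)
    (A (tgrid T n i) (tgrid T n i.+1) - (mesh T n `^ (2 * H) / 2)%:M).

(* w = (x, b): the second levels of x and b are the diagonal blocks of w2. *)
Definition q_x := qsum (fun s t => ulsubmx (w2 s t)).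
Definition q_b := qsum (fun s t => drsubmx (w2 s t)).

Definition w_size (k l : nat) : R :=
  enorm (grid_incr T n w k l)
  + Num.sqrt (enorm (w2 (tgrid T n k) (tgrid T n l))).

Definition control (k l : nat) : R :=
  varpow p (grid_itv k l) w_size
  + varpow (p / 2) (grid_itv k l) (fun i j => enorm (q_x i j))
  + varpow (p / 2) (grid_itv k l) (fun i j => enorm (q_b i j)).

End Control.

(* || xi^L ||_{p-var; [[t_k, t_l]]}, xi^L being indexed by the grid points
   at which its equation is in force: xi^L vanishes before them, and its jump
   at the creation time r (L = 1), max(r, r') (L = 2), which is an initial
   condition of order one, is not counted. *)
Definition xi_pvar {R : realType} {m : nat} (p T : R) (n : nat) (r r' : R)
    (J : nat -> jet R m) (L k l : nat) : R :=
  varpow p (grid_itv k l `&` [set i | after T n r r' L i])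
    (fun i j => enorm (jxi L (J j) - jxi L (J i))) `^ p^-1.

(* ------------------------------------------------------------------------ *)
(* Greedy times                                                             *)
(* ------------------------------------------------------------------------ *)
Section Greedy.
Context {R : realType}.
Variables (p alpha : R) (n : nat) (om : nat -> nat -> R).

(* index of the successor of the greedy time t_k *)
Definition gnext (k : nat) : nat :=
  if (n <= k)%N then n
  else if alpha < om k k.+1 then k.+1
  else (\max_(l < n.+1 | (k < l)%N && (om k l <= alpha)%R) l)%N.

(* At most n greedy times are < T, so listing s_0, ..., s_{n-1} is enough. *)
Definition is_greedy (k : nat) : bool := (k < n)%N && (k \in traject gnext 0%N n).

Definition S0 (k : nat) : bool :=
  is_greedy k && (alpha / 2 <= om k (gnext k) <= alpha).
Definition S1 (k : nat) : bool := is_greedy k && (om k (gnext k) < alpha / 2).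
Definition S2 (k : nat) : bool := is_greedy k && (alpha < om k (gnext k)).

Definition card_S : nat := #|[pred k : 'I_n | [|| S0 k, S1 k | S2 k]]|.

Definition calM01 (S : nat -> bool) (K : R) : R :=
  \prod_(k < n | S k) (K * om k (gnext k) `^ p^-1 + 1).

Definition calM2 (D : nat) (T H : R) (w : R -> 'cV[R]_D) (K : R) : R :=
  \prod_(k < n | S2 k)
    (K * enorm (grid_incr T n w k (gnext k)) + K * mesh T n `^ (2 * H) + 1).

Definition calM (D : nat) (T H : R) (w : R -> 'cV[R]_D) (K : R) : R :=
  calM01 S0 K * calM01 S1 K * calM2 T H w K.

End Greedy.

(* ------------------------------------------------------------------------ *)
(* The threshold alpha                                                      *)
(* ------------------------------------------------------------------------ *)
Section Threshold.
Context {R : realType}.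
Variables (p C0 : R) (C6 C7 : nat -> R).

(* An index i of A_M is represented by the list [:: l_2; ...; l_{alpha_i}]. *)
Definition idxA (M : nat) : seq (seq nat) :=
  match M with
  | 1 => [:: [:: 1%N]]
  | 2 => [:: [:: 1%N; 1%N]; [:: 2%N]]
  | _ => [::]
  end.

(* C_{M-1}, with the convention C_{-1} = 0 *)
Definition prevC (C : nat -> R) (M : nat) : R := if M is N.+1 then C N else 0.

Definition C1 (M : nat) : R :=
  if M is 0 then C0 else \sum_(i <- idxA M) C0.
Definition C2 (M : nat) : R :=
  if M is 0 then 2 * C0 ^+ 2
  else \sum_(i <- idxA M) C0 * (C0 + \sum_(l <- i) C1 l).
Definition C3 (M : nat) : R :=
  if M is 0 then 0
  else \sum_(i <- idxA M) \sum_(l <- i) C0 * C1 l.-1.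

Definition K1 (M : nat) : R := C1 M + prevC C1 M + 1.
Definition K2 (M : nat) : R := C2 M + prevC C2 M + C3 M + prevC C3 M + 1.

Definition C4 (M : nat) : R :=
  sup [set z | exists ls : seq nat,
    (0 < size ls)%N /\ all (leq 1) ls /\ sumn ls = M /\
    z = 2 ^+ M.+1 * \prod_(l <- ls) K1 l].

Definition C8 (M : nat) : R :=
  if M is 0 then C0 * (K1 0 * K1 0 + K2 0)
  else 2 * \sum_(i <- idxA M)
         C0 * (K1 0 * K1 0 + K2 0 + K1 0 * C4 M
               + \sum_(l <- i) (K2 l + K1 l * C4 M)).

Definition K4 (M : nat) : R :=
  Num.max (C8 M + prevC C8 M + 4 * C6 M + 4 * C7 M) 1.

(* K_mu is +oo when mu = 3 / p <= 1; then K3 = +oo, 1 / K3 = 0. *)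
Definition Kmu : \bar R :=
  let mu := 3 / p in
  ((2 `^ mu)%:E * \sum_(1 <= l <oo) (l%:R `^ (- mu))%:E)%E.

Definition K3 (M : nat) : \bar R := Order.max (Kmu * (K4 M)%:E)%E 1%:E.

Definition alpha_root : R :=
  fine (\big[Order.min/(2^-1)%:E]_(M < 3)
          Order.min ((K2 M)^-1)%:E (K3 M)^-1%E).

Definition threshold : R := alpha_root `^ p.

End Threshold.

(* The defining property of C^6_M (op = opLbar M), resp. C^7_M
   (op = opLtilde M), for one realisation J of (y^n, xi^n). *)
Definition increment_const {R : realType} {m d : nat} (p : R)
    (V : 'cV[R]_m -> 'M[R]_(m, d)) (n : nat) (om : nat -> nat -> R)
    (J : nat -> jet R m) (M : nat)
    (op : jet R m -> ('cV[R]_m -> R) -> ('cV[R]_m -> 'cV[R]_m) -> R)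
    (C : R) : Prop :=
  let k1 := K1 (C0sup V) in
  forall k l : nat, (k <= l <= n)%N ->
  let h := om k l `^ p^-1 in
  h <= 2^-1 ->
  enorm (jy (J l) - jy (J k)) <= k1 0%N * h ->
  enorm (ju (J l) - ju (J k)) <= k1 1%N * Pmax 1 (J k) * h ->
  enorm (ju' (J l) - ju' (J k)) <= k1 1%N * Pmax 1 (jswap (J k)) * h ->
  enorm (jz (J l) - jz (J k)) <= k1 2%N * Pmax 2 (J k) * h ->
  opVV_dist V op (J k) (J l) <= C * Pmax M (J k) * h.

(* ------------------------------------------------------------------------ *)
(* Fractional Brownian motion and its rough path lift                       *)
(* ------------------------------------------------------------------------ *)
Section Processes.
Context {R : realType} {disp : measure_display} {Omega : measurableType disp}.
Variable P : probability Omega R.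
Variables (T H : R).

(* The library's normal_prob is not degenerate when sigma = 0. *)
Definition centered_normal (sigma : R) (U : set R) : \bar R :=
  if sigma == 0 then dirac (0 : R) U else normal_prob 0 sigma U.

Definition centered_gaussian (X : R -> {RV P >-> R}) : Prop :=
  forall (N : nat) (t c : 'I_N -> R), (forall i, 0 <= t i <= T) ->
  exists sigma : R, forall U : set R, measurable U ->
    P ((fun o => \sum_i c i * X (t i) o) @^-1` U) = centered_normal sigma U.

Definition fbm_cov (s t : R) : R :=
  (s `^ (2 * H) + t `^ (2 * H) - `|t - s| `^ (2 * H)) / 2.

Definition is_fbm1 (X : R -> {RV P >-> R}) : Prop :=
  [/\ centered_gaussian X,
      forall s t, 0 <= s <= T -> 0 <= t <= T ->
        covariance P (X s) (X t) = (fbm_cov s t)%:E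
    & {ae P, forall o, {within `[0, T], continuous (fun t => X t o)}}].

(* sigma-algebra generated by the variables X i t, 0 <= t <= T *)
Definition sigma_gen (I : Type) (X : I -> R -> {RV P >-> R})
    : set (set Omega) :=
  <<s [set A | exists i t U, 0 <= t <= T /\ measurable U /\
                             A = X i t @^-1` U] >>.

Definition is_fbm (d : nat) (X : 'I_d -> R -> {RV P >-> R}) : Prop :=
  (forall i, is_fbm1 (X i)) /\
  (forall A : 'I_d -> set Omega,
     (forall i, sigma_gen (fun _ : unit => X i) (A i)) ->
     P (\bigcap_(i in [set: 'I_d]) A i) = (\prod_(i < d) fine (P (A i)))%:E).

Definition independent_processes (I J : Type)
    (X : I -> R -> {RV P >-> R}) (Y : J -> R -> {RV P >-> R}) : Prop :=
  forall A B, sigma_gen X A -> sigma_gen Y B ->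
    P (A `&` B) = (P A * P B)%E.

Definition path_of (d : nat) (X : 'I_d -> R -> {RV P >-> R}) (o : Omega) (t : R)
    : 'cV[R]_d := \col_i X i t o.

End Processes.

Section Lift.
Context {R : realType} {D : nat}.
Variable T : R.

(* piecewise linear interpolation of f along the points i T / 2^N *)
Definition plin (N : nat) (f : R -> R) (t : R) : R :=
  let h := T / 2 ^+ N in
  let i := (Num.truncn (t / h))%:R in
  f (i * h) + (t / h - i) * (f ((i + 1) * h) - f (i * h)).

(* int_s^t (f_u - f_s) dg_u for the piecewise linear interpolations; the
   derivative is defined off a finite set *)
Definition plin_area (N : nat) (f g : R -> R) (s t : R) : R :=
  (\int[lebesgue_measure]_(u in `[s, t])
     ((plin N f u - plin N f s) * derive1 (plin N g) u))%R.

(* (delta w, w2) is the geometric rough path above w: it is multiplicative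
   (Chen's relation) and w2 is the limit of the second levels of the dyadic
   piecewise linear approximations. *)
Definition geometric_lift (w : R -> 'cV[R]_D) (w2 : R -> R -> 'M[R]_D) : Prop :=
  (forall s u t, 0 <= s -> s <= u -> u <= t -> t <= T ->
     w2 s t = w2 s u + w2 u t + (w u - w s) *m (w t - w u)^T) /\
  (forall s t (i j : 'I_D), 0 <= s -> s <= t -> t <= T ->
     (fun N => plin_area N (fun u => w u i 0) (fun u => w u j 0) s t)
       @ \oo --> w2 s t i j).

End Lift.

(* Main.v *)
Require Import Defs.
From HB Require Import structures.
From mathcomp Require Import all_boot all_order all_algebra.
From mathcomp Require Import all_classical all_reals all_analysis.
From mathcomp Require Import ring lra zify.

Set Implicit Arguments.
Unset Strict Implicit.
Unset Printing Implicit Defensive.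

Import Order.TTheory GRing.Theory Num.Theory.
Import numFieldNormedType.Exports.

Local Open Scope classical_set_scope.
Local Open Scope ring_scope.

(** The estimates rest on Chen's relation for the second level of the driving
    path, which holds almost surely. The argument is deterministic, for one
    realisation at a time, with constants that depend neither on the
    realisation nor on n, r and r'.

    The state y and its derivatives u, u', z in the directions of D_r, of D_r'
    and of both are the components of one triangular Euler scheme: the
    coefficient of each component is the derivative of the coefficient of the
    previous ones ([tjet]). Differentiating the scheme by the chain rule gives
    exactly the operators L^M and bar L^M ([tjet_der]), and the terms with the
    differentiated noise only occur at the creation times, so that the
    iterative equation holds after them ([xi_equation]).

    The correction Delta^2H / 2 of one step is the difference B of the second
    level x^2 and of q ([drvB_step]); B satisfies Chen's relation since q is
    additive. Every component Y hence solves
      delta Y = W(Y) delta x + G(Y) B  on each grid interval,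
    where G is the derivative of W along the path. The remainder of this
    expansion vanishes on single intervals, and Chen's relation makes its
    defect on two adjacent intervals of order omega^(3/p). For p < 3 a discrete
    sewing argument ([discrete_sewing]) propagates this order to every interval
    with small omega. The fields of u, u', z have polynomial growth, but become
    bounded once the components are measured in the scales P^1, P^1, P^2 of
    the left end point, because the first two scales multiply to at most the
    third ([csc_mul]). An interval with omega <= 1 consists of boundedly many
    small intervals and single steps ([unit_interval]). When p >= 3 the constant
    K_mu is infinite and the threshold vanishes, so that nothing moves on the
    intervals of S_0 and S_1 ([constant_when_om0]).

    Over one greedy interval P^1 therefore grows at most by the factor that
    enters the product of the M_i, and P^2 by its square, the square coming
    from the product of two first derivatives ([csc_growth]). The derivatives
    are created with a bounded value, respectively with a value bounded by
    the first derivatives, and the factors multiply along the greedy times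
    ([greedy_growth]). An increment over a long interval is a sum of one
    contribution per greedy interval ([greedy_increment]), which is where the
    number of greedy times comes from; superadditivity of the control turns
    this into a bound of the p-variation ([xi_pvar_le]). *)

(** * The Euclidean norm *)

Section EuclideanNorm.
Context {R : realType}.

Lemma sum_sqr_cauchy (I : finType) (f g : I -> R) :
  (\sum_i f i * g i) ^+ 2 <= (\sum_i f i ^+ 2) * (\sum_i g i ^+ 2).
Proof.
have h : 0 <= \sum_i \sum_j (f i * g j - f j * g i) ^+ 2.
  by do 2 (apply: sumr_ge0 => ? _); exact: sqr_ge0.
suff e : \sum_i \sum_j (f i * g j - f j * g i) ^+ 2 =
  2 * ((\sum_i f i ^+ 2) * (\sum_i g i ^+ 2) - (\sum_i f i * g i) ^+ 2).
  by move: h; rewrite e; lra.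
have -> : \sum_i \sum_j (f i * g j - f j * g i) ^+ 2 =
  \sum_i \sum_j (f i ^+ 2 * g j ^+ 2) + \sum_i \sum_j (f j ^+ 2 * g i ^+ 2)
  - 2 * \sum_i \sum_j ((f i * g i) * (f j * g j)).
  rewrite mulr_sumr -!sumrN -!big_split; apply: eq_bigr => i _ /=.
  rewrite mulr_sumr -!sumrN -!big_split; apply: eq_bigr => j _ /=; ring.
have e (a b : I -> R) : \sum_i \sum_j a i * b j = (\sum_i a i) * \sum_i b i.
  by rewrite mulr_suml; apply: eq_bigr => i _; rewrite mulr_sumr.
have -> : \sum_i \sum_j f j ^+ 2 * g i ^+ 2 =
    (\sum_i g i ^+ 2) * \sum_i f i ^+ 2.
  by rewrite -e; do 2 (apply: eq_bigr => ? _); rewrite mulrC.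
by rewrite !e; ring.
Qed.

Lemma sqrt_sum_sqrD (I : finType) (f g : I -> R) :
  Num.sqrt (\sum_i (f i + g i) ^+ 2) <=
  Num.sqrt (\sum_i f i ^+ 2) + Num.sqrt (\sum_i g i ^+ 2).
Proof.
have sf : 0 <= \sum_i f i ^+ 2 by apply: sumr_ge0 => i _; exact: sqr_ge0.
have sg : 0 <= \sum_i g i ^+ 2 by apply: sumr_ge0 => i _; exact: sqr_ge0.
rewrite -(ler_pXn2r (ltn0Sn 1)) ?nnegrE ?addr_ge0 ?sqrtr_ge0 //.
rewrite sqr_sqrtr; last by apply: sumr_ge0 => i _; exact: sqr_ge0.
rewrite sqrrD !sqr_sqrtr //.
have -> : \sum_i (f i + g i) ^+ 2 =
    \sum_i f i ^+ 2 + (\sum_i f i * g i) *+ 2 + \sum_i g i ^+ 2.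
  by rewrite -sumrMnl -!big_split; apply: eq_bigr => i _ /=; rewrite sqrrD.
rewrite lerD2r lerD2l lerMn2r /= -sqrtrM //.
apply: (le_trans (ler_norm _)); rewrite -sqrtr_sqr ler_sqrt ?mulr_ge0 //.
exact: sum_sqr_cauchy.
Qed.

Variables k l : nat.
Implicit Types A B : 'M[R]_(k, l).

Lemma enormE A : enorm A = Num.sqrt (\sum_(ij : 'I_k * 'I_l) A ij.1 ij.2 ^+ 2).
Proof. by rewrite /enorm pair_big. Qed.

Lemma enorm_ge0 A : 0 <= enorm A. Proof. exact: sqrtr_ge0. Qed.

Lemma enormD A B : enorm (A + B) <= enorm A + enorm B.
Proof.
rewrite !enormE; apply: le_trans (sqrt_sum_sqrD _ _).
by under eq_bigr do rewrite mxE.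
Qed.

Lemma coord_le_enorm A i j : `|A i j| <= enorm A.
Proof.
rewrite enormE -sqrtr_sqr ler_sqrt; last by apply: sumr_ge0 => ? _; exact: sqr_ge0.
by rewrite (bigD1 (i, j)) //= lerDl; apply: sumr_ge0 => ? _; exact: sqr_ge0.
Qed.

Lemma enorm_le A (c : R) : 0 <= c -> (forall i j, `|A i j| <= c) ->
  enorm A <= (k * l)%:R * c.
Proof.
move=> c0 h; rewrite enormE.
have b0 : 0 <= (k * l)%:R * c by rewrite mulr_ge0.
rewrite -(ler_pXn2r (ltn0Sn 1)) ?nnegrE ?sqrtr_ge0 //.
rewrite sqr_sqrtr; last by apply: sumr_ge0 => ? _; exact: sqr_ge0.
apply: (@le_trans _ _ (\sum_(ij : 'I_k * 'I_l) c ^+ 2)).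
  apply: ler_sum => -[i j] _ /=; rewrite -[leLHS]ger0_norm ?sqr_ge0 // normrX.
  by rewrite lerXn2r ?nnegrE.
rewrite sumr_const card_prod !card_ord -[leLHS]mulr_natl exprMn.
case: (k * l)%N => [|q]; first by rewrite !mul0r expr0n /= mul0r.
rewrite ler_wpM2r ?sqr_ge0 // -natrX ler_nat; lia.
Qed.

End EuclideanNorm.

Lemma enorm_cV_le (R : realType) (m : nat) (v : 'cV[R]_m) (c : R) :
  0 <= c -> (forall i, `|v i 0| <= c) -> enorm v <= m%:R * c.
Proof.
move=> c0 h; rewrite -[in leRHS](muln1 m).
by apply: enorm_le => // i j; rewrite (ord1 j).
Qed.

(** * Partial derivatives and Taylor's formula for functions of class C_b^k *)

Section DirectionalDerivatives.
Context {R : realType} {m : nat}.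
Implicit Types (f : 'cV[R]_m -> R) (y a b c : 'cV[R]_m).

(** The contractions of the first three derivatives, with the last slot
    outermost: D2 and D3 are then D1 and D2 of the partial derivatives, and a
    fact about one order follows from the previous order by a single sum. *)
Definition D1 f y a : R := \sum_l pder l f y * a l 0.
Definition D2 f y a b : R := \sum_l D1 (pder l f) y a * b l 0.
Definition D3 f y a b c : R := \sum_l D2 (pder l f) y a b * c l 0.

Lemma big_tuple_cons (I : finType) k (F : k.+1.-tuple I -> R) :
  \sum_(t : k.+1.-tuple I) F t =
  \sum_(i : I) \sum_(t : k.-tuple I) F [tuple of i :: t].
Proof.
rewrite pair_big /=.
rewrite (reindex (fun it : I * k.-tuple I => [tuple of it.1 :: it.2])) //=.
exists (fun t => (thead t, [tuple of behead t])) => [[i t]|t] _ /=.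
  by rewrite theadE; congr pair; apply: val_inj.
by rewrite [RHS]tuple_eta.
Qed.

Lemma big_tuple0 (I : finType) (F : 0.-tuple I -> R) :
  \sum_(t : 0.-tuple I) F t = F [tuple].
Proof.
rewrite (bigD1 [tuple]) //= big1 ?addr0 // => t /eqP h; case: h.
by apply: val_inj; case: t => -[].
Qed.

Lemma dapp1 f y a : dapp f y [tuple a] = D1 f y a.
Proof.
rewrite /dapp big_tuple_cons; apply: eq_bigr => l _.
by rewrite big_tuple0 !big_ord_recl big_ord0 !(tnth_nth 0) /= mulr1.
Qed.

Lemma dapp2 f y a b : dapp f y [tuple a; b] = D2 f y a b.
Proof.
rewrite /dapp big_tuple_cons /D2 /D1.
under [RHS]eq_bigr do rewrite mulr_suml.
rewrite [RHS]exchange_big /=; apply: eq_bigr => l _.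
rewrite big_tuple_cons; apply: eq_bigr => l' _.
rewrite big_tuple0 !big_ord_recl big_ord0 !(tnth_nth 0) /= mulr1.
by rewrite mulrA.
Qed.

Lemma dapp3 f y a b c : dapp f y [tuple a; b; c] = D3 f y a b c.
Proof.
transitivity (\sum_l1 \sum_l2 \sum_l3
    pders [:: l1; l2; l3] f y * (a l1 0 * b l2 0 * c l3 0)).
  rewrite /dapp big_tuple_cons; apply: eq_bigr => l1 _.
  rewrite big_tuple_cons; apply: eq_bigr => l2 _; rewrite big_tuple_cons; apply: eq_bigr => l3 _.
  by rewrite big_tuple0 !big_ord_recl big_ord0 !(tnth_nth 0) /= mulr1 !mulrA.
rewrite /D3 /D2 /D1.
have -> : \sum_l1 \sum_l2 \sum_l3
    pders [:: l1; l2; l3] f y * (a l1 0 * b l2 0 * c l3 0) =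
  \sum_l3 \sum_l2 \sum_l1
    pders [:: l1; l2; l3] f y * (a l1 0 * b l2 0 * c l3 0).
  rewrite exchange_big /=; under eq_bigr do rewrite exchange_big /=.
  by rewrite exchange_big.
apply: eq_bigr => l3 _; rewrite mulr_suml; apply: eq_bigr => l2 _.
by rewrite !mulr_suml; apply: eq_bigr => l1 _ /=; ring.
Qed.

Lemma Cb_derivable k f l y : Cb k.+1 f -> derivable f y (delta_mx l 0).
Proof. by move=> [_ [_ /(_ l) []]]. Qed.

Lemma Cb_pder k f l : Cb k.+1 f -> Cb k (pder l f).
Proof. by move=> [_ [_ /(_ l) []]]. Qed.

Lemma CbW k f : Cb k.+1 f -> Cb k f.
Proof.
elim: k f => [|k ih] f [fc [fb fd]]; split=> //; split=> // l.
by split; [exact: (fd l).1|exact/ih/(fd l).2].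
Qed.

Lemma pders_rcons ls l f : pders (rcons ls l) f = pders ls (pder l f).
Proof. by elim: ls => //= l' ls ->. Qed.

Lemma Cb_bound k f : Cb k f -> exists2 B : R, 0 <= B &
  forall ls y, (size ls <= k)%N -> `|pders ls f y| <= B.
Proof.
elim: k f => [|k ih] f.
  move=> [_ [[B fB] _]]; exists `|B| => // -[|//] y _.
  by apply: le_trans (fB y) _; exact: ler_norm.
move=> [_ [[B fB] fd]].
have /choice [C hC] : forall l, exists C : R, 0 <= C /\
    forall ls y, (size ls <= k)%N -> `|pders ls (pder l f) y| <= C.
  by move=> l; have [C C0 hC] := ih _ (fd l).2; exists C.
have sC : 0 <= \sum_l C l by apply: sumr_ge0 => l _; exact: (hC l).1.
exists (`|B| + \sum_l C l); first by rewrite addr_ge0.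
move=> ls y; case/lastP: ls => [_|ls l].
  by rewrite -[leLHS]addr0 lerD // (le_trans (fB y)) // ler_norm.
rewrite size_rcons ltnS => hs; rewrite pders_rcons.
apply: le_trans ((hC l).2 _ _ hs) _.
rewrite (bigD1 l) //=.
have : 0 <= \sum_(i < m | i != l) C i by apply: sumr_ge0 => i _; exact: (hC i).1.
by have := normr_ge0 B; lra.
Qed.

Lemma mvt_coord f l y (t : R) : (forall y' : 'cV[R]_m, derivable f y' (delta_mx l 0)) ->
  exists2 s : R, `|s| <= `|t| &
    f (y + t *: delta_mx l 0) - f y = pder l f (y + s *: delta_mx l 0) * t.
Proof.
move=> fd; pose g (s : R) := f (y + s *: delta_mx l 0).
have gd (s : R) : is_derive (s : R) (1 : R) g (pder l f (y + s *: delta_mx l 0)).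
  have e : (fun h : R => h^-1 *: ((g \o shift s) (h *: 1) - g s)) =
    (fun h : R => h^-1 *: ((f \o shift (y + s *: delta_mx l 0))
      (h *: delta_mx l 0) - f (y + s *: delta_mx l 0))).
    apply/funext => h; congr (_ *: (_ - _)); rewrite /g /=; congr f.
    by rewrite scalerDl addrCA [h%:A]mulr1.
  by split; [rewrite /derivable e; exact: fd|rewrite /derive e].
have gc (u v : R) : {within `[u, v], continuous g}.
  by apply: derivable_within_continuous => s _; exact: (@ex_derive _ _ _ _ _ _ _ (gd s)).
have g0 : g 0 = f y by rewrite /g scale0r addr0.
have [t0|t0] := leP 0 t.
  have [s] := MVT_segment t0 (fun s _ => gd s) (gc _ _).
  rewrite in_itv /= => /andP[s0 st]; rewrite g0 subr0 => e; exists s => //.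
  by rewrite !ger0_norm.
have [s] := MVT_segment (ltW t0) (fun s _ => gd s) (gc _ _).
rewrite in_itv /= => /andP[s0 st]; rewrite g0 sub0r => e; exists s.
  by rewrite !ler0_norm ?lerN2 // ltW.
by rewrite -opprB; rewrite -/(g t) e mulrN opprK.
Qed.

(** The corners of the path from y to y' that moves one coordinate at a time:
    along it only partial derivatives are needed, for which the hypotheses
    give a mean value theorem in one variable. *)
Definition mixc y y' (q : nat) : 'cV[R]_m :=
  \col_l (if (l < q)%N then y' l 0 else y l 0).

Lemma mixc_telescope f y y' :
  f y' - f y = \sum_(q < m) (f (mixc y y' q.+1) - f (mixc y y' q)).
Proof.
have -> : \sum_(q < m) (f (mixc y y' q.+1) - f (mixc y y' q)) =
    \sum_(0 <= q < m) (f (mixc y y' q.+1) - f (mixc y y' q)) by rewrite big_mkord.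
rewrite telescope_sumr //; congr (f _ - f _); apply/colP => l; rewrite !mxE //.
by rewrite ltn_ord.
Qed.

Lemma mixcS y y' (q : 'I_m) :
  mixc y y' q.+1 = mixc y y' q + (y' q 0 - y q 0) *: delta_mx q 0.
Proof.
apply/colP => l; rewrite !mxE eqxx andbT ltnS leq_eqVlt.
case: (eqVneq l q) => [->|lq]; first by rewrite eqxx ltnn /= mulr1 addrC subrK.
by rewrite (negbTE (_ : val l != val q)) //= mulr0 addr0.
Qed.

Lemma mixc_mvt f y y' (q : 'I_m) (D : R) :
  (forall l (z : 'cV[R]_m), derivable f z (delta_mx l 0)) ->
  (forall l, `|y' l 0 - y l 0| <= D) ->
  exists2 z : 'cV[R]_m, (forall l, `|z l 0 - y l 0| <= D) &
    f (mixc y y' q.+1) - f (mixc y y' q) = pder q f z * (y' q 0 - y q 0).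
Proof.
move=> fd hD; rewrite mixcS.
have [s hs ->] := @mvt_coord f q (mixc y y' q) (y' q 0 - y q 0) (fd q).
exists (mixc y y' q + s *: delta_mx q 0) => // l.
rewrite !mxE eqxx andbT.
case: (eqVneq l q) => [->|lq].
  by rewrite ltnn mulr1 addrAC subrr add0r (le_trans hs).
rewrite mulr0 addr0; case: ifP => // _.
by rewrite subrr normr0; apply: le_trans (hD l).
Qed.

Lemma lip_coord f y y' (B D : R) :
  (forall l (z : 'cV[R]_m), derivable f z (delta_mx l 0)) ->
  (forall l z, `|pder l f z| <= B) ->
  (forall l, `|y' l 0 - y l 0| <= D) ->
  `|f y' - f y| <= m%:R * (B * D).
Proof.
move=> fd fB hD; rewrite mixc_telescope (le_trans (ler_norm_sum _ _ _)) //.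
rewrite -[X in _ <= X%:R * _]card_ord mulr_natl -sumr_const.
apply: ler_sum => q _.
have [z _ ->] := mixc_mvt q fd hD.
by rewrite normrM ler_pM.
Qed.

(** On each leg of the path through the points [mixc] the mean value theorem
    yields a partial derivative at a nearby point; replacing it by its value at
    y costs a second derivative times D, by [lip_coord]. *)
Lemma taylor_coord f y y' (B D : R) :
  (forall l (z : 'cV[R]_m), derivable f z (delta_mx l 0)) ->
  (forall l l' (z : 'cV[R]_m), derivable (pder l' f) z (delta_mx l 0)) ->
  (forall l l' z, `|pder l (pder l' f) z| <= B) ->
  (forall l, `|y' l 0 - y l 0| <= D) ->
  `|f y' - f y - D1 f y (y' - y)| <= m%:R * (m%:R * (B * D) * D).
Proof.
move=> fd fdd fB hD; rewrite mixc_telescope /D1 -sumrB.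
rewrite (le_trans (ler_norm_sum _ _ _)) //.
rewrite -[X in _ <= X%:R * _]card_ord mulr_natl -sumr_const.
apply: ler_sum => q _.
have [z hz ->] := mixc_mvt q fd hD.
rewrite !mxE -mulrBl normrM ler_pM //.
exact: (lip_coord (fun l => fdd l q) (fun l => fB l q) hz).
Qed.

Lemma is_derive_shift f (v z w : 'cV[R]_m) (df : R) :
  is_derive (z + v) w f df -> is_derive z w (fun z' => f (z' + v)) df.
Proof.
have e : (fun h : R => h^-1 *: (((fun z' => f (z' + v)) \o shift z) (h *: w)
      - f (z + v))) =
    (fun h : R => h^-1 *: ((f \o shift (z + v)) (h *: w) - f (z + v))).
  by apply/funext => h /=; rewrite addrA.
by case=> fd <-; split; [rewrite /derivable e|rewrite /derive e].
Qed.

(** The left-hand side is symmetric in l and l', which is what makes it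
    compare the two orders of differentiation. It is the increment along l of
    the difference of f along l'; the mean value theorem is applied to each
    in turn. *)
Lemma second_difference f l l' y (h : R) : Cb 2 f -> 0 <= h ->
  exists2 z : 'cV[R]_m, (forall i, `|z i 0 - y i 0| <= 2 * h) &
    f (y + h *: delta_mx l 0 + h *: delta_mx l' 0) - f (y + h *: delta_mx l 0)
      - (f (y + h *: delta_mx l' 0) - f y) = pder l' (pder l f) z * h * h.
Proof.
move=> fC h0; set v := h *: delta_mx l' 0.
pose F z := f (z + v) - f z.
have Fd z : is_derive z (delta_mx l 0) F (pder l f (z + v) - pder l f z).
  apply: is_deriveB; first apply: is_derive_shift.
    by split=> //; exact: Cb_derivable fC.
  by split=> //; exact: Cb_derivable fC.
have Fd' z : derivable F z (delta_mx l 0) by case: (Fd z).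
have [s hs] := mvt_coord y h Fd'.
have -> : pder l F (y + s *: delta_mx l 0) =
    pder l f (y + s *: delta_mx l 0 + v) - pder l f (y + s *: delta_mx l 0).
  by case: (Fd (y + s *: delta_mx l 0)).
have fd' z : derivable (pder l f) z (delta_mx l' 0).
  exact: Cb_derivable (Cb_pder _ fC).
have [s' hs' ->] := mvt_coord (y + s *: delta_mx l 0) h fd'.
rewrite /F => ->; eexists; last by [].
rewrite (ger0_norm h0) in hs hs' => i; rewrite !mxE eqxx !andbT.
set b : R := _%:R; set b' : R := _%:R.
have b1 : `|b| <= 1 by rewrite ger0_norm ?ler0n // /b; case: eqP.
have b1' : `|b'| <= 1 by rewrite ger0_norm ?ler0n // /b'; case: eqP.
have -> : y i 0 + s * b + s' * b' - y i 0 = s * b + s' * b' by ring.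
rewrite (le_trans (ler_normD _ _)) // !normrM.
have := ler_pM (normr_ge0 _) (normr_ge0 _) hs b1.
have := ler_pM (normr_ge0 _) (normr_ge0 _) hs' b1'.
by lra.
Qed.

(** Schwarz's theorem. Both mixed derivatives agree with the same second
    difference divided by h ^ 2, up to moving the point by at most 2 * h; as
    the third derivatives are bounded, they differ by a multiple of h. *)
Lemma pderC f l l' : Cb 3 f -> pder l (pder l' f) = pder l' (pder l f).
Proof.
move=> fC; apply/funext => y.
have [B B0 hB] := Cb_bound fC.
have lip i i' (z : 'cV[R]_m) (D : R) : (forall j, `|z j 0 - y j 0| <= D) ->
    `|pder i (pder i' f) z - pder i (pder i' f) y| <= m%:R * (B * D).
  move=> hD; apply: lip_coord hD.
    by move=> j z'; exact: Cb_derivable (Cb_pder _ (Cb_pder _ fC)).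
  by move=> j z'; exact: (hB [:: j; i; i']).
suff hs (h : R) : 0 < h ->
    `|pder l (pder l' f) y - pder l' (pder l f) y| <= (4 * m%:R * B) * h.
  apply/eqP; rewrite -subr_eq0 -normr_le0; apply/ler_addgt0Pr => e e0.
  have c0 : 0 < 4 * m%:R * B + 1 by rewrite ltr_wpDl // !mulr_ge0.
  rewrite add0r; apply: le_trans (hs (e / (4 * m%:R * B + 1)) _) _.
    by rewrite divr_gt0.
  rewrite mulrA ler_pdivrMr // mulrC ler_pM2l //; lra.
move=> h0.
have [z hz e] := second_difference l l' y (CbW fC) (ltW h0).
have [z' hz' e'] := second_difference l' l y (CbW fC) (ltW h0).
have l1 := lip l' l _ _ hz; have l2 := lip l l' _ _ hz'; clear lip.
move: (pder l' (pder l f) y) (pder l (pder l' f) y) l1 l2 => q p.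
move: (pder l' (pder l f) z) (pder l (pder l' f) z') e e' => w w' e e' l1 l2.
have ee : w * h * h = w' * h * h.
  rewrite -e -e'.
  have -> : y + h *: delta_mx l 0 + h *: delta_mx l' 0 =
    y + h *: delta_mx l' 0 + h *: delta_mx l 0 by rewrite addrAC.
  move: (f _) (f _) (f _) (f _) => a b c d; ring.
have {}ee : w = w'.
  by move/(mulIf (lt0r_neq0 h0)): ee => /(mulIf (lt0r_neq0 h0)).
rewrite ee in l1; have := ler_distD w' p q; rewrite (distrC p w') => l3.
by apply: le_trans l3 _; lra.
Qed.

Lemma D2C f y a b : Cb 3 f -> D2 f y a b = D2 f y b a.
Proof.
move=> fC; rewrite /D2 /D1.
under eq_bigr do rewrite mulr_suml.
under [RHS]eq_bigr do rewrite mulr_suml.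
rewrite exchange_big; apply: eq_bigr => l _; apply: eq_bigr => l' _ /=.
by rewrite (pderC l l' fC) mulrAC.
Qed.

Lemma D3C12 f y a b c : Cb 4 f -> D3 f y a b c = D3 f y b a c.
Proof.
by move=> fC; apply: eq_bigr => l _; rewrite D2C //; exact: Cb_pder fC.
Qed.

Lemma D3C23 f y a b c : Cb 3 f -> D3 f y a b c = D3 f y a c b.
Proof.
move=> fC; rewrite /D3 /D2.
under eq_bigr do rewrite mulr_suml.
under [RHS]eq_bigr do rewrite mulr_suml.
rewrite exchange_big; apply: eq_bigr => l _; apply: eq_bigr => l' _ /=.
by rewrite (pderC l l' fC) mulrAC.
Qed.

End DirectionalDerivatives.

(** * The chain rule along a curve *)

Section ChainRule.
Context {R : realType} {m : nat}.

Lemma is_derive0_cvg (g : R -> R) (dg : R) :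
  is_derive (0 : R) (1 : R) g dg <->
  h^-1 * (g h - g 0) @[h --> (0 : R)^'] --> dg.
Proof.
have e : (fun h : R => h^-1 *: ((g \o shift 0) (h *: (1 : R)) - g 0)) =
    (fun h : R => h^-1 * (g h - g 0)).
  by apply/funext => h /=; rewrite addr0 [h *: 1]mulr1.
split=> [[gd <-]|gc]; first by rewrite /derive e; rewrite /derivable e in gd.
by split; rewrite ?/derivable ?/derive e; [apply: cvgP gc|exact: cvg_lim gc].
Qed.

Lemma cvg_sumr (I : finType) (g : I -> R -> R) (a : I -> R) :
  (forall i, g i h @[h --> (0 : R)^'] --> a i) ->
  (\sum_i g i h) @[h --> (0 : R)^'] --> \sum_i a i.
Proof. move=> gc; apply: cvg_big => [|i _]; [exact: add_continuous|exact: gc]. Qed.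

(** The Taylor remainder is at most a constant times |Y h - Y 0|^2, and the
    quotient |Y h - Y 0| / h converges, hence the remainder divided by h tends
    to 0. *)
Lemma is_derive_chain (f : 'cV[R]_m -> R) (Y : R -> 'cV[R]_m) (v : 'cV[R]_m) :
  Cb 2 f ->
  (forall l, is_derive (0 : R) (1 : R) (fun h => Y h l 0) (v l 0)) ->
  is_derive (0 : R) (1 : R) (fun h => f (Y h)) (D1 f (Y 0) v).
Proof.
move=> fC Yd; apply/is_derive0_cvg.
have [B B0 hB] := Cb_bound fC.
pose q l (h : R) := h^-1 * (Y h l 0 - Y 0 l 0).
have qc l : q l h @[h --> (0 : R)^'] --> v l 0 by move: (Yd l) => /is_derive0_cvg.
pose S h := \sum_l `|q l h|.
have Sc : S h @[h --> (0 : R)^'] --> \sum_l `|v l 0|.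
  by apply: cvg_sumr => l; apply: cvg_norm; exact: qc.
pose C : R := m%:R * (m%:R * B).
have idc : h @[h --> (0 : R)^'] --> (0 : R) by apply: cvg_within.
have bc : C * (S h * S h * `|h|) @[h --> (0 : R)^'] --> (0 : R).
  have : C * (S h * S h * `|h|) @[h --> (0 : R)^'] -->
      C * ((\sum_l `|v l 0|) * (\sum_l `|v l 0|) * `|0 : R|).
    apply: cvgM; first exact: cvg_cst.
    by apply: cvgM; [exact: cvgM|exact: cvg_norm].
  by rewrite normr0 !mulr0.
pose r h := h^-1 * (f (Y h) - f (Y 0)) - \sum_l pder l f (Y 0) * q l h.
have rc : r h @[h --> (0 : R)^'] --> (0 : R).
  apply: (@squeeze_cvgr _ _ _ _ (fun h => - (C * (S h * S h * `|h|))) 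
    (fun h => C * (S h * S h * `|h|))) => //; last first.
    by have := cvgN bc; rewrite oppr0; apply.
  near=> h; rewrite -ler_norml.
  have h0 : h != 0 by near: h; exact: nbhs_dnbhs_neq.
  pose D : R := \sum_l `|Y h l 0 - Y 0 l 0|.
  have hD l : `|Y h l 0 - Y 0 l 0| <= D.
    by rewrite /D (bigD1 l) //= lerDl sumr_ge0.
  have DS : D = S h * `|h|.
    rewrite /S mulr_suml; apply: eq_bigr => l _.
    by rewrite /q normrM mulrAC -normrM mulVf // normr1 mul1r.
  have hT : `|f (Y h) - f (Y 0) - D1 f (Y 0) (Y h - Y 0)| <=
      m%:R * (m%:R * (B * D) * D).
    apply: taylor_coord hD.
    - by move=> l z; exact: Cb_derivable fC.
    - by move=> l l' z; exact: Cb_derivable (Cb_pder _ fC).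
    - by move=> l l' z; exact: (hB [:: l; l']).
  have -> : r h = h^-1 * (f (Y h) - f (Y 0) - D1 f (Y 0) (Y h - Y 0)).
    rewrite mulrBr /r /D1 mulr_sumr; congr (_ - _); apply: eq_bigr => l _.
    by rewrite !mxE mulrCA.
  rewrite normrM normfV ler_pdivrMl ?normr_gt0 //.
  apply: le_trans hT _; rewrite DS /C; move: (S h) `|h| => s t.
  by rewrite le_eqVlt; apply/orP; left; apply/eqP; ring.
have e : (fun h => h^-1 * (f (Y h) - f (Y 0))) =
    (fun h => r h + \sum_l pder l f (Y 0) * q l h).
  by apply/funext => h; rewrite /r subrK.
rewrite e -[D1 _ _ _]add0r; apply: cvgD => //.
by apply: cvg_sumr => l; apply: cvgM; [exact: cvg_cst|exact: qc].
Unshelve. all: by end_near.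
Qed.

End ChainRule.

(** * A discrete sewing estimate *)

(** Arithmetic on grid indices; the real inequalities of the context would
    only burden the decision procedure. *)
Ltac nlia := repeat match goal with
  | H : is_true (Order.le _ _) |- _ => clear H
  | H : is_true (Order.lt _ _) |- _ => clear H end; lia.

Lemma norm_sum_le (R : realType) (d : nat) (F : 'I_d -> R) (c : R) :
  (forall j, `|F j| <= c) -> `|\sum_j F j| <= d%:R * c.
Proof.
move=> h; apply: le_trans (ler_norm_sum _ _ _) _.
rewrite -[X in X%:R]card_ord mulr_natl -sumr_const.
by apply: ler_sum => j _.
Qed.

Section DiscreteSewing.
Context {R : realType}.
Variables (d : nat) (p C : R).
Hypotheses (p0 : 0 < p) (p3 : p < 3) (C0 : 0 <= C).

Let dd : R := d%:R.
(* c1 bounds increments over an interval, c2 the defect of the expansion on two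
   adjacent intervals. *)
Let c1 : R := 1 + 2 * dd ^+ 2 * C + dd * C.
Let c2 : R := dd * C * c1 ^+ 2 + 2 * dd ^+ 2 * C * c1.
Let th : R := 2^-1 `^ p^-1.
(* Splitting an interval yields two remainders K' (th h)^3 and two defects
   c2 h^3; K' is chosen such that they add up to at most K' h^3. *)
Let K' : R := 2 * c2 / (1 - 2 * th ^+ 3) + 1.
Let eps : R := (K' + c1)^-1.

Lemma dd0 : 0 <= dd. Proof. exact: ler0n. Qed.

Lemma c1_ge1 : 1 <= c1.
Proof.
have := dd0; have := mulr_ge0 dd0 C0; have := mulr_ge0 (sqr_ge0 dd) C0.
by rewrite /c1 -mulrA; lra.
Qed.

Lemma c2_ge0 : 0 <= c2.
Proof.
have h : 0 <= c1 by have := c1_ge1; lra.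
by rewrite /c2 addr_ge0 ?mulr_ge0 ?exprn_ge0 ?dd0.
Qed.

Lemma th_ge0 : 0 <= th. Proof. exact: powR_ge0. Qed.

(** The condition p < 3 says that the remainders of order 3 / p > 1 on the two
    halves of an interval add up to a fraction of the one on the whole. *)
Lemma th3_lt : 2 * th ^+ 3 < 1.
Proof.
have -> : th ^+ 3 = 2^-1 `^ (3 / p).
  by rewrite -powR_mulrn ?powR_ge0 // /th -powRrM mulrC.
have h : 1 < 3 / p by rewrite ltr_pdivlMr // mul1r.
have : 2^-1 `^ (3 / p) < (2^-1 : R) `^ 1; last by rewrite powRr1 //; lra.
rewrite /powR (_ : (2^-1 == 0 :> R) = false); last by apply/negbTE; lra.
rewrite ltr_expR mul1r gtr_nMl // lnV ?posrE // oppr_lt0.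
by rewrite ln_gt0 // ltr1n.
Qed.

Lemma K'_ge1 : 1 <= K'.
Proof.
have h : 0 <= 2 * c2 / (1 - 2 * th ^+ 3).
  by rewrite divr_ge0 ?mulr_ge0 ?c2_ge0 // subr_ge0 ltW // th3_lt.
by rewrite /K'; lra.
Qed.

Lemma K'_fix : 2 * K' * th ^+ 3 + 2 * c2 <= K'.
Proof.
have h : 0 < 1 - 2 * th ^+ 3 by rewrite subr_gt0 th3_lt.
have e : K' * (1 - 2 * th ^+ 3) = 2 * c2 + (1 - 2 * th ^+ 3).
  by rewrite /K' mulrDl mul1r divfK // gt_eqF.
move: e; rewrite mulrBr mulr1; set a := th ^+ 3 in h *; lra.
Qed.

Lemma eps_gt0 : 0 < eps.
Proof. by rewrite invr_gt0; have := K'_ge1; have := c1_ge1; lra. Qed.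

Lemma eps_le (h : R) : 0 <= h -> h <= eps -> [/\ K' * h <= 1, c1 * h <= 1 & h <= 1].
Proof.
move=> h0; rewrite /eps -[_^-1]mul1r ler_pdivlMr; last first.
  by have := K'_ge1; have := c1_ge1; lra.
have := K'_ge1; have := c1_ge1; move: K' c1 => K c hc hK.
by rewrite mulrDr => hh; split; nra.
Qed.

Variables (I : Type) (Y : I -> nat -> R) (W : I -> 'I_d -> nat -> R)
  (G : I -> 'I_d -> 'I_d -> nat -> R) (X : 'I_d -> nat -> nat -> R)
  (B : 'I_d -> 'I_d -> nat -> nat -> R) (om : nat -> nat -> R) (sc : I -> R)
  (s N : nat).

Let h k l := om k l `^ p^-1.
(* The region in which the bounds on the coefficients are available. *)
Let reg k := forall i, `|Y i k - Y i s| <= sc i.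

Hypothesis sN : (s <= N)%N.
Hypothesis om0 : forall k l, (s <= k)%N -> (k <= l)%N -> (l <= N)%N -> 0 <= om k l.
Hypothesis omS : forall k u l, (s <= k)%N -> (k <= u)%N -> (u <= l)%N ->
  (l <= N)%N -> om k u + om u l <= om k l.
Hypothesis hX : forall j k l, (s <= k)%N -> (k <= l)%N -> (l <= N)%N ->
  `|X j k l| <= h k l.
Hypothesis hB : forall j j' k l, (s <= k)%N -> (k <= l)%N -> (l <= N)%N ->
  `|B j j' k l| <= 2 * h k l ^+ 2.
Hypothesis XD : forall j k u l, (s <= k)%N -> (k <= u)%N -> (u <= l)%N ->
  (l <= N)%N -> X j k l = X j k u + X j u l.
Hypothesis BD : forall j j' k u l, (s <= k)%N -> (k <= u)%N -> (u <= l)%N ->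
  (l <= N)%N -> B j j' k l = B j j' k u + B j j' u l + X j k u * X j' u l.
Hypothesis step : forall i k, (s <= k)%N -> (k < N)%N ->
  Y i k.+1 - Y i k = \sum_j W i j k * X j k k.+1
    + \sum_j \sum_j' G i j j' k * B j j' k k.+1.
Hypothesis sc0 : forall i, 0 <= sc i.
Hypothesis HW : forall i j k, (s <= k)%N -> (k <= N)%N -> reg k ->
  `|W i j k| <= C * sc i.
Hypothesis HG : forall i j j' k, (s <= k)%N -> (k <= N)%N -> reg k ->
  `|G i j j' k| <= C * sc i.
Hypothesis HdG : forall i j j' k u D, (s <= k)%N -> (k <= u)%N -> (u <= N)%N ->
  reg k -> reg u -> 0 <= D <= 1 ->
  (forall i, `|Y i u - Y i k| <= D * sc i) ->
  `|G i j j' u - G i j j' k| <= C * D * sc i.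
Hypothesis HdW : forall i j' k u D E, (s <= k)%N -> (k <= u)%N -> (u <= N)%N ->
  reg k -> reg u -> 0 <= D <= 1 -> D ^+ 2 <= E ->
  (forall i, `|Y i u - Y i k| <= D * sc i) ->
  (forall i, `|Y i u - Y i k - \sum_j W i j k * X j k u| <= E * sc i) ->
  `|W i j' u - W i j' k - \sum_j G i j j' k * X j k u| <= C * E * sc i.
Hypothesis small : h s N <= eps.

Let A i k l := \sum_j W i j k * X j k l + \sum_j \sum_j' G i j j' k * B j j' k l.
Let Rm i k l := Y i l - Y i k - A i k l.

Lemma invp_ge0 : 0 <= p^-1. Proof. by rewrite invr_ge0 ltW. Qed.
Hint Resolve invp_ge0 : core.

Lemma h_ge0 k l : 0 <= h k l. Proof. exact: powR_ge0. Qed.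

Lemma om_le k l k' l' : (s <= k')%N -> (k' <= k)%N -> (k <= l)%N -> (l <= l')%N ->
  (l' <= N)%N -> om k l <= om k' l'.
Proof.
move=> a b c e f.
have h1 : om k' k + om k l' <= om k' l' by apply: omS; nlia.
have h2 : om k l + om l l' <= om k l' by apply: omS; nlia.
have h3 : 0 <= om k' k by apply: om0; nlia.
have h4 : 0 <= om l l' by apply: om0; nlia.
by lra.
Qed.

Lemma h_le k l k' l' : (s <= k')%N -> (k' <= k)%N -> (k <= l)%N -> (l <= l')%N ->
  (l' <= N)%N -> h k l <= h k' l'.
Proof.
move=> a b c e f; apply: ge0_ler_powR => //; rewrite ?nnegrE.
- by apply: om0; nlia.
- by apply: om0; nlia.
- by apply: om_le; nlia.
Qed.

Lemma om_diag k : (s <= k <= N)%N -> om k k = 0.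
Proof.
move=> /andP[a b]; have := @omS k k k a (leqnn _) (leqnn _) b.
by have := om0 a (leqnn _) b; lra.
Qed.

Lemma h_half k l k' l' : (s <= k)%N -> (k <= l)%N -> (l <= N)%N ->
  (s <= k')%N -> (k' <= l')%N -> (l' <= N)%N ->
  om k l <= om k' l' / 2 -> h k l <= th * h k' l'.
Proof.
move=> a b c a' b' c' e; rewrite /th /h -powRM; [|lra|exact: om0].
apply: ge0_ler_powR => //; rewrite ?nnegrE.
- exact: om0.
- by rewrite mulr_ge0 // om0.
- lra.
Qed.

Lemma Rm_diag i k : (s <= k <= N)%N -> Rm i k k = 0.
Proof.
move=> skN; have /andP[a b] := skN.
have h0 : h k k = 0 by rewrite /h om_diag // powR0 // invr_neq0 // gt_eqF.
rewrite /Rm /A subrr add0r big1 ?add0r => [|j _]; last first.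
  have := hX j a (leqnn _) b; rewrite h0 normr_le0 => /eqP ->.
  by rewrite mulr0.
rewrite big1 ?oppr0 // => j _; rewrite big1 // => j' _.
have := hB j j' a (leqnn _) b; rewrite h0 expr0n /= mulr0 normr_le0 => /eqP ->.
by rewrite mulr0.
Qed.

Lemma Rm_step i k : (s <= k)%N -> (k < N)%N -> Rm i k k.+1 = 0.
Proof. by move=> a b; rewrite /Rm step // subrr. Qed.

(** Chen's relation for B cancels the terms of second order. What remains is
    the error of the first order expansion of W times X, and the increment of G
    times B, both of order h^3. *)
Lemma A_defect i k u l : (s <= k)%N -> (k <= u)%N -> (u <= l)%N -> (l <= N)%N ->
  Rm i k l = Rm i k u + Rm i u l
   + (\sum_j' (W i j' u - W i j' k - \sum_j G i j j' k * X j k u) * X j' u l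
      + \sum_j \sum_j' (G i j j' u - G i j j' k) * B j j' u l).
Proof.
move=> a b c e.
have hA : A i k l = A i k u + \sum_j W i j k * X j u l
    + \sum_j \sum_j' (G i j j' k * B j j' u l + G i j j' k * X j k u * X j' u l).
  have h1 : \sum_j W i j k * X j k l =
      \sum_j W i j k * X j k u + \sum_j W i j k * X j u l.
    by rewrite -big_split; apply: eq_bigr => j _ /=; rewrite (XD _ a b c e) mulrDr.
  have h2 : \sum_j \sum_j' G i j j' k * B j j' k l =
      \sum_j \sum_j' G i j j' k * B j j' k u +
      \sum_j \sum_j' (G i j j' k * B j j' u l + G i j j' k * X j k u * X j' u l).
    rewrite -big_split; apply: eq_bigr => j _; rewrite -big_split.
    by apply: eq_bigr => j' _ /=; rewrite (BD _ _ a b c e); ring.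
  by rewrite /A h1 h2 addrACA addrA.
have hD : A i u l + \sum_j \sum_j' G i j j' k * X j k u * X j' u l =
    \sum_j W i j k * X j u l + \sum_j \sum_j' G i j j' k * B j j' u l
    + (\sum_j' (W i j' u - W i j' k) * X j' u l
      + \sum_j \sum_j' (G i j j' u - G i j j' k) * B j j' u l)
    + \sum_j \sum_j' G i j j' k * X j k u * X j' u l.
  have h1 : \sum_j W i j u * X j u l =
      \sum_j W i j k * X j u l + \sum_j (W i j u - W i j k) * X j u l.
    by rewrite -big_split; apply: eq_bigr => j _ /=; ring.
  have h2 : \sum_j \sum_j' G i j j' u * B j j' u l =
      \sum_j \sum_j' G i j j' k * B j j' u l +
      \sum_j \sum_j' (G i j j' u - G i j j' k) * B j j' u l.
    rewrite -big_split; apply: eq_bigr => j _; rewrite -big_split.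
    by apply: eq_bigr => j' _ /=; ring.
  by rewrite /A h1 h2 [in RHS]addrACA.
have hE : \sum_j' (W i j' u - W i j' k - \sum_j G i j j' k * X j k u) * X j' u l
   = \sum_j' (W i j' u - W i j' k) * X j' u l
     - \sum_j \sum_j' G i j j' k * X j k u * X j' u l.
  rewrite [X in _ - X]exchange_big -sumrB; apply: eq_bigr => j' _ /=.
  by rewrite mulrBl mulr_suml.
rewrite hE /Rm hA.
under [X in _ - (_ + X)]eq_bigr do rewrite big_split.
rewrite big_split /=; move: hD.
set a1 := A i k u; set a2 := A i u l.
set b1 := \sum_j W i j k * X j u l; set b2 := \sum_j _; set b3 := \sum_j _.
set b4 := \sum_j _; set b5 := \sum_j _; lra.
Qed.

Lemma increment_bounds k l : (s <= k)%N -> (k <= l)%N -> (l <= N)%N -> reg k ->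
  (forall i, `|Rm i k l| <= K' * h k l ^+ 3 * sc i) -> forall i,
  `|Y i l - Y i k - \sum_j W i j k * X j k l| <= c1 * h k l ^+ 2 * sc i /\
  `|Y i l - Y i k| <= c1 * h k l * sc i.
Proof.
move=> a b c rk hR i.
have sc1 := sc0 i; have d0 := dd0; have h0 := h_ge0 k l.
have hh : h k l <= h s N by apply: h_le => //; nlia.
have [hK hc h1] := eps_le (h_ge0 _ _) (le_trans hh small).
have kN := leq_trans b c.
have t1 j : `|W i j k * X j k l| <= C * sc i * h k l.
  rewrite normrM; apply: ler_pM => //; first exact: HW.
  exact: hX.
have t2 j j' : `|G i j j' k * B j j' k l| <= C * sc i * (2 * h k l ^+ 2).
  rewrite normrM; apply: ler_pM => //; first exact: HG.
  exact: hB.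
have b1 := norm_sum_le t1; have b2 := norm_sum_le (fun j => norm_sum_le (t2 j)).
have b3 := hR i; rewrite -/dd in b1 b2.
have e1 : Y i l - Y i k - \sum_j W i j k * X j k l =
    Rm i k l + \sum_j \sum_j' G i j j' k * B j j' k l.
  by rewrite /Rm /A opprD addrA subrK.
have q1 : `|Y i l - Y i k - \sum_j W i j k * X j k l| <=
    h k l ^+ 2 * sc i + dd * (dd * (C * sc i * (2 * h k l ^+ 2))).
  rewrite e1; apply: le_trans (ler_normD _ _) _; apply: lerD => //.
  apply: le_trans b3 _; rewrite ler_wpM2r //.
  have -> : K' * h k l ^+ 3 = K' * h k l * h k l ^+ 2 by ring.
  by rewrite ler_piMl // sqr_ge0.
have e2 : Y i l - Y i k = Y i l - Y i k - \sum_j W i j k * X j k l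
    + \sum_j W i j k * X j k l by rewrite subrK.
have q2 := ler_normD (Y i l - Y i k - \sum_j W i j k * X j k l)
   (\sum_j W i j k * X j k l).
rewrite -e2 in q2.
have q3 : h k l ^+ 2 * sc i <= h k l * sc i.
  by rewrite ler_wpM2r // expr2 ler_piMl.
have q4 : dd * (dd * (C * sc i * (2 * h k l ^+ 2))) <=
    dd * (dd * (C * sc i * (2 * h k l))).
  do 2 (rewrite ler_wpM2l //); rewrite ler_wpM2l ?mulr_ge0 // ler_wpM2l //.
  by rewrite expr2 ler_piMl.
have q5 : 0 <= dd * C * h k l ^+ 2 * sc i by rewrite !mulr_ge0 ?sqr_ge0.
split.
  apply: le_trans q1 _; rewrite /c1 -subr_ge0; apply: le_trans q5 _.
  by rewrite le_eqVlt; apply/orP; left; apply/eqP; ring.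
apply: le_trans q2 _; apply: le_trans (lerD q1 b1) _.
apply: le_trans (lerD (lerD q3 q4) (lexx _)) _.
by rewrite /c1 le_eqVlt; apply/orP; left; apply/eqP; ring.
Qed.

Lemma defect_bound i k u l : (s <= k)%N -> (k <= u)%N -> (u <= l)%N -> (l <= N)%N ->
  reg k -> reg u -> (forall i, `|Rm i k u| <= K' * h k u ^+ 3 * sc i) ->
  `|\sum_j' (W i j' u - W i j' k - \sum_j G i j j' k * X j k u) * X j' u l
      + \sum_j \sum_j' (G i j j' u - G i j j' k) * B j j' u l|
  <= c2 * h k l ^+ 3 * sc i.
Proof.
move=> a b c e rk ru hR.
have sc1 := sc0 i; have lN := leq_trans c e; have d0 := dd0.
have hku : h k u <= h k l by apply: h_le; nlia.
have hul : h u l <= h k l by apply: h_le; nlia.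
have h0 := h_ge0 k l; have h0' := h_ge0 k u; have c10 := c1_ge1.
have [_ hc1 _] := eps_le (h_ge0 _ _) small.
have hD : 0 <= c1 * h k u <= 1.
  apply/andP; split; first by rewrite mulr_ge0 //; lra.
  apply: le_trans hc1; rewrite ler_wpM2l //; first lra.
  by apply: h_le => //; nlia.
have hb := increment_bounds a b lN rk hR.
have hE : (c1 * h k u) ^+ 2 <= c1 ^+ 2 * h k u ^+ 2 by rewrite exprMn.
have c1sq : c1 <= c1 ^+ 2 by rewrite expr2 ler_peMl //; lra.
have t1 j' : `|(W i j' u - W i j' k - \sum_j G i j j' k * X j k u) * X j' u l|
    <= C * c1 ^+ 2 * h k l ^+ 3 * sc i.
  rewrite normrM.
  have -> : C * c1 ^+ 2 * h k l ^+ 3 * sc i =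
    C * (c1 ^+ 2 * h k l ^+ 2) * sc i * h k l by ring.
  apply: ler_pM => //; last by apply: le_trans hul; apply: hX => //; nlia.
  apply: le_trans (HdW i j' a b lN rk ru hD hE (fun i' => (hb i').2) _) _.
    move=> i'; apply: le_trans (hb i').1 _; rewrite ler_wpM2r // ler_wpM2r //.
    exact: exprn_ge0.
  rewrite ler_wpM2r // ler_wpM2l // ler_wpM2l ?sqr_ge0 //.
  by rewrite lerXn2r ?nnegrE.
have t2 j j' : `|(G i j j' u - G i j j' k) * B j j' u l|
    <= 2 * C * c1 * h k l ^+ 3 * sc i.
  rewrite normrM.
  have -> : 2 * C * c1 * h k l ^+ 3 * sc i =
    C * (c1 * h k l) * sc i * (2 * h k l ^+ 2) by ring.
  apply: ler_pM => //.
    apply: le_trans (HdG i j j' a b lN rk ru hD (fun i' => (hb i').2)) _.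
    by rewrite ler_wpM2r // ler_wpM2l // ler_wpM2l //; lra.
  apply: le_trans (hB j j' _ c e) _; first exact: leq_trans b.
  by rewrite ler_wpM2l // lerXn2r ?nnegrE ?h_ge0.
apply: le_trans (ler_normD _ _) _.
have := norm_sum_le t1.
have := norm_sum_le (fun j => norm_sum_le (t2 j)).
rewrite -/dd /c2; move: (`| _ |) (`| _ |) => u1 u2 b1 b2.
have -> : (dd * C * c1 ^+ 2 + 2 * dd ^+ 2 * C * c1) * h k l ^+ 3 * sc i =
  dd * (C * c1 ^+ 2 * h k l ^+ 3 * sc i)
  + dd * (dd * (2 * C * c1 * h k l ^+ 3 * sc i)) by ring.
exact: lerD.
Qed.

(** The step from u to u.+1 that crosses the middle of the mass of om. Two
    halves plus one step replace an exact halving, which a grid does not offer;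
    the step is free because the remainder vanishes on it ([Rm_step]). *)
Lemma split_point k l : (s <= k)%N -> (k < l)%N -> (l <= N)%N ->
  exists u, [/\ (k <= u < l)%N, om k u <= om k l / 2 & om u.+1 l <= om k l / 2].
Proof.
move=> a b c.
have ex : exists u, (k <= u < l)%N && (om k u <= om k l / 2).
  by exists k; rewrite leqnn b om_diag ?divr_ge0 ?om0 //; nlia.
have ub u : (k <= u < l)%N && (om k u <= om k l / 2) -> (u <= l)%N by nlia.
case: (ex_maxnP ex ub) => u /andP[hu h1] hmax; exists u; split=> //.
have [ul|ul] := leqP l u.+1.
  have -> : u.+1 = l by nlia.
  by rewrite om_diag ?divr_ge0 ?om0 //; nlia.
have h2 : om k l / 2 < om k u.+1.
  by rewrite ltNge; apply/negP => h3; have := hmax u.+1; rewrite h3; nlia.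
have : om k u.+1 + om u.+1 l <= om k l by apply: omS; nlia.
by lra.
Qed.

(** The bounds on the coefficients hold only in the region [reg], and staying
    there follows from the estimate itself. The outer induction on the right
    end point l carries both statements together; the inner one, on the length,
    applies the estimate to the right half of the interval. *)
Lemma sewing_bound l : (s <= l)%N -> (l <= N)%N -> reg l /\
  forall k, (s <= k)%N -> (k <= l)%N ->
    forall i, `|Rm i k l| <= K' * h k l ^+ 3 * sc i.
Proof.
elim/ltn_ind: l => l IH sl lN.
suff hR : forall q k, (l - k <= q)%N -> (s <= k)%N -> (k <= l)%N ->
    forall i, `|Rm i k l| <= K' * h k l ^+ 3 * sc i.
  split; last by move=> k sk kl; exact: (hR (l - k)%N).
  have rs : reg s by move=> i; rewrite subrr normr0.
  move=> i; have [_] := increment_bounds (leqnn s) sl lN rs (hR _ _ (leqnn _) (leqnn _) sl) i.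
  move/le_trans; apply; rewrite ler_piMl //.
  have [_ + _] := eps_le (h_ge0 _ _) small.
  apply: le_trans; rewrite ler_wpM2l //; first by have := c1_ge1; lra.
  by apply: h_le.
elim=> [|q ihq] k lkq sk kl i.
  have -> : k = l by nlia.
  by rewrite Rm_diag ?normr0 ?sl // !mulr_ge0 ?exprn_ge0 ?h_ge0 //; have := K'_ge1; lra.
have [e|kl'] := eqVneq k l.
  by rewrite e Rm_diag ?normr0 ?sl // !mulr_ge0 ?exprn_ge0 ?h_ge0 //; have := K'_ge1; lra.
have kl2 : (k < l)%N by nlia.
have [u [/andP[ku ul] h1 h2]] := split_point sk kl2 lN.
have [ru hRu] := IH u ul (leq_trans sk ku) (ltnW (leq_trans ul lN)).
have [rk _] := IH k kl2 sk (leq_trans kl lN).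
have hk := hRu k sk ku.
have b1 := @defect_bound i k u l sk ku (ltnW ul) lN rk ru hk.
rewrite (A_defect _ sk ku (ltnW ul) lN).
have su := leq_trans sk ku.
have t1 : `|Rm i k u| <= K' * th ^+ 3 * h k l ^+ 3 * sc i.
  apply: le_trans (hk i) _; rewrite ler_wpM2r // -[X in _ <= X]mulrA -exprMn.
  rewrite ler_wpM2l //; first by have := K'_ge1; lra.
  rewrite lerXn2r ?nnegrE ?mulr_ge0 ?th_ge0 ?h_ge0 //.
  by apply: h_half => //; nlia.
have t2 : `|Rm i u l| <= K' * th ^+ 3 * h k l ^+ 3 * sc i + c2 * h k l ^+ 3 * sc i.
  have q0 : 0 <= c2 * h k l ^+ 3 * sc i.
    by rewrite !mulr_ge0 ?exprn_ge0 ?h_ge0 // c2_ge0.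
  have q1 : 0 <= K' * th ^+ 3 * h k l ^+ 3 * sc i.
    by rewrite !mulr_ge0 ?exprn_ge0 ?h_ge0 ?th_ge0 //; have := K'_ge1; lra.
  have [e|ul'] := eqVneq u.+1 l.
    have -> : Rm i u l = 0 by rewrite -e Rm_step // (leq_trans ul).
    by rewrite normr0 addr_ge0.
  have ul'' : (u.+1 < l)%N by nlia.
  have su1 : (s <= u.+1)%N by nlia.
  have [ru1 hRu1] := IH u.+1 ul'' su1 (ltnW (leq_trans ul'' lN)).
  have b2 := @defect_bound i u u.+1 l su (leqnSn u) (ltnW ul'') lN ru ru1 (hRu1 u su (leqnSn u)).
  rewrite (A_defect _ su (leqnSn u) (ltnW ul'') lN) Rm_step ?add0r; [|nlia|nlia].
  apply: le_trans (ler_normD _ _) _; apply: lerD.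
    have hq : (l - u.+1 <= q)%N by nlia.
    apply: le_trans (ihq _ hq su1 (ltnW ul'') i) _.
    rewrite ler_wpM2r // -[X in _ <= X]mulrA -exprMn.
    rewrite ler_wpM2l //; first by have := K'_ge1; lra.
    have lN' : (u.+1 <= l)%N by exact: ltnW.
    rewrite lerXn2r ?nnegrE ?mulr_ge0 ?th_ge0 ?h_ge0 //.
    by apply: h_half.
  apply: le_trans b2 _; rewrite ler_wpM2r // ler_wpM2l ?c2_ge0 //.
  by rewrite lerXn2r ?nnegrE ?h_ge0 //; apply: h_le; nlia.
have tot : 2 * (K' * th ^+ 3 * h k l ^+ 3 * sc i) + 2 * (c2 * h k l ^+ 3 * sc i)
    <= K' * h k l ^+ 3 * sc i.
  have := ler_wpM2r (mulr_ge0 (exprn_ge0 3 (h_ge0 k l)) (sc0 i)) K'_fix.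
  move: (th ^+ 3) (h k l ^+ 3) (sc i) K' c2 => a b c e f; nra.
apply: le_trans (ler_normD _ _) _; have := ler_normD (Rm i k u) (Rm i u l).
move: t1 t2 tot b1; move: (K' * th ^+ 3 * h k l ^+ 3 * sc i) (K' * h k l ^+ 3 * sc i).
move: (c2 * h k l ^+ 3 * sc i) => a b c; lra.
Qed.

Lemma sewing_increments i :
  `|Y i N - Y i s - \sum_j W i j s * X j s N| <= c1 * h s N ^+ 2 * sc i /\
  `|Y i N - Y i s| <= c1 * h s N * sc i.
Proof.
have [_ hR] := sewing_bound sN (leqnn N).
apply: increment_bounds => //; first by move=> i'; rewrite subrr normr0.
exact: hR.
Qed.

End DiscreteSewing.

(** The index set is arbitrary and each component carries its own scale sc i,
    which must bound the coefficients of that component as long as no component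
    has moved by more than its scale. Fields of polynomial growth fit into this
    form, and eps and c do not depend on the scales. *)
Lemma discrete_sewing (R : realType) (d : nat) (p C : R) :
  0 < p -> p < 3 -> 0 <= C ->
  exists2 eps : R, 0 < eps & exists2 c : R, 1 <= c &
  forall (I : Type) (Y : I -> nat -> R) (W : I -> 'I_d -> nat -> R)
    (G : I -> 'I_d -> 'I_d -> nat -> R) (X : 'I_d -> nat -> nat -> R)
    (B : 'I_d -> 'I_d -> nat -> nat -> R) (om : nat -> nat -> R) (sc : I -> R)
    (s N : nat),
  let h k l := om k l `^ p^-1 in
  let reg k := forall i, `|Y i k - Y i s| <= sc i in
  (s <= N)%N ->
  (forall k l, (s <= k)%N -> (k <= l)%N -> (l <= N)%N -> 0 <= om k l) ->
  (forall k u l, (s <= k)%N -> (k <= u)%N -> (u <= l)%N -> (l <= N)%N ->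
    om k u + om u l <= om k l) ->
  (forall j k l, (s <= k)%N -> (k <= l)%N -> (l <= N)%N -> `|X j k l| <= h k l) ->
  (forall j j' k l, (s <= k)%N -> (k <= l)%N -> (l <= N)%N ->
    `|B j j' k l| <= 2 * h k l ^+ 2) ->
  (forall j k u l, (s <= k)%N -> (k <= u)%N -> (u <= l)%N -> (l <= N)%N ->
    X j k l = X j k u + X j u l) ->
  (forall j j' k u l, (s <= k)%N -> (k <= u)%N -> (u <= l)%N -> (l <= N)%N ->
    B j j' k l = B j j' k u + B j j' u l + X j k u * X j' u l) ->
  (forall i k, (s <= k)%N -> (k < N)%N ->
    Y i k.+1 - Y i k = \sum_j W i j k * X j k k.+1
      + \sum_j \sum_j' G i j j' k * B j j' k k.+1) ->
  (forall i, 0 <= sc i) ->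
  (forall i j k, (s <= k)%N -> (k <= N)%N -> reg k -> `|W i j k| <= C * sc i) ->
  (forall i j j' k, (s <= k)%N -> (k <= N)%N -> reg k ->
    `|G i j j' k| <= C * sc i) ->
  (forall i j j' k u D, (s <= k)%N -> (k <= u)%N -> (u <= N)%N ->
    reg k -> reg u -> 0 <= D <= 1 ->
    (forall i, `|Y i u - Y i k| <= D * sc i) ->
    `|G i j j' u - G i j j' k| <= C * D * sc i) ->
  (forall i j' k u D E, (s <= k)%N -> (k <= u)%N -> (u <= N)%N ->
    reg k -> reg u -> 0 <= D <= 1 -> D ^+ 2 <= E ->
    (forall i, `|Y i u - Y i k| <= D * sc i) ->
    (forall i, `|Y i u - Y i k - \sum_j W i j k * X j k u| <= E * sc i) ->
    `|W i j' u - W i j' k - \sum_j G i j j' k * X j k u| <= C * E * sc i) ->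
  h s N <= eps -> forall i,
  `|Y i N - Y i s - \sum_j W i j s * X j s N| <= c * h s N ^+ 2 * sc i /\
  `|Y i N - Y i s| <= c * h s N * sc i.
Proof.
move=> p0 p3 C0; eexists; first exact: (@eps_gt0 _ d p C p0 p3 C0).
eexists; first exact: (@c1_ge1 _ d C C0).
move=> I Y W G X B om sc s N h reg *.
by apply: (@sewing_increments _ d p C p0 p3 C0 I Y W G X B om sc s N).
Qed.

(** * First order expansions along the driving path *)

Section LocalCalculus.
Context {R : realType}.
Variable D : R.
Hypothesis D01 : 0 <= D <= 1.

(** The pair (a, a') has size s and increment of order D * s, with a constant C
    common to both, so that products multiply scales and constants
    separately. *)
Definition lip (C s a a' : R) :=
  [/\ 0 <= C, 0 <= s, `|a| <= C * s & `|a' - a| <= C * D * s].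

Lemma lip_end C s a a' : lip C s a a' -> `|a'| <= 2 * C * s.
Proof.
move=> [C0 s0 h1 h2]; have /andP[D0 D1] := D01.
have -> : a' = a + (a' - a) by ring.
apply: le_trans (ler_normD _ _) _; apply: le_trans (lerD h1 h2) _.
have : C * D * s <= C * s by rewrite ler_wpM2r // ler_piMr.
by lra.
Qed.

Lemma lipW C C' s s' a a' : C <= C' -> s <= s' -> lip C s a a' -> lip C' s' a a'.
Proof.
move=> CC ss [C0 s0 h1 h2]; have /andP[D0 _] := D01.
split; [lra|lra| |].
- by apply: le_trans h1 _; apply: ler_pM.
- by apply: le_trans h2 _; apply: ler_pM => //; [exact: mulr_ge0|exact: ler_wpM2r].
Qed.

Lemma lipD C1 C2 s a a' b b' : lip C1 s a a' -> lip C2 s b b' ->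
  lip (C1 + C2) s (a + b) (a' + b').
Proof.
move=> [C0 s0 h1 h2] [C0' _ h1' h2']; split; rewrite ?addr_ge0 // !mulrDl.
- by apply: le_trans (ler_normD _ _) _; exact: lerD.
- rewrite opprD addrACA; apply: le_trans (ler_normD _ _) _; exact: lerD.
Qed.

Lemma lipM C1 C2 s1 s2 a a' b b' : lip C1 s1 a a' -> lip C2 s2 b b' ->
  lip (3 * C1 * C2) (s1 * s2) (a * b) (a' * b').
Proof.
move=> ha hb; have hb' := lip_end hb; have /andP[D0 _] := D01.
case: ha => C0 s0 h1 h2; case: hb => C0' s0' h1' h2'.
split; rewrite ?mulr_ge0 //.
- rewrite normrM; apply: le_trans (ler_pM (normr_ge0 _) (normr_ge0 _) h1 h1') _.
  have : 0 <= C1 * s1 * (C2 * s2) by rewrite !mulr_ge0.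
  by nra.
- have -> : a' * b' - a * b = (a' - a) * b' + a * (b' - b) by ring.
  apply: le_trans (ler_normD _ _) _; rewrite !normrM.
  have := ler_pM (normr_ge0 _) (normr_ge0 _) h2 hb'.
  have := ler_pM (normr_ge0 _) (normr_ge0 _) h1 h2'.
  move: (`|_| * `|_|) (`|_| * `|_|) => u v.
  have -> : 3 * C1 * C2 * D * (s1 * s2) =
    C1 * s1 * (C2 * D * s2) + C1 * D * s1 * (2 * C2 * s2) by ring.
  by lra.
Qed.

Lemma lip_sum (m : nat) C s (a a' : 'I_m -> R) : 0 <= C -> 0 <= s ->
  (forall l, lip C s (a l) (a' l)) ->
  lip (m%:R * C) s (\sum_l a l) (\sum_l a' l).
Proof.
move=> C0 s0 h; split; rewrite ?mulr_ge0 // -?mulrA.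
- by apply: norm_sum_le => l; case: (h l).
- by rewrite -sumrB; apply: norm_sum_le => l; rewrite mulrA; case: (h l).
Qed.

Variable m : nat.
Implicit Types (f : 'cV[R]_m -> R) (y : 'cV[R]_m).

Lemma lip_fun f y y' (B : R) : Cb 1 f -> 0 <= B ->
  (forall ls z, (size ls <= 1)%N -> `|pders ls f z| <= B) ->
  (forall l, `|y' l 0 - y l 0| <= D) ->
  lip (B * m.+1%:R ^+ 2) 1 (f y) (f y').
Proof.
move=> fC B0 hB hD; have /andP[D0 D1] := D01.
have m0 : 0 <= m%:R :> R by [].
have e : m.+1%:R = m%:R + 1 :> R by rewrite -natr1.
split; rewrite ?mulr1 ?mulr_ge0 ?exprn_ge0 //.
- apply: le_trans (hB [::] y _) _ => //; rewrite e ler_peMr //; nra.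
- have h1 := lip_coord (fun l z => Cb_derivable (l := l) (y := z) fC)
    (fun l z => hB [:: l] z (leqnn 1)) hD.
  apply: le_trans h1 _; rewrite e mulrCA -mulrA ler_wpM2l //.
  by rewrite ler_wpM2r //; nra.
Qed.

Lemma lip_D1 f y y' (a a' : 'cV[R]_m) C Ca sa : 0 <= C -> 0 <= Ca -> 0 <= sa ->
  (forall l, lip C 1 (pder l f y) (pder l f y')) ->
  (forall l, lip Ca sa (a l 0) (a' l 0)) ->
  lip (m%:R * (3 * C * Ca)) sa (D1 f y a) (D1 f y' a').
Proof.
move=> C0 Ca0 sa0 hf ha; apply: lip_sum; rewrite ?mulr_ge0 // => l.
by rewrite -[sa]mul1r; exact: lipM.
Qed.

Lemma lip_D2 f y y' (a a' b b' : 'cV[R]_m) C Ca sa Cb sb :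
  0 <= C -> 0 <= Ca -> 0 <= sa -> 0 <= Cb -> 0 <= sb ->
  (forall l l', lip C 1 (pder l (pder l' f) y) (pder l (pder l' f) y')) ->
  (forall l, lip Ca sa (a l 0) (a' l 0)) ->
  (forall l, lip Cb sb (b l 0) (b' l 0)) ->
  lip (m%:R * (3 * (m%:R * (3 * C * Ca)) * Cb)) (sa * sb)
    (D2 f y a b) (D2 f y' a' b').
Proof.
move=> C0 Ca0 sa0 Cb0 sb0 hf ha hb; apply: lip_sum; rewrite ?mulr_ge0 // => l.
by apply: lipM => //; exact: lip_D1.
Qed.

Lemma lip_D3 f y y' (a a' b b' c c' : 'cV[R]_m) C Ca sa Cb sb Cc sc :
  0 <= C -> 0 <= Ca -> 0 <= sa -> 0 <= Cb -> 0 <= sb -> 0 <= Cc -> 0 <= sc ->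
  (forall l l' l'', lip C 1 (pder l (pder l' (pder l'' f)) y)
                            (pder l (pder l' (pder l'' f)) y')) ->
  (forall l, lip Ca sa (a l 0) (a' l 0)) ->
  (forall l, lip Cb sb (b l 0) (b' l 0)) ->
  (forall l, lip Cc sc (c l 0) (c' l 0)) ->
  lip (m%:R * (3 * (m%:R * (3 * (m%:R * (3 * C * Ca)) * Cb)) * Cc))
    (sa * sb * sc) (D3 f y a b c) (D3 f y' a' b' c').
Proof.
move=> C0 Ca0 sa0 Cb0 sb0 Cc0 sc0 hf ha hb hc; apply: lip_sum.
- by rewrite !mulr_ge0.
- by rewrite !mulr_ge0.
by move=> l; apply: lipM => //; exact: lip_D2.
Qed.

(* D bounds the increments and E the errors of the expansions. The product
   rule produces the product of two increments, of size D ^ 2, which is why E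
   must dominate it. *)
Variables (d : nat) (x : 'I_d -> R) (E : R).
Hypothesis DE : D ^+ 2 <= E.

Lemma E_ge0 : 0 <= E. Proof. exact: le_trans (sqr_ge0 D) DE. Qed.

(** Controlled paths in one step: da j is the derivative of a along the j-th
    component of the driving path. The calculus rules below compute da together
    with the bounds. *)
Definition ctrl (C s a a' : R) (da : 'I_d -> R) :=
  lip C s a a' /\ `|a' - a - \sum_j da j * x j| <= C * E * s.

Lemma ctrlW C C' s s' a a' da : C <= C' -> s <= s' ->
  ctrl C s a a' da -> ctrl C' s' a a' da.
Proof.
move=> CC ss [h1 h2]; split; first exact: lipW h1.
case: h1 => C0 s0 _ _; apply: le_trans h2 _; have := E_ge0 => E0.
by apply: ler_pM => //; [exact: mulr_ge0|exact: ler_wpM2r].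
Qed.

Lemma ctrlD C1 C2 s a a' da b b' db : ctrl C1 s a a' da -> ctrl C2 s b b' db ->
  ctrl (C1 + C2) s (a + b) (a' + b') (fun j => da j + db j).
Proof.
move=> [h1 h2] [h1' h2']; split; first exact: lipD.
have -> : a' + b' - (a + b) - \sum_j (da j + db j) * x j =
    (a' - a - \sum_j da j * x j) + (b' - b - \sum_j db j * x j).
  by under eq_bigr do rewrite mulrDl; rewrite big_split /=; ring.
apply: le_trans (ler_normD _ _) _; rewrite !mulrDl; exact: lerD.
Qed.

Lemma ctrlM C1 C2 s1 s2 a a' da b b' db :
  ctrl C1 s1 a a' da -> ctrl C2 s2 b b' db ->
  ctrl (3 * C1 * C2) (s1 * s2) (a * b) (a' * b') (fun j => da j * b + a * db j).
Proof.
move=> [h1 h2] [h1' h2']; split; first exact: lipM.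
case: h1 => C0 s0 a1 a2; case: h1' => C0' s0' b1 b2.
have -> : a' * b' - a * b - \sum_j (da j * b + a * db j) * x j =
    (a' - a - \sum_j da j * x j) * b + a * (b' - b - \sum_j db j * x j)
    + (a' - a) * (b' - b).
  have -> : \sum_j (da j * b + a * db j) * x j =
      (\sum_j da j * x j) * b + a * \sum_j db j * x j.
    by rewrite mulr_suml mulr_sumr -big_split; apply: eq_bigr => j _ /=; ring.
  by ring.
apply: le_trans (ler_normD _ _) _.
have q1 := ler_pM (normr_ge0 _) (normr_ge0 _) h2 b1.
have q2 := ler_pM (normr_ge0 _) (normr_ge0 _) a1 h2'.
have q3 := ler_pM (normr_ge0 _) (normr_ge0 _) a2 b2.
have q4 : C1 * D * s1 * (C2 * D * s2) <= C1 * C2 * E * (s1 * s2).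
  have -> : C1 * D * s1 * (C2 * D * s2) = C1 * C2 * D ^+ 2 * (s1 * s2) by ring.
  by rewrite ler_wpM2r ?mulr_ge0 // ler_wpM2l ?mulr_ge0.
have q5 := ler_normD ((a' - a - \sum_j da j * x j) * b)
   (a * (b' - b - \sum_j db j * x j)).
have -> : 3 * C1 * C2 * E * (s1 * s2) = C1 * E * s1 * (C2 * s2)
    + C1 * s1 * (C2 * E * s2) + C1 * C2 * E * (s1 * s2) by ring.
rewrite !normrM in q5 *.
apply: lerD; last exact: le_trans q3 q4.
by apply: le_trans q5 _; exact: lerD.
Qed.

Lemma ctrl_sum C s (a a' : 'I_m -> R) (da : 'I_m -> 'I_d -> R) :
  0 <= C -> 0 <= s -> (forall l, ctrl C s (a l) (a' l) (da l)) ->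
  ctrl (m%:R * C) s (\sum_l a l) (\sum_l a' l) (fun j => \sum_l da l j).
Proof.
move=> C0 s0 h; split; first by apply: lip_sum => // l; case: (h l).
have -> : \sum_l a' l - \sum_l a l - \sum_j (\sum_l da l j) * x j =
    \sum_l (a' l - a l - \sum_j da l j * x j).
  rewrite !sumrB; congr (_ - _ - _).
  by under eq_bigr do rewrite mulr_suml; rewrite exchange_big.
by rewrite -!mulrA; apply: norm_sum_le => l; rewrite mulrA; case: (h l).
Qed.

Lemma eq_ctrl C s a a' da db : da =1 db -> ctrl C s a a' da -> ctrl C s a a' db.
Proof. by move=> /funext ->. Qed.

Lemma ctrl_fun f y y' (B : R) (g : 'I_d -> 'cV[R]_m) : Cb 2 f -> 0 <= B ->
  (forall ls z, (size ls <= 2)%N -> `|pders ls f z| <= B) ->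
  (forall l, `|y' l 0 - y l 0| <= D) ->
  (forall l, `|y' l 0 - y l 0 - \sum_j g j l 0 * x j| <= E) ->
  ctrl (B * m.+1%:R ^+ 2) 1 (f y) (f y') (fun j => D1 f y (g j)).
Proof.
move=> fC B0 hB hD hE; have /andP[D0 _] := D01; have E0 := E_ge0.
split; first by apply: lip_fun => //; [exact: CbW|move=> ls z h; apply: hB; lia].
have hT : `|f y' - f y - D1 f y (y' - y)| <= m%:R * (m%:R * (B * D) * D).
  apply: taylor_coord hD.
  - by move=> l z; exact: Cb_derivable fC.
  - by move=> l l' z; exact: Cb_derivable (Cb_pder _ fC).
  - by move=> l l' z; exact: (hB [:: l; l']).
have -> : f y' - f y - \sum_j D1 f y (g j) * x j =
    (f y' - f y - D1 f y (y' - y))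
    + \sum_l pder l f y * (y' l 0 - y l 0 - \sum_j g j l 0 * x j).
  have -> : \sum_j D1 f y (g j) * x j = \sum_l pder l f y * \sum_j g j l 0 * x j.
    under eq_bigr do rewrite mulr_suml.
    rewrite exchange_big; apply: eq_bigr => l _ /=; rewrite mulr_sumr.
    by apply: eq_bigr => j _; rewrite mulrA.
  have -> : D1 f y (y' - y) = \sum_l pder l f y * (y' l 0 - y l 0).
    by apply: eq_bigr => l _; rewrite !mxE.
  have -> : \sum_l pder l f y * (y' l 0 - y l 0 - \sum_j g j l 0 * x j) =
      \sum_l pder l f y * (y' l 0 - y l 0)
      - \sum_l pder l f y * \sum_j g j l 0 * x j.
    by rewrite -sumrB; apply: eq_bigr => l _; rewrite mulrBr.
  by rewrite addrA subrK.
have hS : `|\sum_l pder l f y * (y' l 0 - y l 0 - \sum_j g j l 0 * x j)|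
    <= m%:R * (B * E).
  by apply: norm_sum_le => l; rewrite normrM ler_pM // (hB [:: l]).
apply: le_trans (ler_normD _ _) _; apply: le_trans (lerD hT hS) _.
have e : m.+1%:R = m%:R + 1 :> R by rewrite -natr1.
have m0 : 0 <= m%:R :> R by [].
have q : m%:R * (m%:R * (B * D) * D) <= m%:R * (m%:R * (B * E)).
  have -> : m%:R * (m%:R * (B * D) * D) = m%:R * (m%:R * (B * D ^+ 2)) by ring.
  by do 3 apply: ler_wpM2l => //.
apply: le_trans (lerD q (lexx _)) _.
have -> : B * m.+1%:R ^+ 2 * E * 1 =
   m%:R * (m%:R * (B * E)) + m%:R * (B * E) + (m%:R + 1) * (B * E).
  by rewrite e; ring.
by rewrite lerDl !mulr_ge0 // addr_ge0.
Qed.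

Lemma ctrl_D1 f y y' (a a' : 'cV[R]_m) (g da : 'I_d -> 'cV[R]_m) C Ca sa :
  0 <= C -> 0 <= Ca -> 0 <= sa ->
  (forall l, ctrl C 1 (pder l f y) (pder l f y') (fun j => D1 (pder l f) y (g j))) ->
  (forall l, ctrl Ca sa (a l 0) (a' l 0) (fun j => da j l 0)) ->
  ctrl (m%:R * (3 * C * Ca)) sa (D1 f y a) (D1 f y' a')
    (fun j => D2 f y (g j) a + D1 f y (da j)).
Proof.
move=> C0 Ca0 sa0 hf ha.
apply: eq_ctrl; last first.
  apply: ctrl_sum => [| |l]; rewrite ?mulr_ge0 //.
  by rewrite -[X in ctrl _ X]mul1r; exact: ctrlM (hf l) (ha l).
by move=> j /=; rewrite big_split.
Qed.

Lemma ctrl_D2 f y y' (a a' b b' : 'cV[R]_m) (g da db : 'I_d -> 'cV[R]_m) C Ca sa Cb sb :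
  0 <= C -> 0 <= Ca -> 0 <= sa -> 0 <= Cb -> 0 <= sb ->
  (forall l l', ctrl C 1 (pder l (pder l' f) y) (pder l (pder l' f) y')
     (fun j => D1 (pder l (pder l' f)) y (g j))) ->
  (forall l, ctrl Ca sa (a l 0) (a' l 0) (fun j => da j l 0)) ->
  (forall l, ctrl Cb sb (b l 0) (b' l 0) (fun j => db j l 0)) ->
  ctrl (m%:R * (3 * (m%:R * (3 * C * Ca)) * Cb)) (sa * sb)
    (D2 f y a b) (D2 f y' a' b')
    (fun j => D3 f y (g j) a b + D2 f y (da j) b + D2 f y a (db j)).
Proof.
move=> C0 Ca0 sa0 Cb0 sb0 hf ha hb.
apply: eq_ctrl; last first.
  apply: ctrl_sum => [| |l]; rewrite ?mulr_ge0 //.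
  apply: ctrlM (hb l); apply: (@ctrl_D1 _ y y' a a' g da) => //.
move=> j /=; rewrite -!big_split; apply: eq_bigr => l _ /=; ring.
Qed.

End LocalCalculus.

(** * The components of a jet and their coefficients *)

(** Indexing the components lets one statement treat y, u, u' and z at once,
    which is necessary: the expansion of the coefficient of one component
    involves the increments of the others. *)
Inductive comp := Cy | Cu | Cu' | Cz.

Section Components.
Context {R : realType} {m d : nat}.
Implicit Types (J : jet R m).

Definition jcomp (c : comp) J : 'cV[R]_m :=
  match c with Cy => jy J | Cu => ju J | Cu' => ju' J | Cz => jz J end.

Definition opc (c : comp) J (f : 'cV[R]_m -> R) : R :=
  match c with
  | Cy => opL 0 J f | Cu => opL 1 J f | Cu' => opL 1 (jswap J) f
  | Cz => opL 2 J f end.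

Definition opcbar (c : comp) J (f : 'cV[R]_m -> R) (g : 'cV[R]_m -> 'cV[R]_m) : R :=
  match c with
  | Cy => opLbar 0 J f g | Cu => opLbar 1 J f g | Cu' => opLbar 1 (jswap J) f g
  | Cz => opLbar 2 J f g end.

Variable V : 'cV[R]_m -> 'M[R]_(m, d).

Lemma vfieldE j y l : vfield V j y l 0 = vcoef V l j y.
Proof. by rewrite mxE. Qed.

Lemma opLvE M J l j : opLv M J (vfield V j) l 0 = opL M J (vcoef V l j).
Proof.
rewrite mxE; congr (opL M J _); apply/funext => y; exact: vfieldE.
Qed.

Hypothesis hV : CbV V 4.

(** The operator bar L puts the slot of V_j last. Moved to the front by
    Schwarz's theorem, it is the slot that a derivative along V_j creates, and
    the right-hand side is the derivative of L V along V_j ([ctrl_D1]). The same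
    holds for [opLbar2E] and [ctrl_D2]. *)
Lemma opLbar1E J i j' j : opLbar 1 J (vcoef V i j') (vfield V j) =
  D2 (vcoef V i j') (jy J) (vfield V j (jy J)) (ju J)
  + D1 (vcoef V i j') (jy J) (opLv 1 J (vfield V j)).
Proof.
rewrite /opLbar dapp2 dapp1; congr (_ + _).
by apply: D2C; exact: CbW (hV i j').
Qed.

Lemma opLbar2E J i j' j : opLbar 2 J (vcoef V i j') (vfield V j) =
  D3 (vcoef V i j') (jy J) (vfield V j (jy J)) (ju J) (ju' J)
  + D2 (vcoef V i j') (jy J) (opLv 1 J (vfield V j)) (ju' J)
  + D2 (vcoef V i j') (jy J) (ju J) (opLv 1 (jswap J) (vfield V j))
  + (D2 (vcoef V i j') (jy J) (vfield V j (jy J)) (jz J)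
     + D1 (vcoef V i j') (jy J) (opLv 2 J (vfield V j))).
Proof.
rewrite /opLbar !dapp2 dapp1 dapp3.
have C3 := CbW (hV i j').
rewrite (D3C23 _ _ _ _ C3) (D3C12 _ _ _ _ (hV i j')) (D2C _ (jz J) _ C3).
ring.
Qed.

Lemma CbV_bound : exists2 B : R, 0 <= B & forall i j ls y, (size ls <= 4)%N ->
  `|pders ls (vcoef V i j) y| <= B.
Proof.
have /choice [F hF] : forall ij : 'I_m * 'I_d, exists B : R, 0 <= B /\
    forall ls y, (size ls <= 4)%N -> `|pders ls (vcoef V ij.1 ij.2) y| <= B.
  by move=> [i j]; have [B B0 hB] := Cb_bound (hV i j); exists B.
exists (\sum_ij F ij); first by apply: sumr_ge0 => ij _; case: (hF ij).
move=> i j ls y hs; have [_ h] := hF (i, j).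
apply: le_trans (h ls y hs) _; rewrite (bigD1 (i, j)) //= lerDl.
by apply: sumr_ge0 => ij _; case: (hF ij).
Qed.

Variable B : R.
Hypothesis B0 : 0 <= B.
Hypothesis hB : forall i j ls y, (size ls <= 4)%N -> `|pders ls (vcoef V i j) y| <= B.

(* The constants produced by the rules of [lip] and [ctrl] for each operator;
   the entry 2 is the constant of a component of the jet. *)
Let Kf : R := B * m.+1%:R ^+ 2.
Let kD1 (C Ca : R) : R := m%:R * (3 * C * Ca).
Let kD2 (C Ca Cb : R) : R := m%:R * (3 * kD1 C Ca * Cb).
Let kD3 (C Ca Cb Cc : R) : R := m%:R * (3 * kD2 C Ca Cb * Cc).
Let kL1 : R := kD1 Kf 2.
Let kL2 : R := kD2 Kf 2 2 + kL1.
Let kB0 : R := kD1 Kf Kf.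
Let kB1 : R := kD2 Kf 2 Kf + kD1 Kf kL1.
Let kB2 : R := kD3 Kf 2 2 Kf + kD2 Kf 2 Kf + kD2 Kf kL1 2 + kD2 Kf 2 kL1 + kD1 Kf kL2.

Let kA : R := Kf + kL1 + kL2 + kB0 + kB1 + kB2.

Lemma kD1_ge0 C Ca : 0 <= C -> 0 <= Ca -> 0 <= kD1 C Ca.
Proof. by move=> *; rewrite !mulr_ge0. Qed.
Lemma kD2_ge0 C Ca Cb : 0 <= C -> 0 <= Ca -> 0 <= Cb -> 0 <= kD2 C Ca Cb.
Proof. by move=> *; rewrite !mulr_ge0 ?kD1_ge0. Qed.
Lemma kD3_ge0 C Ca Cb Cc : 0 <= C -> 0 <= Ca -> 0 <= Cb -> 0 <= Cc ->
  0 <= kD3 C Ca Cb Cc.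
Proof. by move=> *; rewrite !mulr_ge0 ?kD2_ge0. Qed.
Lemma Kf_ge0 : 0 <= Kf. Proof. by rewrite mulr_ge0 ?exprn_ge0. Qed.
Lemma kL1_ge0 : 0 <= kL1. Proof. by rewrite kD1_ge0 ?Kf_ge0. Qed.
Lemma kL2_ge0 : 0 <= kL2.
Proof. by rewrite addr_ge0 ?kL1_ge0 ?kD2_ge0 ?Kf_ge0. Qed.
Lemma kB0_ge0 : 0 <= kB0. Proof. by rewrite kD1_ge0 ?Kf_ge0. Qed.
Lemma kB1_ge0 : 0 <= kB1.
Proof. by rewrite addr_ge0 ?kD1_ge0 ?kD2_ge0 ?kL1_ge0 ?Kf_ge0. Qed.
Lemma kB2_ge0 : 0 <= kB2.
Proof. by rewrite !addr_ge0 ?kD1_ge0 ?kD2_ge0 ?kD3_ge0 ?kL1_ge0 ?kL2_ge0 ?Kf_ge0. Qed.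
Lemma kA_ge0 : 0 <= kA.
Proof.
have := Kf_ge0; have := kL1_ge0; have := kL2_ge0; have := kB0_ge0.
have := kB1_ge0; have := kB2_ge0; rewrite /kA.
by move: Kf kL1 kL2 kB0 kB1 kB2 => a b c e f g *; lra.
Qed.
Lemma kA_ge : [/\ Kf <= kA, kL1 <= kA & kL2 <= kA] /\
  [/\ kB0 <= kA, kB1 <= kA & kB2 <= kA].
Proof.
have := Kf_ge0; have := kL1_ge0; have := kL2_ge0; have := kB0_ge0.
have := kB1_ge0; have := kB2_ge0; rewrite /kA.
by move: Kf kL1 kL2 kB0 kB1 kB2 => a b c e f g *; split; split; lra.
Qed.
Hint Resolve Kf_ge0 kL1_ge0 kL2_ge0 : core.

Lemma Cb_pders k ls f : Cb (size ls + k) f -> Cb k (pders (R := R) (m := m) ls f).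
Proof.
elim/last_ind: ls f => [|ls l ih] f //; rewrite size_rcons => fC.
by rewrite pders_rcons; apply: ih; exact: Cb_pder fC.
Qed.

Lemma pders_cat ls ls' (f : 'cV[R]_m -> R) : pders ls (pders ls' f) = pders (ls ++ ls') f.
Proof. by rewrite /pders foldr_cat. Qed.

Lemma Cb_vcoef k ls i j : (size ls + k <= 4)%N -> Cb k (pders ls (vcoef V i j)).
Proof.
move=> h; apply: Cb_pders.
have -> : (size ls + k = 4 - (4 - (size ls + k)))%N by lia.
elim: (4 - (size ls + k))%N => [|q ih]; first exact: hV.
case E : (4 - q)%N ih => [|r] ih; first by rewrite subnS E.
by rewrite subnS E; exact: CbW.
Qed.

Variables (J J' : jet R m) (sc : comp -> R) (D : R).
Hypothesis D01 : 0 <= D <= 1.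
Hypothesis sc0 : forall c, 0 <= sc c.
Hypothesis scy : sc Cy = 1.
Hypothesis scz : sc Cu * sc Cu' <= sc Cz.
Hypothesis hJ : forall c l, c <> Cy -> `|jcomp c J l 0| <= 2 * sc c.
Hypothesis hD : forall c l, `|jcomp c J' l 0 - jcomp c J l 0| <= D * sc c.
Hint Resolve sc0 : core.

Lemma lip_coef ls i j : (size ls <= 3)%N ->
  lip D Kf 1 (pders ls (vcoef V i j) (jy J)) (pders ls (vcoef V i j) (jy J')).
Proof.
move=> h; apply: lip_fun => //.
- by apply: Cb_vcoef; lia.
- by move=> ls' z h'; rewrite pders_cat; apply: hB; rewrite size_cat; lia.
- by move=> l; have := hD Cy l; rewrite scy mulr1.
Qed.

Lemma lip_vfield j l :
  lip D Kf 1 (vfield V j (jy J) l 0) (vfield V j (jy J') l 0).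
Proof. by rewrite !vfieldE; exact: (@lip_coef [::]). Qed.

Lemma lip_comp c l : c <> Cy -> lip D 2 (sc c) (jcomp c J l 0) (jcomp c J' l 0).
Proof.
move=> hc; split=> //; first exact: hJ.
apply: le_trans (hD c l) _; have /andP[D0 _] := D01.
by have := mulr_ge0 D0 (sc0 c); lra.
Qed.

Lemma lip_u l : lip D 2 (sc Cu) (ju J l 0) (ju J' l 0).
Proof. exact: (@lip_comp Cu). Qed.
Lemma lip_u' l : lip D 2 (sc Cu') (ju' J l 0) (ju' J' l 0).
Proof. exact: (@lip_comp Cu'). Qed.
Lemma lip_z l : lip D 2 (sc Cz) (jz J l 0) (jz J' l 0).
Proof. exact: (@lip_comp Cz). Qed.

Lemma lip_opL1 i j :
  lip D kL1 (sc Cu) (opL 1 J (vcoef V i j)) (opL 1 J' (vcoef V i j)).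
Proof.
rewrite /opL !dapp1; apply: lip_D1 => // [l|l]; last exact: lip_u.
exact: (@lip_coef [:: l]).
Qed.

Lemma lip_opL1' i j : lip D kL1 (sc Cu') (opL 1 (jswap J) (vcoef V i j))
  (opL 1 (jswap J') (vcoef V i j)).
Proof.
rewrite /opL !dapp1; apply: lip_D1 => // [l|l]; last exact: lip_u'.
exact: (@lip_coef [:: l]).
Qed.

Lemma lip_opL2 i j :
  lip D kL2 (sc Cz) (opL 2 J (vcoef V i j)) (opL 2 J' (vcoef V i j)).
Proof.
rewrite /opL !dapp1 !dapp2; apply: lipD => //.
- apply: (@lipW _ _ D01 (kD2 Kf 2 2) _ (sc Cu * sc Cu')) => //.
  apply: lip_D2 => // [l l'|l|l]; [exact: (@lip_coef [:: l; l'])| |].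
    exact: lip_u.
  exact: lip_u'.
- by apply: lip_D1 => // [l|l]; [exact: (@lip_coef [:: l])|exact: lip_z].
Qed.

Lemma lip_opLbar0 i j' j : lip D kB0 1 (opLbar 0 J (vcoef V i j') (vfield V j))
  (opLbar 0 J' (vcoef V i j') (vfield V j)).
Proof.
rewrite /opLbar !dapp1; apply: lip_D1 => // [l|l]; last exact: lip_vfield.
exact: (@lip_coef [:: l]).
Qed.

Lemma lip_opLbar1 i j' j : lip D kB1 (sc Cu)
  (opLbar 1 J (vcoef V i j') (vfield V j)) (opLbar 1 J' (vcoef V i j') (vfield V j)).
Proof.
rewrite /opLbar !dapp1 !dapp2; apply: lipD => //.
- rewrite -[sc Cu]mulr1; apply: lip_D2 => // [l l'|l|l].
  + exact: (@lip_coef [:: l; l']).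
  + exact: lip_u.
  + exact: lip_vfield.
- apply: lip_D1 => // [l|l]; first exact: (@lip_coef [:: l]).
  by rewrite !opLvE; exact: lip_opL1.
Qed.

Lemma lip_opLbar1' i j' j : lip D kB1 (sc Cu')
  (opLbar 1 (jswap J) (vcoef V i j') (vfield V j))
  (opLbar 1 (jswap J') (vcoef V i j') (vfield V j)).
Proof.
rewrite /opLbar !dapp1 !dapp2; apply: lipD => //.
- rewrite -[sc Cu']mulr1; apply: lip_D2 => // [l l'|l|l].
  + exact: (@lip_coef [:: l; l']).
  + exact: lip_u'.
  + exact: lip_vfield.
- apply: lip_D1 => // [l|l]; first exact: (@lip_coef [:: l]).
  by rewrite !opLvE; exact: lip_opL1'.
Qed.

Lemma lip_opLbar2 i j' j : lip D kB2 (sc Cz)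
  (opLbar 2 J (vcoef V i j') (vfield V j)) (opLbar 2 J' (vcoef V i j') (vfield V j)).
Proof.
rewrite /opLbar !dapp1 !dapp2 !dapp3; rewrite /kB2.
apply: lipD; first (apply: lipD; first (apply: lipD; first apply: lipD)).
- apply: (@lipW _ _ D01 (kD3 Kf 2 2 Kf) _ (sc Cu * sc Cu' * 1)); rewrite ?mulr1 //.
  rewrite -[X in lip _ _ X]mulr1.
  apply: lip_D3 => // [l l' l''|l|l|l].
  + exact: (@lip_coef [:: l; l'; l'']).
  + exact: lip_u.
  + exact: lip_u'.
  + exact: lip_vfield.
- rewrite -[sc Cz]mulr1; apply: lip_D2 => // [l l'|l|l].
  + exact: (@lip_coef [:: l; l']).
  + exact: lip_z.
  + exact: lip_vfield.
- apply: (@lipW _ _ D01 (kD2 Kf kL1 2) _ (sc Cu * sc Cu')) => //.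
  apply: lip_D2 => // [l l'|l|l].
  + exact: (@lip_coef [:: l; l']).
  + by rewrite !opLvE; exact: lip_opL1.
  + exact: lip_u'.
- apply: (@lipW _ _ D01 (kD2 Kf 2 kL1) _ (sc Cu * sc Cu')) => //.
  apply: lip_D2 => // [l l'|l|l].
  + exact: (@lip_coef [:: l; l']).
  + exact: lip_u.
  + by rewrite !opLvE; exact: lip_opL1'.
- apply: lip_D1 => // [l|l]; first exact: (@lip_coef [:: l]).
  by rewrite !opLvE; exact: lip_opL2.
Qed.

Lemma lip_opc c i j : lip D kA (sc c) (opc c J (vcoef V i j)) (opc c J' (vcoef V i j)).
Proof.
have [[h1 h2 h3] _] := kA_ge.
case: c => /=.
- by rewrite scy; apply: lipW h1 (lexx _) _ => //; exact: (@lip_coef [::]).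
- by apply: lipW h2 (lexx _) _ => //; exact: lip_opL1.
- by apply: lipW h2 (lexx _) _ => //; exact: lip_opL1'.
- by apply: lipW h3 (lexx _) _ => //; exact: lip_opL2.
Qed.

Lemma lip_opcbar c i j' j : lip D kA (sc c)
  (opcbar c J (vcoef V i j') (vfield V j)) (opcbar c J' (vcoef V i j') (vfield V j)).
Proof.
have [_ [h1 h2 h3]] := kA_ge.
case: c => /=.
- by rewrite scy; apply: lipW h1 (lexx _) _ => //; exact: lip_opLbar0.
- by apply: lipW h2 (lexx _) _ => //; exact: lip_opLbar1.
- by apply: lipW h2 (lexx _) _ => //; exact: lip_opLbar1'.
- by apply: lipW h3 (lexx _) _ => //; exact: lip_opLbar2.
Qed.

Variables (x : 'I_d -> R) (E : R).
Hypothesis DE : D ^+ 2 <= E.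
Hypothesis hE : forall c l,
  `|jcomp c J' l 0 - jcomp c J l 0 - \sum_j opc c J (vcoef V l j) * x j| <= E * sc c.

Lemma ctrl_coef ls i j' : (size ls <= 2)%N ->
  ctrl D x E Kf 1 (pders ls (vcoef V i j') (jy J)) (pders ls (vcoef V i j') (jy J'))
    (fun j => D1 (pders ls (vcoef V i j')) (jy J) (vfield V j (jy J))).
Proof.
move=> h; apply: ctrl_fun => //.
- by apply: Cb_vcoef; lia.
- by move=> ls' z h'; rewrite pders_cat; apply: hB; rewrite size_cat; lia.
- by move=> l; have := hD Cy l; rewrite scy mulr1.
- move=> l; have := hE Cy l; rewrite scy mulr1 /=.
  by under [X in _ -> `|_ - X| <= _]eq_bigr do rewrite vfieldE.
Qed.

Lemma ctrl_comp c l : c <> Cy -> ctrl D x E 2 (sc c) (jcomp c J l 0) (jcomp c J' l 0)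
  (fun j => opc c J (vcoef V l j)).
Proof.
move=> hc; split; first exact: lip_comp.
apply: le_trans (hE c l) _; have E0 := E_ge0 DE.
by have := mulr_ge0 E0 (sc0 c); lra.
Qed.

Lemma ctrl_u l : ctrl D x E 2 (sc Cu) (ju J l 0) (ju J' l 0)
  (fun j => opLv 1 J (vfield V j) l 0).
Proof. by apply: eq_ctrl (@ctrl_comp Cu l _) => // j; rewrite opLvE. Qed.
Lemma ctrl_u' l : ctrl D x E 2 (sc Cu') (ju' J l 0) (ju' J' l 0)
  (fun j => opLv 1 (jswap J) (vfield V j) l 0).
Proof. by apply: eq_ctrl (@ctrl_comp Cu' l _) => // j; rewrite opLvE. Qed.
Lemma ctrl_z l : ctrl D x E 2 (sc Cz) (jz J l 0) (jz J' l 0)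
  (fun j => opLv 2 J (vfield V j) l 0).
Proof. by apply: eq_ctrl (@ctrl_comp Cz l _) => // j; rewrite opLvE. Qed.

Lemma ctrl_opL0 i j' : ctrl D x E Kf 1 (opL 0 J (vcoef V i j'))
  (opL 0 J' (vcoef V i j')) (fun j => opLbar 0 J (vcoef V i j') (vfield V j)).
Proof.
by apply: eq_ctrl (@ctrl_coef [::] i j' _) => // j; rewrite /opLbar dapp1.
Qed.

Lemma ctrl_opL1 i j' : ctrl D x E kL1 (sc Cu) (opL 1 J (vcoef V i j'))
  (opL 1 J' (vcoef V i j')) (fun j => opLbar 1 J (vcoef V i j') (vfield V j)).
Proof.
rewrite /opL !dapp1; apply: eq_ctrl => [j|].
  by rewrite opLbar1E; reflexivity.
apply: ctrl_D1 => // l; last exact: ctrl_u.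
exact: (@ctrl_coef [:: l]).
Qed.

Lemma ctrl_opL1' i j' : ctrl D x E kL1 (sc Cu') (opL 1 (jswap J) (vcoef V i j'))
  (opL 1 (jswap J') (vcoef V i j'))
  (fun j => opLbar 1 (jswap J) (vcoef V i j') (vfield V j)).
Proof.
rewrite /opL !dapp1; apply: eq_ctrl => [j|].
  by rewrite opLbar1E; reflexivity.
apply: ctrl_D1 => // l; last exact: ctrl_u'.
exact: (@ctrl_coef [:: l]).
Qed.

Lemma ctrl_opL2 i j' : ctrl D x E kL2 (sc Cz) (opL 2 J (vcoef V i j'))
  (opL 2 J' (vcoef V i j')) (fun j => opLbar 2 J (vcoef V i j') (vfield V j)).
Proof.
rewrite /opL !dapp1 !dapp2; apply: eq_ctrl => [j|].
  by rewrite opLbar2E; reflexivity.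
apply: ctrlD => //.
- apply: (@ctrlW _ _ D01 _ _ _ DE (kD2 Kf 2 2) _ (sc Cu * sc Cu')) => //.
  apply: ctrl_D2 => // [l l'|l|l]; [exact: (@ctrl_coef [:: l; l'])| |].
    exact: ctrl_u.
  exact: ctrl_u'.
- by apply: ctrl_D1 => // l; [exact: (@ctrl_coef [:: l])|exact: ctrl_z].
Qed.

Lemma ctrl_opc c i j' : ctrl D x E kA (sc c) (opc c J (vcoef V i j'))
  (opc c J' (vcoef V i j')) (fun j => opcbar c J (vcoef V i j') (vfield V j)).
Proof.
have [[h1 h2 h3] _] := kA_ge.
case: c => /=.
- by rewrite scy; apply: ctrlW h1 (lexx _) _ => //; exact: ctrl_opL0.
- by apply: ctrlW h2 (lexx _) _ => //; exact: ctrl_opL1.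
- by apply: ctrlW h2 (lexx _) _ => //; exact: ctrl_opL1'.
- by apply: ctrlW h3 (lexx _) _ => //; exact: ctrl_opL2.
Qed.

End Components.

(** The coefficients of a jet measured in scales for which the first two
    multiply to at most the third, as L^2 contains the product u (x) u'. These
    are the four hypotheses of the sewing estimate: size of the coefficients,
    increment of the second order one, and expansion of the first order one. *)
Lemma jet_bounds (R : realType) (m d : nat) (V : 'cV[R]_m -> 'M[R]_(m, d)) :
  CbV V 4 -> exists2 C : R, 0 <= C &
  forall (J J' : jet R m) (sc : comp -> R) (D : R), 0 <= D <= 1 ->
  (forall c, 0 <= sc c) -> sc Cy = 1 -> sc Cu * sc Cu' <= sc Cz ->
  (forall c l, c <> Cy -> `|jcomp c J l 0| <= 2 * sc c) ->
  (forall c l, `|jcomp c J' l 0 - jcomp c J l 0| <= D * sc c) ->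
  forall c i j j',
  [/\ `|opc c J (vcoef V i j')| <= C * sc c,
      `|opcbar c J (vcoef V i j') (vfield V j)| <= C * sc c,
      `|opcbar c J' (vcoef V i j') (vfield V j)
        - opcbar c J (vcoef V i j') (vfield V j)| <= C * D * sc c &
      forall (x : 'I_d -> R) (E : R), D ^+ 2 <= E ->
        (forall c l, `|jcomp c J' l 0 - jcomp c J l 0
          - \sum_j opc c J (vcoef V l j) * x j| <= E * sc c) ->
        `|opc c J' (vcoef V i j') - opc c J (vcoef V i j')
          - \sum_j opcbar c J (vcoef V i j') (vfield V j) * x j| <= C * E * sc c].
Proof.
move=> hV; have [B B0 hB] := CbV_bound hV.
eexists; first exact: (@kA_ge0 R m B B0).
move=> J J' sc D D01 sc0 scy scz hJ hD c i j j'.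
have [_ _ h1 _] := @lip_opc _ _ _ V hV B B0 hB J J' sc D D01 sc0 scy scz hJ hD c i j'.
have [_ _ h2 h3] :=
  @lip_opcbar _ _ _ V hV B B0 hB J J' sc D D01 sc0 scy scz hJ hD c i j' j.
split=> // x E DE hE.
by have [_] := @ctrl_opc _ _ _ V hV B B0 hB J J' sc D D01 sc0 scy scz hJ hD
  x E DE hE c i j'.
Qed.

(** * Estimates on intervals where the control is at most 1 *)

Section Scales.
Context {R : realType} {m : nat}.
Implicit Types (J : jet R m).

(** The natural size of each component: P^1 for u and u', P^2 for z. *)
Definition csc (c : comp) J : R :=
  match c with
  | Cy => 1 | Cu => Pmax 1 J | Cu' => Pmax 1 (jswap J) | Cz => Pmax 2 J end.

(** The power in which a common factor of all the components enters the scale: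
    P^2 contains |u| |u'|. *)
Definition cdeg (c : comp) : nat := if c is Cz then 2 else 1.

Lemma csc_ge1 c J : 1 <= csc c J.
Proof. by case: c; rewrite /= ?lexx // !le_max lexx. Qed.

Lemma csc_ge0 c J : 0 <= csc c J.
Proof. exact: le_trans ler01 (csc_ge1 c J). Qed.

Lemma csc_mul J : csc Cu J * csc Cu' J <= csc Cz J.
Proof.
rewrite /csc /Pmax /=; set a := enorm _; set b := enorm _; set z := enorm _.
have a0 : 0 <= a := enorm_ge0 _; have b0 : 0 <= b := enorm_ge0 _.
rewrite !le_max -!orbA.
case: (leP 1 a) => ha; case: (leP 1 b) => hb; rewrite ?mulr1 ?mul1r.
- by rewrite lexx !orbT.
- by rewrite lexx !orbT.
- by rewrite lexx !orbT.
- by rewrite lexx.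
Qed.

Lemma csc_le_z c J : csc c J <= csc Cz J.
Proof.
have h := csc_mul J.
have h1 := csc_ge1 Cu J; have h2 := csc_ge1 Cu' J.
case: c => //; first exact: csc_ge1.
- by apply: le_trans h; rewrite ler_peMr // csc_ge0.
- by apply: le_trans h; rewrite ler_peMl // csc_ge0.
Qed.

Lemma enorm_le_csc c J : c <> Cy -> enorm (jcomp c J) <= csc c J.
Proof. by case: c => //= _; rewrite !le_max lexx !orbT. Qed.

Lemma jcomp_le_csc c J i : c <> Cy -> `|jcomp c J i 0| <= csc c J.
Proof.
by move=> hc; apply: le_trans (enorm_le_csc _ hc); exact: coord_le_enorm.
Qed.

(** A relative increment eta multiplies |u| and |u'| by 1 + m * eta, hence the
    product in P^2 by its square. *)
Lemma csc_growth J J' (eta : R) : 0 <= eta ->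
  (forall c i, c <> Cy -> `|jcomp c J' i 0 - jcomp c J i 0| <= eta * csc c J) ->
  forall c, csc c J' <= (1 + m%:R * eta) ^+ cdeg c * csc c J.
Proof.
move=> eta0 h.
set q := 1 + m%:R * eta.
have q1 : 1 <= q by rewrite lerDl mulr_ge0.
have q12 : q <= q ^+ 2 by rewrite expr2 ler_peMr // (le_trans ler01).
have qs1 : 1 <= q ^+ 2 by exact: le_trans q12.
have hn c : c <> Cy -> enorm (jcomp c J') <= q * csc c J.
  move=> hc; have -> : jcomp c J' = jcomp c J + (jcomp c J' - jcomp c J).
    by rewrite addrCA subrr addr0.
  apply: le_trans (enormD _ _) _; rewrite mulrDl mul1r -mulrA.
  apply: lerD; first exact: enorm_le_csc.
  apply: enorm_cV_le; first by rewrite mulr_ge0 // csc_ge0.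
  by move=> i; rewrite !mxE; exact: h.
have g1 c : 1 <= q * csc c J.
  have := ler_pM ler01 ler01 q1 (csc_ge1 c J); by rewrite mulr1.
have hu : enorm (ju J') <= q * csc Cu J by exact: (hn Cu).
have hu' : enorm (ju' J') <= q * csc Cu' J by exact: (hn Cu').
have hz : enorm (jz J') <= q * csc Cz J by exact: (hn Cz).
have a1 := csc_le_z Cu J; have a2 := csc_le_z Cu' J; have a3 := csc_mul J.
have b1 := csc_ge1 Cu J; have b2 := csc_ge1 Cu' J; have b3 := csc_ge1 Cz J.
case.
- by rewrite /= expr1 mulr1.
- by rewrite expr1 ge_max g1.
- by rewrite expr1 ge_max g1.
have mono t : t <= csc Cz J -> q * t <= q ^+ 2 * csc Cz J.
  move=> ht; apply: (@le_trans _ _ (q * csc Cz J)).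
    by rewrite ler_wpM2l // (le_trans ler01).
  by rewrite ler_wpM2r // csc_ge0.
rewrite /= !ge_max; apply/andP; split; last first.
  exact: le_trans hz (mono _ (lexx _)).
apply/andP; split; last first.
  apply: le_trans (ler_pM (enorm_ge0 _) (enorm_ge0 _) hu hu') _.
  by rewrite mulrACA -expr2 ler_wpM2l // sqr_ge0.
apply/and3P; split.
- exact: le_trans (g1 Cz) (mono _ (lexx _)).
- exact: le_trans hu (mono _ a1).
- exact: le_trans hu' (mono _ a2).
Qed.

End Scales.

(** What the scheme sees of the driving path: its increments X and a second
    level B, from which the sum of the corrections of the grid intervals has
    been compensated. The relation for B is Chen's. *)
Record grid_driver (R : realType) (d : nat) (p : R) (n : nat)
  (X : 'I_d -> nat -> nat -> R) (B : 'I_d -> 'I_d -> nat -> nat -> R)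
  (om : nat -> nat -> R) : Prop := GridDriver {
  gd_ge0 : forall k l, (k <= l)%N -> (l <= n)%N -> 0 <= om k l;
  gd_super : forall k u l, (k <= u)%N -> (u <= l)%N -> (l <= n)%N ->
    om k u + om u l <= om k l;
  gd_X : forall j k l, (k <= l)%N -> (l <= n)%N -> `|X j k l| <= om k l `^ p^-1;
  gd_B : forall j j' k l, (k <= l)%N -> (l <= n)%N ->
    `|B j j' k l| <= 2 * (om k l `^ p^-1) ^+ 2;
  gd_XD : forall j k u l, (k <= u)%N -> (u <= l)%N -> (l <= n)%N ->
    X j k l = X j k u + X j u l;
  gd_BD : forall j j' k u l, (k <= u)%N -> (u <= l)%N -> (l <= n)%N ->
    B j j' k l = B j j' k u + B j j' u l + X j k u * X j' u l }.

Definition jet_step (R : realType) (m d : nat) (V : 'cV[R]_m -> 'M[R]_(m, d))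
    (X : 'I_d -> nat -> nat -> R) (B : 'I_d -> 'I_d -> nat -> nat -> R)
    (J : nat -> jet R m) (k : nat) : Prop :=
  forall c i, jcomp c (J k.+1) i 0 - jcomp c (J k) i 0 =
    \sum_j opc c (J k) (vcoef V i j) * X j k k.+1
    + \sum_j \sum_j' opcbar c (J k) (vcoef V i j') (vfield V j) * B j j' k k.+1.

Section LocalEstimates.
Context {R : realType} {m d : nat}.
Variables (V : 'cV[R]_m -> 'M[R]_(m, d)) (p : R).
Hypotheses (hV : CbV V 4) (p0 : 0 < p).

Lemma op_bounds : exists2 C : R, 0 <= C & forall (J : jet R m) c i j j',
  `|opc c J (vcoef V i j)| <= C * csc c J /\
  `|opcbar c J (vcoef V i j') (vfield V j)| <= C * csc c J.
Proof.
have [C C0 hC] := jet_bounds hV; exists C => // J c i j j'.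
have D01 : 0 <= (0 : R) <= 1 by rewrite lexx ler01.
have h1 c' l : c' <> Cy -> `|jcomp c' J l 0| <= 2 * csc c' J.
  move=> hc; apply: le_trans (jcomp_le_csc J l hc) _.
  by have := csc_ge0 c' J; lra.
have h2 c' l : `|jcomp c' J l 0 - jcomp c' J l 0| <= 0 * csc c' J.
  by rewrite subrr normr0 mul0r.
have hh j1 j2 := hC J J (csc ^~ J) 0 D01 (csc_ge0 ^~ J) erefl (csc_mul J) h1 h2 c i j1 j2.
by split; [case: (hh j j)|case: (hh j j')].
Qed.

(** The sewing estimate applied to the coordinates of the four components, with
    the scales of the left end point. Within the region the components are at
    most twice these scales, so that the coefficients are bounded there. *)
Lemma small_interval : p < 3 -> exists2 eps : R, 0 < eps & exists2 C : R, 1 <= C &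
  forall n X B om (J : nat -> jet R m) s N, grid_driver p n X B om ->
  (s <= N)%N -> (N <= n)%N ->
  (forall k, (s <= k)%N -> (k < N)%N -> jet_step V X B J k) ->
  let h := om s N `^ p^-1 in h <= eps -> forall c i,
  `|jcomp c (J N) i 0 - jcomp c (J s) i 0 - \sum_j opc c (J s) (vcoef V i j) * X j s N|
    <= C * h ^+ 2 * csc c (J s) /\
  `|jcomp c (J N) i 0 - jcomp c (J s) i 0| <= C * h * csc c (J s).
Proof.
move=> p3; have [C C0 hC] := jet_bounds hV.
have [eps eps0 [C' C'1 hS]] := discrete_sewing d p0 p3 C0.
exists eps => //; exists C' => // n X B om J s N [g1 g2 g3 g4 g5 g6] sN Nn st h hh c i.
have regb k : (forall ci : comp * 'I_m, `|jcomp ci.1 (J k) ci.2 0 - jcomp ci.1 (J s) ci.2 0|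
      <= csc ci.1 (J s)) ->
    forall c l, c <> Cy -> `|jcomp c (J k) l 0| <= 2 * csc c (J s).
  move=> hr c' l hc.
  have := hr (c', l); have := jcomp_le_csc (J s) l hc => /=.
  have := ler_normD (jcomp c' (J s) l 0) (jcomp c' (J k) l 0 - jcomp c' (J s) l 0).
  by rewrite addrCA subrr addr0; lra.
have D01 : 0 <= (0 : R) <= 1 by rewrite lexx ler01.
have h2 k c' l : `|jcomp c' (J k) l 0 - jcomp c' (J k) l 0| <= 0 * csc c' (J s).
  by rewrite subrr normr0 mul0r.
have le a b e : (a <= b -> b <= e -> a <= e)%N by exact: leq_trans.
apply: (hS (comp * 'I_m)%type (fun ci k => jcomp ci.1 (J k) ci.2 0)
  (fun ci j k => opc ci.1 (J k) (vcoef V ci.2 j))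
  (fun ci j j' k => opcbar ci.1 (J k) (vcoef V ci.2 j') (vfield V j))
  X B om (fun ci => csc ci.1 (J s)) s N) (c, i) => //.
- by move=> k l _ kl lN; apply: g1 => //; exact: le Nn.
- by move=> k u l _ ku ul lN; apply: g2 => //; exact: le Nn.
- by move=> j k l _ kl lN; apply: g3 => //; exact: le Nn.
- by move=> j j' k l _ kl lN; apply: g4 => //; exact: le Nn.
- by move=> j k u l _ ku ul lN; apply: g5 => //; exact: le Nn.
- by move=> j j' k u l _ ku ul lN; apply: g6 => //; exact: le Nn.
- by move=> [c' i'] k sk kN; exact: st.
- by move=> [c' i']; exact: csc_ge0.
- move=> [c' i'] j k sk kN rk.
  by have [] := hC (J k) (J k) (csc ^~ (J s)) 0 D01 (csc_ge0 ^~ _) erefl (csc_mul _)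
    (regb k rk) (h2 k) c' i' j j.
- move=> [c' i'] j j' k sk kN rk.
  by have [] := hC (J k) (J k) (csc ^~ (J s)) 0 D01 (csc_ge0 ^~ _) erefl (csc_mul _)
    (regb k rk) (h2 k) c' i' j j'.
- move=> [c' i'] j j' k u D sk ku uN rk ru D01' hD.
  by have [] := hC (J k) (J u) (csc ^~ (J s)) D D01' (csc_ge0 ^~ _) erefl (csc_mul _)
    (regb k rk) (fun c l => hD (c, l)) c' i' j j'.
- move=> [c' i'] j' k u D E sk ku uN rk ru D01' DE hD hE.
  have [_ _ _ hh'] := hC (J k) (J u) (csc ^~ (J s)) D D01' (csc_ge0 ^~ _) erefl (csc_mul _)
    (regb k rk) (fun c l => hD (c, l)) c' i' j' j'.
  by apply: hh' => // c1 l1; exact: (hE (c1, l1)).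
Qed.

Section Driver.
Variables (n : nat) (X : 'I_d -> nat -> nat -> R)
  (B : 'I_d -> 'I_d -> nat -> nat -> R) (om : nat -> nat -> R).
Hypothesis gd : grid_driver p n X B om.

Lemma om_mono k l k' l' : (k' <= k)%N -> (k <= l)%N -> (l <= l')%N -> (l' <= n)%N ->
  om k l <= om k' l'.
Proof.
move=> a b c e; have b' := leq_trans b c.
have h1 := gd_super gd a b' e; have h2 := gd_super gd b c e.
have h3 := gd_ge0 gd a (leq_trans b' e); have h4 := gd_ge0 gd c e.
by lra.
Qed.

Lemma om_powR_mono k l k' l' : (k' <= k)%N -> (k <= l)%N -> (l <= l')%N ->
  (l' <= n)%N -> om k l `^ p^-1 <= om k' l' `^ p^-1.
Proof.
move=> a b c e; have ip : 0 <= p^-1 by rewrite invr_ge0 ltW.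
apply: ge0_ler_powR => //; rewrite ?nnegrE.
- by apply: (gd_ge0 gd) => //; exact: leq_trans e.
- by apply: (gd_ge0 gd) => //; exact: leq_trans a (leq_trans b c).
- exact: om_mono.
Qed.

(** The scheme is explicit, so that one step is linear in the driver even when
    the driver is large: this serves on the long steps, those of S_2 and those
    that separate small intervals. *)
Lemma one_step (C : R) (J : nat -> jet R m) k (x b : R) : 0 <= C -> 0 <= x -> 0 <= b ->
  (forall (J : jet R m) c i j j', `|opc c J (vcoef V i j)| <= C * csc c J /\
    `|opcbar c J (vcoef V i j') (vfield V j)| <= C * csc c J) ->
  jet_step V X B J k ->
  (forall j, `|X j k k.+1| <= x) -> (forall j j', `|B j j' k k.+1| <= b) ->
  forall c i, `|jcomp c (J k.+1) i 0 - jcomp c (J k) i 0| <=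
    (d%:R * C * x + d%:R ^+ 2 * C * b) * csc c (J k).
Proof.
move=> C0 x0 b0 hC st hX hB c i; rewrite st.
have t1 j : `|opc c (J k) (vcoef V i j) * X j k k.+1| <= C * csc c (J k) * x.
  by rewrite normrM ler_pM //; case: (hC (J k) c i j j).
have t2 j j' : `|opcbar c (J k) (vcoef V i j') (vfield V j) * B j j' k k.+1|
    <= C * csc c (J k) * b.
  by rewrite normrM ler_pM //; case: (hC (J k) c i j j').
apply: le_trans (ler_normD _ _) _.
apply: le_trans (lerD (norm_sum_le t1) (norm_sum_le (fun j => norm_sum_le (t2 j)))) _.
by rewrite le_eqVlt; apply/orP; left; apply/eqP; ring.
Qed.

(** This is the case of a vanishing threshold, where the intervals of S_0 and
    S_1 have no mass and the driver is trivial on them. *)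
Lemma constant_when_om0 (J : nat -> jet R m) s N : (s <= N)%N -> (N <= n)%N ->
  (forall k, (s <= k)%N -> (k < N)%N -> jet_step V X B J k) -> om s N = 0 ->
  (forall c i, jcomp c (J N) i 0 = jcomp c (J s) i 0) /\ (forall j, X j s N = 0).
Proof.
move=> sN Nn st om0.
have i0 : p^-1 != 0 by rewrite invr_neq0 // gt_eqF.
split; last first.
  move=> j; have := gd_X gd j sN Nn; rewrite om0 powR0 // normr_le0.
  by move/eqP.
elim: N sN Nn st om0 => [|N IH] sN Nn st om0 c i.
  by have -> : s = 0%N by lia.
move: sN; rewrite leq_eqVlt => /orP[/eqP -> //|]; rewrite ltnS => sN.
have z k l : (s <= k)%N -> (k <= l)%N -> (l <= N.+1)%N -> om k l = 0.
  move=> a b e; apply/eqP; rewrite eq_le (gd_ge0 gd b (leq_trans e Nn)) andbT.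
  by rewrite -om0; apply: om_mono.
have NN := leqnSn N.
rewrite -(IH sN (leq_trans NN Nn)) //; last first.
- exact: z.
- by move=> k a b; apply: st => //; exact: leq_trans b NN.
apply/eqP; rewrite -subr_eq0 (st N sN (ltnSn N)) big1 ?add0r => [|j _].
  rewrite big1 // => j _; rewrite big1 // => j' _.
  have := gd_B gd j j' NN Nn; rewrite z // powR0 // expr0n mulr0 normr_le0.
  by move/eqP => ->; rewrite mulr0.
have := gd_X gd j NN Nn; rewrite z // powR0 // normr_le0.
by move/eqP => ->; rewrite mulr0.
Qed.

End Driver.

(** The interval is cut greedily into pieces of mass at most eps ^ p and single
    steps; each pair consisting of a piece and a step uses up mass eps ^ p, so
    that their number is bounded. The scales grow by a bounded factor on each
    of them. *)
Lemma unit_interval_growth : p < 3 -> exists2 K : R, 1 <= K &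
  forall n X B om (J : nat -> jet R m) s N, grid_driver p n X B om ->
  (s <= N)%N -> (N <= n)%N ->
  (forall k, (s <= k)%N -> (k < N)%N -> jet_step V X B J k) ->
  om s N <= 1 -> forall c, csc c (J N) <= K * csc c (J s).
Proof.
move=> p3; have [eps eps0 [C1 C11 hS]] := small_interval p3.
have [C C0 hC] := op_bounds.
pose eta : R := C1 + d%:R * C + 2 * d%:R ^+ 2 * C.
have eta0 : 0 <= eta by rewrite !addr_ge0 ?mulr_ge0 ?exprn_ge0 //; lra.
have q1 : 1 <= 1 + m%:R * eta by rewrite lerDl mulr_ge0.
have [kap kap1 kap_c] : exists2 kap : R, 1 <= kap &
    forall c, (1 + m%:R * eta) ^+ cdeg c <= kap.
  exists ((1 + m%:R * eta) ^+ 2); first by rewrite exprn_ege1.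
  by case; apply: ler_weXn2l.
pose al : R := eps `^ p.
have al0 : 0 < al by exact: powR_gt0.
have om_root n (X : 'I_d -> nat -> nat -> R) B om s N : grid_driver p n X B om -> (s <= N)%N -> (N <= n)%N ->
    forall a, om s N <= a -> om s N `^ p^-1 <= a `^ p^-1.
  move=> gd sN Nn a h; have ip : 0 <= p^-1 by rewrite invr_ge0 ltW.
  have o0 := gd_ge0 gd sN Nn.
  by apply: ge0_ler_powR => //; rewrite ?nnegrE // (le_trans o0).
have small_growth n X B om (J : nat -> jet R m) s N : grid_driver p n X B om ->
    (s <= N)%N -> (N <= n)%N ->
    (forall k, (s <= k)%N -> (k < N)%N -> jet_step V X B J k) ->
    om s N <= 1 -> om s N <= al -> forall c, csc c (J N) <= kap * csc c (J s).
  move=> gd sN Nn st om1 omal c.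
  have h1 := om_root _ _ _ _ _ _ gd sN Nn _ om1; rewrite powR1 in h1.
  have h2 := om_root _ _ _ _ _ _ gd sN Nn _ omal.
  have e : al `^ p^-1 = eps by rewrite /al -powRrM mulfV ?gt_eqF // powRr1 // ltW.
  rewrite e in h2.
  apply: le_trans (csc_growth eta0 _ c) _ => [c' i _|].
    have [_] := hS n X B om J s N gd sN Nn st h2 c' i.
    move/le_trans; apply; rewrite ler_wpM2r ?csc_ge0 //.
    apply: (@le_trans _ _ C1); first by rewrite ler_piMr //; lra.
    by rewrite /eta -addrA lerDl addr_ge0 ?mulr_ge0 ?exprn_ge0.
  by rewrite ler_wpM2r ?csc_ge0.
suff claim q n X B om (J : nat -> jet R m) s N : grid_driver p n X B om ->
  (s <= N)%N -> (N <= n)%N ->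
  (forall k, (s <= k)%N -> (k < N)%N -> jet_step V X B J k) ->
  om s N <= 1 -> om s N <= q%:R * al ->
  forall c, csc c (J N) <= kap ^+ (2 * q).+1 * csc c (J s).
  exists (kap ^+ (2 * (Num.truncn al^-1).+1).+1); first exact: exprn_ege1.
  move=> n X B om J s N gd sN Nn st om1; apply: (claim _ n X B om J s N gd sN Nn st om1).
  apply: le_trans om1 _; rewrite -ler_pdivrMr // mul1r ltW //.
  exact: truncnS_gt.
elim: q n X B om J s N => [|q IH] n X B om J s N gd sN Nn st om1 omq c.
  by apply: small_growth gd sN Nn st om1 _ c; rewrite mul0r in omq; lra.
have [omal|omal] := leP (om s N) al.
  apply: le_trans (small_growth n X B om J s N gd sN Nn st om1 omal c) _.
  by rewrite ler_wpM2r ?csc_ge0 // -[X in X <= _]expr1 ler_weXn2l.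
have om_ss : om s s = 0.
  have sn := leq_trans sN Nn; have := gd_super gd (leqnn s) (leqnn s) sn.
  by have := gd_ge0 gd (leqnn s) sn; lra.
have ex : exists u, (s <= u <= N)%N && (om s u <= al).
  by exists s; rewrite leqnn sN om_ss ltW.
have ub u : (s <= u <= N)%N && (om s u <= al) -> (u <= N)%N by case/andP=> /andP[].
case: (ex_maxnP ex ub) => u /andP[/andP[su uN] h1] hmax.
have {}uN : (u < N)%N.
  rewrite ltn_neqAle uN andbT; apply/eqP => e; move: h1; rewrite e.
  by rewrite leNgt omal.
have h2 : al < om s u.+1.
  rewrite ltNge; apply/negP => h3; have := hmax u.+1; rewrite h3 uN ltnn.
  by rewrite (leq_trans su (leqnSn u)) => /(_ isT).
have su1 := leq_trans su (leqnSn u); have un := leq_trans uN Nn.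
have h3 : om u.+1 N <= q%:R * al.
  have := gd_super gd su1 uN Nn; move: omq; rewrite -natr1 mulrDl mul1r; lra.
have o1 : om u.+1 N <= 1 by apply: le_trans om1; exact: (om_mono gd).
have o2 : om u u.+1 <= 1 by apply: le_trans om1; exact: (om_mono gd).
have o3 : om s u <= 1 by apply: le_trans om1; apply: (om_mono gd) => //; exact: ltnW.
have g1 : csc c (J u) <= kap * csc c (J s).
  apply: small_growth gd su (ltnW un) _ o3 h1 c => k sk ku.
  by apply: st => //; exact: ltn_trans uN.
have r1 := om_root _ _ _ _ _ _ gd (leqnSn u) un _ o2; rewrite powR1 in r1.
have g2 : csc c (J u.+1) <= kap * csc c (J u).
  apply: le_trans (@csc_growth _ _ (J u) (J u.+1) eta eta0 _ c) _; last first.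
    by rewrite ler_wpM2r ?csc_ge0.
  move=> c' i _.
  apply: le_trans (@one_step X B C J u 1 2 C0 ler01 _ hC _ _ _ c' i) _ => //.
  - exact: st.
  - by move=> j; apply: le_trans r1; exact: (gd_X gd).
  - move=> j j'; apply: le_trans (gd_B gd j j' (leqnSn u) un) _.
    by rewrite ler_piMr // exprn_ile1 // powR_ge0.
  rewrite ler_wpM2r ?csc_ge0 // /eta mulr1 -addrA.
  have -> : d%:R ^+ 2 * C * 2 = 2 * d%:R ^+ 2 * C :> R by ring.
  by rewrite lerDr (le_trans ler01).
have g3 := IH n X B om J u.+1 N gd uN Nn _ o1 h3 c.
apply: le_trans (g3 _) _; first by move=> k sk; apply: st; exact: leq_trans su1 sk.
have k0 : 0 <= kap by exact: le_trans ler01 kap1.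
have e : kap ^+ (2 * q.+1).+1 = kap ^+ (2 * q).+1 * (kap * kap).
  have -> : (2 * q.+1).+1 = ((2 * q).+1 + 2)%N by rewrite mulnS addnC.
  by rewrite exprD; congr (_ * _); exact: expr2.
rewrite e -!mulrA; apply: ler_wpM2l; first exact: exprn_ge0.
exact: le_trans g2 (ler_wpM2l k0 g1).
Qed.

(** Either h <= eps and the sewing estimate applies, or h ^ 2 and h are bounded
    below and the crude bound of [unit_interval_growth] is of the same
    order. *)
Lemma unit_interval : exists2 K : R, 1 <= K &
  forall n X B om (J : nat -> jet R m) s N, grid_driver p n X B om ->
  (s <= N)%N -> (N <= n)%N ->
  (forall k, (s <= k)%N -> (k < N)%N -> jet_step V X B J k) ->
  om s N <= 1 -> p < 3 \/ om s N = 0 ->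
  let h := om s N `^ p^-1 in forall c i, c <> Cy ->
  `|jcomp c (J N) i 0 - jcomp c (J s) i 0 - \sum_j opc c (J s) (vcoef V i j) * X j s N|
    <= K * h ^+ 2 * csc c (J s) /\
  `|jcomp c (J N) i 0 - jcomp c (J s) i 0| <= K * h * csc c (J s).
Proof.
have triv (K : R) n X B om (J : nat -> jet R m) s N : 1 <= K -> grid_driver p n X B om ->
  (s <= N)%N -> (N <= n)%N ->
  (forall k, (s <= k)%N -> (k < N)%N -> jet_step V X B J k) -> om s N = 0 ->
  let h := om s N `^ p^-1 in forall c i,
  `|jcomp c (J N) i 0 - jcomp c (J s) i 0 - \sum_j opc c (J s) (vcoef V i j) * X j s N|
    <= K * h ^+ 2 * csc c (J s) /\
  `|jcomp c (J N) i 0 - jcomp c (J s) i 0| <= K * h * csc c (J s).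
  move=> K1 gd sN Nn st om0 h c i.
  have [e1 e2] := constant_when_om0 gd sN Nn st om0.
  rewrite e1 subrr big1 ?subrr ?normr0 => [|j _]; last by rewrite e2 mulr0.
  by rewrite !mulr_ge0 ?exprn_ge0 ?powR_ge0 ?csc_ge0 //; lra.
have [p3|p3] := ltP p 3; last first.
  exists 1 => // n X B om J s N gd sN Nn st om1 [//|om0] h c i _.
  exact: triv gd sN Nn st om0 c i.
have [eps eps0 [C1 C11 hS]] := small_interval p3.
have [C C0 hC] := op_bounds.
have [K2 K21 hK] := unit_interval_growth p3.
pose A : R := K2 + 1 + d%:R * C.
have A0 : 0 <= A by rewrite !addr_ge0 ?mulr_ge0 //; lra.
have e0 : 0 <= eps^-1 by rewrite invr_ge0 ltW.
pose K := C1 + A * (eps ^- 2) + A * eps^-1.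
have K1 : 1 <= K.
  have : 0 <= A * (eps ^- 2) by rewrite mulr_ge0 // invr_ge0 exprn_ge0 // ltW.
  by have := mulr_ge0 A0 e0; rewrite /K; lra.
exists K => // n X B om J s N gd sN Nn st om1 _ h c i hc.
have h0 : 0 <= h by exact: powR_ge0.
have h1 : h <= 1.
  have ip : 0 <= p^-1 by rewrite invr_ge0 ltW.
  have e1 : (1 : R) `^ p^-1 = 1 by rewrite powR1.
  rewrite -[leRHS]e1; apply: ge0_ler_powR => //; rewrite ?nnegrE //.
  exact: (gd_ge0 gd).
have s0 := csc_ge0 c (J s).
have C1K : C1 <= K.
  rewrite /K -addrA lerDl addr_ge0 ?mulr_ge0 //.
  by rewrite invr_ge0 exprn_ge0 // ltW.
have [he|he] := leP h eps.
  have [b1 b2] := hS n X B om J s N gd sN Nn st he c i; split.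
    by apply: le_trans b1 _; rewrite ler_wpM2r // ler_wpM2r // exprn_ge0.
  by apply: le_trans b2 _; rewrite ler_wpM2r // ler_wpM2r.
have g := hK n X B om J s N gd sN Nn st om1 c.
have d1 : `|jcomp c (J N) i 0 - jcomp c (J s) i 0| <= (K2 + 1) * csc c (J s).
  apply: le_trans (ler_normB _ _) _; rewrite mulrDl mul1r.
  apply: lerD; last exact: jcomp_le_csc.
  by apply: le_trans g; exact: jcomp_le_csc.
have d2 : `|\sum_j opc c (J s) (vcoef V i j) * X j s N| <= d%:R * (C * csc c (J s)).
  apply: norm_sum_le => j; rewrite normrM -[leRHS]mulr1 ler_pM //.
    by case: (hC (J s) c i j j).
  by apply: le_trans h1; exact: (gd_X gd).
have he1 : 1 <= h / eps by rewrite ler_pdivlMr // mul1r ltW.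
split.
  apply: le_trans (ler_normB _ _) _; apply: le_trans (lerD d1 d2) _.
  have -> : (K2 + 1) * csc c (J s) + d%:R * (C * csc c (J s)) = A * csc c (J s).
    by rewrite /A; ring.
  rewrite ler_wpM2r //; apply: (@le_trans _ _ (A * eps ^- 2 * h ^+ 2)).
    rewrite -mulrA ler_peMr // mulrC -exprVn -exprMn; exact: exprn_ege1.
  rewrite ler_wpM2r ?exprn_ge0 // /K -addrA addrC -addrA lerDl addr_ge0 //.
    exact: mulr_ge0.
  by lra.
apply: le_trans d1 _; rewrite ler_wpM2r //.
apply: (@le_trans _ _ (A * eps^-1 * h)).
  rewrite -mulrA mulrC -[X in X <= _]mul1r ler_pM //; first lra.
    by rewrite mulrC.
  by rewrite /A lerDl mulr_ge0.
rewrite ler_wpM2r // /K lerDr addr_ge0 ?mulr_ge0 //; first lra.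
by rewrite invr_ge0 exprn_ge0 // ltW.
Qed.

End LocalEstimates.

(** * Discrete variation and the control *)

Section DiscreteVariation.
Context {R : realType}.
Variables (rho : R) (n : nat) (g : nat -> nat -> R).
Hypothesis rho0 : 0 < rho.
Hypothesis g_diag : forall k, (k <= n)%N -> g k k = 0.

Definition vsum (u : seq nat) : R :=
  \sum_(i < (size u).-1) g (nth 0%N u i) (nth 0%N u i.+1) `^ rho.

Lemma vsum_cons2 x y s : vsum [:: x, y & s] = g x y `^ rho + vsum (y :: s).
Proof. by rewrite /vsum /= big_ord_recl. Qed.

Lemma vsum1 x : vsum [:: x] = 0. Proof. by rewrite /vsum big_ord0. Qed.
Lemma vsum0 : vsum [::] = 0. Proof. by rewrite /vsum big_ord0. Qed.

Lemma vsum_cat u v : vsum u + vsum v <= vsum (u ++ v).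
Proof.
elim: u => [|x [|y u] IH]; first by rewrite vsum0 add0r.
  rewrite vsum1 add0r /=; case: v {IH} => [|y v]; first by rewrite vsum0 vsum1.
  by rewrite vsum_cons2 lerDr powR_ge0.
by rewrite /= !vsum_cons2 -addrA lerD2l.
Qed.

Let m0 : R := \sum_(i < n.+1) \sum_(j < n.+1) g i j `^ rho.

Lemma g_le_m0 k l : (k <= n)%N -> (l <= n)%N -> g k l `^ rho <= m0.
Proof.
move=> kn ln; rewrite /m0 (bigD1 (inord k)) //= (bigD1 (inord l)) //=.
rewrite !inordK // -addrA lerDl addr_ge0 ?sumr_ge0 // => i _.
  exact: powR_ge0.
by apply: sumr_ge0 => j _; exact: powR_ge0.
Qed.

Lemma m0_ge0 : 0 <= m0.
Proof. by do 2 (apply: sumr_ge0 => ? _); exact: powR_ge0. Qed.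

(** The sequence may repeat points, but only steps that move contribute, and
    there are at most last x s - x of them. This makes the supremum finite. *)
Lemma vsum_bound x s : path leq x s -> all (leq^~ n) (x :: s) ->
  vsum (x :: s) <= m0 * (last x s - x)%:R.
Proof.
elim: s x => [|y s IH] x /=; first by rewrite vsum1 subnn mulr0.
move=> /andP[xy ys] /and3P[xn yn sn].
have h := IH y ys (introT andP (conj yn sn)).
have yl : (y <= last y s)%N.
  have := ys; rewrite path_sortedE; last exact: leq_trans.
  move=> /andP[/allP al _]; have := mem_last y s; rewrite inE => /orP[/eqP ->//|].
  exact: al.
rewrite vsum_cons2.
have -> : (last y s - x = (y - x) + (last y s - y))%N by lia.
rewrite natrD mulrDr; apply: lerD => //.
have [xy'|] := eqVneq x y.
  by rewrite -xy' subnn mulr0 g_diag // powR0 // gt_eqF.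
move=> xy'; apply: le_trans (g_le_m0 xn yn) _.
rewrite ler_peMr ?m0_ge0 // ler1n; lia.
Qed.

Lemma vsum_le_bound (I : set nat) u : (forall k, I k -> (k <= n)%N) ->
  sorted leq u -> (forall k, k \in u -> I k) -> vsum u <= m0 * n%:R.
Proof.
move=> In su uI; case: u su uI => [|x s] /= su uI.
  by rewrite vsum0 mulr_ge0 ?m0_ge0.
apply: le_trans (vsum_bound su _) _.
  by apply/allP => k ks; exact/In/uI.
rewrite ler_wpM2l ?m0_ge0 // ler_nat.
have := In _ (uI (last x s) (mem_last _ _)); lia.
Qed.

Lemma varpow_ub (I : set nat) u : (forall k, I k -> (k <= n)%N) ->
  sorted leq u -> (forall k, k \in u -> I k) -> vsum u <= varpow rho I g.
Proof.
move=> In su uI; apply: ub_le_sup; last by exists u.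
by exists (m0 * n%:R) => _ [v [sv [vI ->]]]; exact: (vsum_le_bound In).
Qed.

Lemma varpow_le (I : set nat) (M : R) :
  (forall u, sorted leq u -> (forall k, k \in u -> I k) -> vsum u <= M) ->
  varpow rho I g <= M.
Proof.
move=> h; apply: ge_sup; first by exists (vsum [::]), [::].
by move=> _ [u [su [uI ->]]]; exact: h.
Qed.

Lemma varpow_ge0 (I : set nat) : (forall k, I k -> (k <= n)%N) ->
  0 <= varpow rho I g.
Proof. by move=> In; rewrite -vsum0; apply: varpow_ub. Qed.

Lemma varpow_pair k l : (k <= l)%N -> (l <= n)%N ->
  g k l `^ rho <= varpow rho (grid_itv k l) g.
Proof.
move=> kl ln; have := @varpow_ub (grid_itv k l) [:: k; l].
rewrite vsum_cons2 vsum1 addr0; apply=> [i /andP[_ il]|/=|i].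
- exact: leq_trans ln.
- by rewrite andbT.
- by rewrite !inE => /orP[]/eqP ->; rewrite /grid_itv /= ?leqnn ?kl.
Qed.

(** Two sequences on adjacent intervals are concatenated. *)
Lemma varpow_super k u l : (k <= u)%N -> (u <= l)%N -> (l <= n)%N ->
  varpow rho (grid_itv k u) g + varpow rho (grid_itv u l) g
  <= varpow rho (grid_itv k l) g.
Proof.
move=> ku ul ln; rewrite -lerBrDr; apply: varpow_le => s ss sI.
rewrite lerBrDl -lerBrDr; apply: varpow_le => t st tI; rewrite lerBrDl addrC.
rewrite addrC; apply: le_trans (vsum_cat _ _) _; apply: varpow_ub.
- by move=> i /andP[_ il]; exact: leq_trans ln.
- rewrite (sorted_pairwise leq_trans) pairwise_cat -!(sorted_pairwise leq_trans).
  rewrite ss st !andbT; apply/allrelP => i j /sI/andP[_ iu] /tI/andP[uj _].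
  exact: leq_trans uj.
- move=> i; rewrite mem_cat => /orP[/sI/andP[a b]|/tI/andP[a b]].
    by rewrite /grid_itv /= a (leq_trans b).
  by rewrite /grid_itv /= b (leq_trans ku).
Qed.

End DiscreteVariation.

Section ControlProperties.
Context {R : realType} {d : nat}.
Variables (T H p : R) (n : nat).
Hypotheses (T0 : 0 < T) (n0 : (0 < n)%N) (p0 : 0 < p).
Variables (x b : R -> 'cV[R]_d) (w2 : R -> R -> 'M[R]_(d + d)).

Let w t := col_mx (x t) (b t).

Hypothesis chen : forall s u t, 0 <= s -> s <= u -> u <= t -> t <= T ->
  w2 s t = w2 s u + w2 u t + (w u - w s) *m (w t - w u)^T.

Let om := control p T H n w w2.

Lemma mesh_gt0 : 0 < mesh T n. Proof. by rewrite divr_gt0 // ltr0n. Qed.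

Lemma tgrid_le k l : (tgrid T n k <= tgrid T n l) = (k <= l)%N.
Proof. by rewrite /tgrid ler_pM2r ?mesh_gt0 // ler_nat. Qed.

Lemma tgrid_lt k l : (tgrid T n k < tgrid T n l) = (k < l)%N.
Proof. by rewrite ltNge tgrid_le -ltnNge. Qed.

Lemma tgrid_ge0 k : 0 <= tgrid T n k.
Proof. by rewrite mulr_ge0 // ltW // mesh_gt0. Qed.

Lemma tgrid_leT k : (k <= n)%N -> tgrid T n k <= T.
Proof.
move=> kn; apply: (@le_trans _ _ (tgrid T n n)); first by rewrite tgrid_le.
by rewrite /tgrid /mesh mulrCA divff ?mulr1 // pnatr_eq0 -lt0n.
Qed.

Lemma w2_diag k : (k <= n)%N -> w2 (tgrid T n k) (tgrid T n k) = 0.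
Proof.
move=> kn; have := chen (tgrid_ge0 k) (lexx _) (lexx _) (tgrid_leT kn).
rewrite subrr mul0mx addr0 => h.
by apply: (@addrI _ (w2 (tgrid T n k) (tgrid T n k))); rewrite -h addr0.
Qed.

Lemma enorm0 k l : enorm (0 : 'M[R]_(k, l)) = 0.
Proof.
rewrite /enorm big1 ?sqrtr0 // => i _; rewrite big1 // => j _.
by rewrite mxE expr0n.
Qed.

Lemma w_size_diag k : (k <= n)%N -> w_size T n w w2 k k = 0.
Proof.
by move=> kn; rewrite /w_size /grid_incr subrr w2_diag // !enorm0 sqrtr0 addr0.
Qed.

Lemma q_diag (A : R -> R -> 'M[R]_d) k : enorm (qsum T H n A k k) = 0.
Proof. by rewrite /qsum big_geq // enorm0. Qed.

Let gx i j : R := enorm (q_x T H n w2 i j).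
Let gb i j : R := enorm (q_b T H n w2 i j).
Let gx_diag k : (k <= n)%N -> gx k k = 0. Proof. by move=> _; exact: q_diag. Qed.
Let gb_diag k : (k <= n)%N -> gb k k = 0. Proof. by move=> _; exact: q_diag. Qed.
Let p20 : 0 < p / 2. Proof. by rewrite divr_gt0. Qed.

Lemma omE k l : om k l = varpow p (grid_itv k l) (w_size T n w w2)
  + varpow (p / 2) (grid_itv k l) gx + varpow (p / 2) (grid_itv k l) gb.
Proof. by []. Qed.

Lemma control_parts k l : (k <= l)%N -> (l <= n)%N ->
  [/\ w_size T n w w2 k l `^ p <= om k l,
      enorm (q_x T H n w2 k l) `^ (p / 2) <= om k l & 0 <= om k l].
Proof.
move=> kl ln.
have In i : grid_itv k l i -> (i <= n)%N by move=> /andP[_ h]; exact: leq_trans ln.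
have h1 := varpow_pair p0 w_size_diag kl ln.
have h2 := varpow_pair p20 gx_diag kl ln.
have g1 := varpow_ge0 p0 w_size_diag In.
have g2 := varpow_ge0 p20 gx_diag In.
have g3 := varpow_ge0 p20 gb_diag In.
rewrite omE -/(gx k l); move: h1 h2 g1 g2 g3.
move: (varpow p _ _) (varpow _ _ gx) (varpow _ _ gb) (_ `^ _) (_ `^ _).
move=> a1 a2 a3 a4 a5 *; split; lra.
Qed.

Lemma control_super k u l : (k <= u)%N -> (u <= l)%N -> (l <= n)%N ->
  om k u + om u l <= om k l.
Proof.
move=> ku ul ln.
have h1 := varpow_super p0 w_size_diag ku ul ln.
have h2 := varpow_super p20 gx_diag ku ul ln.
have h3 := varpow_super p20 gb_diag ku ul ln.
rewrite !omE; move: h1 h2 h3.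
move: (varpow p (grid_itv k u) _) (varpow p (grid_itv u l) _) (varpow p (grid_itv k l) _).
move: (varpow _ (grid_itv k u) gx) (varpow _ (grid_itv u l) gx).
move: (varpow _ (grid_itv k l) gx) (varpow _ (grid_itv k u) gb).
move: (varpow _ (grid_itv u l) gb) (varpow _ (grid_itv k l) gb).
move=> a1 a2 a3 a4 a5 a6 a7 a8 a9 *; lra.
Qed.

Lemma w_size_ge0 k l : 0 <= w_size T n w w2 k l.
Proof. by rewrite addr_ge0 ?enorm_ge0 ?sqrtr_ge0. Qed.

Lemma powR_inv_le (y z r : R) : 0 < r -> 0 <= y -> y `^ r <= z -> y <= z `^ r^-1.
Proof.
move=> r0 y0 h.
rewrite -[leLHS](powRr1 y0) -(@mulfV _ r) ?gt_eqF // powRrM.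
apply: ge0_ler_powR; rewrite ?nnegrE ?powR_ge0 ?invr_ge0 ?(ltW r0) //.
by apply: le_trans h; exact: powR_ge0.
Qed.

Definition drvX (j : 'I_d) (k l : nat) : R := grid_incr T n x k l j 0.
(** Subtracting q turns the second level of the driving path into the one for
    which the scheme is an exact expansion on single intervals ([drvB_step]);
    Chen's relation survives because q is additive. *)
Definition drvB (j j' : 'I_d) (k l : nat) : R :=
  ulsubmx (w2 (tgrid T n k) (tgrid T n l)) j j' - q_x T H n w2 k l j j'.

(** On one grid interval x^2 cancels, and only the correction of the scheme
    remains. *)
Lemma drvB_step j j' k :
  drvB j j' k k.+1 = (mesh T n `^ (2 * H) / 2) * (j == j')%:R.
Proof.
rewrite /drvB /q_x /qsum big_nat1 !mxE.
by case: (j == j'); rewrite ?mulr1n ?mulr0n /=; ring.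
Qed.

Lemma sqrt_powR (y : R) : 0 <= y -> (y `^ p^-1) ^+ 2 = y `^ (p / 2)^-1.
Proof.
move=> y0; rewrite -powR_mulrn ?powR_ge0 // -powRrM; congr (_ `^ _).
by rewrite invfM invrK mulrC.
Qed.

Lemma grid_driverP : grid_driver p n drvX drvB om.
Proof.
have hw k l : (k <= l)%N -> (l <= n)%N -> w_size T n w w2 k l <= om k l `^ p^-1.
  move=> kl ln; have [h _ _] := control_parts kl ln.
  exact: powR_inv_le (w_size_ge0 _ _) h.
have wE s t i : (w s - w t) (lshift d i) 0 = x s i 0 - x t i 0.
  by rewrite /w opp_col_mx add_col_mx col_mxEu !mxE.
split.
- by move=> k l kl ln; case: (control_parts kl ln).
- exact: control_super.
- move=> j k l kl ln; apply: le_trans (hw k l kl ln).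
  have -> : drvX j k l = grid_incr T n w k l (lshift d j) 0.
    by rewrite /drvX /grid_incr wE !mxE.
  by apply: le_trans (coord_le_enorm _ _ _) _; rewrite lerDl sqrtr_ge0.
- move=> j j' k l kl ln.
  have [_ h2 om0] := control_parts kl ln.
  have b1 : `|ulsubmx (w2 (tgrid T n k) (tgrid T n l)) j j'| <= (om k l `^ p^-1) ^+ 2.
    rewrite !mxE; apply: le_trans (coord_le_enorm _ _ _) _.
    rewrite -[leLHS]sqr_sqrtr ?enorm_ge0 // lerXn2r ?nnegrE ?sqrtr_ge0 ?powR_ge0 //.
    by apply: le_trans (hw k l kl ln); rewrite lerDr enorm_ge0.
  have b2 : `|q_x T H n w2 k l j j'| <= (om k l `^ p^-1) ^+ 2.
    apply: le_trans (coord_le_enorm _ _ _) _; rewrite sqrt_powR //.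
    exact: powR_inv_le (enorm_ge0 _) h2.
  by apply: le_trans (ler_normB _ _) _; lra.
- by move=> j k u l _ _ _; rewrite /drvX /grid_incr !mxE; ring.
- move=> j j' k u l ku ul ln.
  rewrite /drvB (@chen _ (tgrid T n u)) ?tgrid_le ?tgrid_ge0 ?tgrid_leT //.
  have -> : q_x T H n w2 k l = q_x T H n w2 k u + q_x T H n w2 u l.
    by rewrite /q_x /qsum (big_cat_nat ku ul).
  have e : ((w (tgrid T n u) - w (tgrid T n k)) *m
      (w (tgrid T n l) - w (tgrid T n u))^T) (lshift d j) (lshift d j')
      = drvX j k u * drvX j' u l.
    by rewrite mxE big_ord1 [_^T _ _]mxE !wE /drvX /grid_incr !mxE.
  rewrite -e; set M := _ *m _; set A1 := w2 _ _; set A2 := w2 _ _.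
  by rewrite !mxE; ring.
Qed.

End ControlProperties.

(** * Greedy times *)

Lemma sup_nonneg (R : realType) (A : set R) : (forall x, A x -> 0 <= x) -> 0 <= sup A.
Proof.
move=> A0; have [hs|hs] := pselect (has_sup A); last by rewrite sup_out.
have [[x Ax] hub] := hs; apply: le_trans (A0 x Ax) _; exact: ub_le_sup hub _ Ax.
Qed.

Section GreedyTimes.
Context {R : realType}.
Variables (alpha : R) (n : nat) (om : nat -> nat -> R).
Hypothesis n0 : (0 < n)%N.

Let next := gnext alpha n om.
Let greedy := is_greedy alpha n om.

Lemma gnext_bounds k : (k < n)%N -> (k < next k <= n)%N.
Proof.
move=> kn; rewrite /next /gnext [(n <= k)%N]leqNgt kn /=.
case: ltP => [_|omk]; first by rewrite ltnSn kn.
have kS : (k.+1 < n.+1)%N by [].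
set P := fun l : 'I_n.+1 => (k < l)%N && (om k l <= alpha).
apply/andP; split.
  apply: (@leq_bigmax_cond _ P (fun l => l : nat) (Ordinal kS)).
  by rewrite /P /= ltnSn.
by apply/bigmax_leqP => l _; rewrite -ltnS.
Qed.

Lemma gnext_le k : (k < n)%N -> om k k.+1 <= alpha -> om k (next k) <= alpha.
Proof.
move=> kn omk; rewrite /next /gnext [(n <= k)%N]leqNgt kn ltNge omk /=.
have kS : (k.+1 < n.+1)%N by [].
have [|l /andP[_ hl] ->] :=
  @eq_bigmax_cond _ (fun l : 'I_n.+1 => (k < l)%N && (om k l <= alpha))
    (fun l => l : nat); last exact: hl.
by apply/card_gt0P; exists (Ordinal kS); rewrite unfold_in /= ltnSn.
Qed.

(** If the first step is not too large, then the next greedy time keeps the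
    control below alpha; so an interval of S_2 is a single step. *)
Lemma S2_next k : S2 alpha n om k -> next k = k.+1.
Proof.
move=> /andP[/andP[kn _] h].
have [omk|omk] := leP (om k k.+1) alpha.
  by move: h; rewrite ltNge (gnext_le kn omk).
by rewrite /next /gnext [(n <= k)%N]leqNgt kn omk.
Qed.

Lemma greedy_cases k : greedy k ->
  S2 alpha n om k \/ ((S0 alpha n om k || S1 alpha n om k) && ~~ S2 alpha n om k).
Proof.
move=> gk; rewrite /S0 /S1 /S2 -/greedy gk /=.
case: (ltP alpha) => h; [by left|right].
by rewrite andbT orbC; case: ltP.
Qed.

Lemma S01_le k : S0 alpha n om k || S1 alpha n om k -> 0 <= alpha ->
  greedy k /\ om k (next k) <= alpha.
Proof.
move=> h a0; split; first by case/orP: h => /andP[].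
case/orP: h => /andP[_]; first by case/andP.
by rewrite -/next => /ltW h; apply: le_trans h _; lra.
Qed.

Lemma greedy0 : greedy 0%N.
Proof.
by rewrite /greedy /is_greedy n0; apply/trajectP; exists 0%N.
Qed.

(** A greedy time below n is reached after at most that many iterations, as the
    times increase strictly, hence within the n iterations that are listed. *)
Lemma greedy_next k : greedy k -> (next k < n)%N -> greedy (next k).
Proof.
move=> /andP[kn /trajectP [i i_n ek]] nk; rewrite /greedy /is_greedy nk /=.
have it j : (j < n)%N -> (iter j next 0 < n)%N -> (j <= iter j next 0)%N.
  elim: j => [//|j IH] jn; rewrite iterS => h.
  have hj : (iter j next 0 < n)%N.
    have [//|hj] := ltnP (iter j next 0) n.
    by move: h; rewrite {1}/next /gnext hj ltnn.
  have /andP[a _] := gnext_bounds hj.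
  exact: leq_ltn_trans (IH (ltnW jn) hj) a.
have ii : (i <= k)%N by rewrite ek; apply: it => //; rewrite -ek.
apply/trajectP; exists i.+1; last by rewrite iterS -ek.
have /andP[a _] := gnext_bounds kn.
exact: leq_ltn_trans (leq_ltn_trans ii a) nk.
Qed.

Lemma greedy_cover l : (0 < l)%N -> (l <= n)%N ->
  exists s, [/\ greedy s, (s < l)%N & (l <= next s)%N].
Proof.
move=> l0 ln.
have ex : exists s, greedy s && (s < l)%N by exists 0%N; rewrite greedy0.
have ub s : greedy s && (s < l)%N -> (s <= l)%N by move=> /andP[_ /ltnW].
case: (ex_maxnP ex ub) => s /andP[gs sl] hmax; exists s; split=> //.
rewrite leqNgt; apply/negP => h.
have /andP[sn _] := gs; have /andP[a _] := gnext_bounds sn.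
have := hmax (next s); rewrite h greedy_next ?(leq_trans h) // => /(_ isT).
by rewrite leqNgt a.
Qed.

Variable f : nat -> R.
Hypothesis f1 : forall k, 1 <= f k.

(** The part of the product of the M_i that belongs to the greedy times before
    l; keeping it as a function of l makes the growth estimate an induction. *)
Definition gprod (l : nat) : R := \prod_(0 <= k < l) (if greedy k then f k else 1).
Definition gcount (l : nat) : nat := \sum_(0 <= k < l) greedy k.

Lemma gprod_ge1 l : 1 <= gprod l.
Proof.
elim: l => [|l IH]; first by rewrite /gprod big_geq.
rewrite /gprod big_nat_recr //= -/(gprod l).
have := ler_pM ler01 ler01 IH (_ : 1 <= if greedy l then f l else 1).
by rewrite mulr1; apply; case: ifP.
Qed.

Lemma gprod_mono k l : (k <= l)%N -> gprod k <= gprod l.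
Proof.
move=> kl; rewrite -(subnKC kl); elim: (l - k)%N => [|j IH]; first by rewrite addn0.
apply: le_trans IH _; rewrite addnS /gprod [in leRHS]big_nat_recr //=.
rewrite -/(gprod (k + j)) ler_peMr //; last by case: ifP.
exact: le_trans ler01 (gprod_ge1 _).
Qed.

Lemma gprod_greedy s l : greedy s -> (s < l)%N -> gprod s * f s <= gprod l.
Proof.
move=> gs sl; apply: le_trans (gprod_mono sl).
by rewrite /gprod big_nat_recr //= gs.
Qed.

Lemma gcount_mono k l : (k <= l)%N -> (gcount k <= gcount l)%N.
Proof. by move=> kl; rewrite /gcount (big_cat_nat (leq0n k) kl) /= leq_addr. Qed.

Lemma gcount_greedy s l : greedy s -> (s < l)%N -> (gcount s < gcount l)%N.
Proof.
move=> gs sl; apply: leq_trans (gcount_mono sl).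
by rewrite /gcount big_nat_recr //= gs addn1.
Qed.

(** The time e at which the derivative is created lies inside some greedy
    interval, where growth is only known to be bounded; this gives the factor
    c. Every later greedy interval contributes its factor f s. *)
Lemma greedy_growth (Q : nat -> R) (e q : nat) (C c : R) :
  0 <= C -> 1 <= c -> (forall k, 0 <= Q k) ->
  Q e <= C * gprod e ^+ q ->
  (forall s l, greedy s -> (e <= s)%N -> (s <= l)%N -> (l <= next s)%N ->
     Q l <= f s ^+ q * Q s) ->
  (forall s l, greedy s -> (s < e)%N -> (e <= l)%N -> (l <= next s)%N ->
     Q l <= c * Q e) ->
  forall l, (e <= l)%N -> (l <= n)%N -> Q l <= c * C * gprod l ^+ q.
Proof.
move=> C0 c1 Q0 Qe h1 h2; have c0 : 0 <= c := le_trans ler01 c1.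
have G0 k : 0 <= gprod k := le_trans ler01 (gprod_ge1 k).
elim/ltn_ind=> l IH el ln.
have hm k : (k <= l)%N -> C * gprod k ^+ q <= C * gprod l ^+ q.
  move=> kl; apply: ler_wpM2l => //.
  by rewrite lerXn2r ?nnegrE //; exact: gprod_mono.
have [<-|ne] := eqVneq e l.
  apply: le_trans Qe _; rewrite -mulrA ler_peMl // mulr_ge0 // exprn_ge0 //.
have l0 : (0 < l)%N by lia.
have [s [gs sl ls]] := greedy_cover l0 ln.
have [se|es] := ltnP s e.
  apply: le_trans (h2 s l gs se el ls) _; rewrite -mulrA; apply: ler_wpM2l => //.
  exact: le_trans Qe (hm _ el).
apply: le_trans (h1 s l gs es (ltnW sl) ls) _.
have f0 : 0 <= f s := le_trans ler01 (f1 s).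
have := ler_wpM2l (exprn_ge0 q f0) (IH s sl es (leq_trans (ltnW sl) ln)).
move/le_trans; apply; rewrite mulrCA -exprMn.
apply: ler_wpM2l; first exact: mulr_ge0.
rewrite lerXn2r ?nnegrE ?mulr_ge0 // mulrC; exact: gprod_greedy.
Qed.

(** The increment is split at the greedy times, and every piece is bounded by
    the control of the whole interval: the number of greedy times is the price
    of having no summable bound on the pieces. *)
Lemma greedy_increment (Z : nat -> R) (h : nat -> nat -> R) (e : nat) (A : R) :
  0 <= A -> (forall k l, 0 <= h k l) ->
  (forall k l k' l', (k' <= k)%N -> (k <= l)%N -> (l <= l')%N -> (l' <= n)%N ->
     h k l <= h k' l') ->
  (forall s k l, greedy s -> (s <= k)%N -> (e <= k)%N -> (k <= l)%N ->
     (l <= next s)%N -> `|Z l - Z k| <= A * h k l) ->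
  forall u v, (e <= u)%N -> (u <= v)%N -> (v <= n)%N ->
  `|Z v - Z u| <= A * (gcount v)%:R * h u v.
Proof.
move=> A0 h0 hm hZ u v eu; elim/ltn_ind: v => v IH uv vn.
have [<-|ne] := eqVneq u v; first by rewrite subrr normr0 !mulr_ge0.
have v0 : (0 < v)%N by lia.
have [s [gs sv vs]] := greedy_cover v0 vn.
have cs := gcount_greedy gs sv.
have [su|us] := leqP s u.
  apply: le_trans (hZ s u v gs su eu uv vs) _.
  rewrite ler_wpM2r // ler_peMr // ler1n; exact: leq_ltn_trans cs.
have -> : Z v - Z u = (Z v - Z s) + (Z s - Z u) by ring.
apply: le_trans (ler_normD _ _) _.
have b1 := hZ s s v gs (leqnn s) (leq_trans eu (ltnW us)) (ltnW sv) vs.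
have b2 := IH s sv (ltnW us) (leq_trans (ltnW sv) vn).
have m1 : h s v <= h u v by apply: hm => //; [exact: ltnW|exact: ltnW].
have m2 : h u s <= h u v by apply: hm => //; exact: ltnW.
have q1 : A * h s v <= A * h u v by exact: ler_wpM2l.
have q2 : A * (gcount s)%:R * h u s <= A * (gcount s)%:R * h u v.
  by apply: ler_wpM2l => //; exact: mulr_ge0.
have q3 : A * (gcount s).+1%:R * h u v <= A * (gcount v)%:R * h u v.
  by apply: ler_wpM2r => //; apply: ler_wpM2l => //; rewrite ler_nat.
apply: le_trans q3; rewrite -natr1 mulrDr mulr1 mulrDl addrC.
by apply: lerD; [exact: le_trans b2 q2|exact: le_trans b1 q1].
Qed.

Lemma card_SE : card_S alpha n om = gcount n.
Proof.
rewrite /card_S -sum1_card big_mkcond /gcount big_mkord; apply: eq_bigr => k _.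
rewrite inE /=; have [gk|gk] := boolP (greedy k).
  by case: (greedy_cases gk) => [->|/andP[/orP[]-> _]]; rewrite ?orbT.
by rewrite /S0 /S1 /S2 -/greedy (negbTE gk).
Qed.

End GreedyTimes.

(** The p-th power of A * om ^ (1 / p) is A ^ p * om, whose sums over a
    subdivision telescope by superadditivity. *)
Lemma xi_pvar_le (R : realType) (m : nat) (p T : R) (n : nat) (r r' : R)
    (J : nat -> jet R m) (L k l : nat) (om : nat -> nat -> R) (A : R) :
  0 < p -> 0 <= A -> (k <= l)%N ->
  (forall u v, (k <= u)%N -> (u <= v)%N -> (v <= l)%N -> 0 <= om u v) ->
  (forall u v t, (k <= u)%N -> (u <= v)%N -> (v <= t)%N -> (t <= l)%N ->
    om u v + om v t <= om u t) ->
  (forall u v, (k <= u)%N -> (u <= v)%N -> (v <= l)%N -> after T n r r' L u ->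
    after T n r r' L v ->
    enorm (jxi L (J v) - jxi L (J u)) <= A * om u v `^ p^-1) ->
  xi_pvar p T n r r' J L k l <= A * om k l `^ p^-1.
Proof.
move=> p0 A0 kl om0 omS hA.
have ip : 0 <= p^-1 by rewrite invr_ge0 ltW.
have okl : 0 <= om k l by apply: om0.
pose g i j := enorm (jxi L (J j) - jxi L (J i)).
pose I := grid_itv k l `&` [set i | after T n r r' L i].
have step u v : (k <= u)%N -> (u <= v)%N -> (v <= l)%N -> after T n r r' L u ->
    after T n r r' L v -> g u v `^ p <= A `^ p * om u v.
  move=> a b c e f.
  have -> : A `^ p * om u v = (A * om u v `^ p^-1) `^ p.
    rewrite powRM ?powR_ge0 // -powRrM mulVf ?gt_eqF // powRr1 //.
    exact: om0.
  apply: ge0_ler_powR; rewrite ?nnegrE ?enorm_ge0 ?mulr_ge0 ?powR_ge0 ?(ltW p0) //.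
  exact: hA.
have mono u v : (k <= u)%N -> (u <= v)%N -> (v <= l)%N -> om u v <= om k l.
  move=> a b c; have h1 := omS k u l (leqnn k) a (leq_trans b c) (leqnn l).
  have h2 := omS u v l a b c (leqnn l).
  have h3 := om0 k u (leqnn k) a (leq_trans b c).
  have h4 := om0 v l (leq_trans a b) c (leqnn l).
  by lra.
have bound x s : path leq x s -> (forall i, i \in x :: s -> I i) ->
    vsum p g (x :: s) <= A `^ p * om x (last x s).
  elim: s x => [|y s IH] x.
    move=> _ /(_ x (mem_head _ _)) [/andP[a b] _].
    by rewrite vsum1 mulr_ge0 ?powR_ge0 // om0.
  rewrite [path _ _ _]/= => /andP[xy ys] hI.
  have hI' i : i \in y :: s -> I i by move=> h; apply: hI; rewrite inE h orbT.
  have [/andP[kx xl] ax] := hI x (mem_head _ _).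
  have [/andP[ky yl] ay] := hI' y (mem_head _ _).
  have [/andP[kz zl] az] := hI' _ (mem_last y s).
  have yz : (y <= last y s)%N.
    move: ys; rewrite path_sortedE; last exact: leq_trans.
    move=> /andP[/allP al _]; have := mem_last y s; rewrite inE => /orP[/eqP ->//|].
    exact: al.
  rewrite vsum_cons2 /=; apply: le_trans (lerD (step x y kx xy yl ax ay) (IH y ys hI')) _.
  by rewrite -mulrDr ler_wpM2l ?powR_ge0 // omS.
have hv : varpow p I g <= A `^ p * om k l.
  apply: varpow_le => -[|x s] ss sI.
    by rewrite vsum0 mulr_ge0 // powR_ge0.
  have [/andP[kx xl] _] := sI x (mem_head _ _).
  have [/andP[kz zl] _] := sI _ (mem_last x s).
  apply: le_trans (bound x s ss sI) _; rewrite ler_wpM2l ?powR_ge0 //.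
  apply: mono => //; move: ss; rewrite /= path_sortedE; last exact: leq_trans.
  move=> /andP[/allP al _]; have := mem_last x s; rewrite inE => /orP[/eqP ->//|].
  exact: al.
rewrite /xi_pvar -/I -/g.
have v0 : 0 <= varpow p I g.
  apply: sup_nonneg.
  by move=> _ [u [_ [_ ->]]]; apply: sumr_ge0 => i _; exact: powR_ge0.
have -> : A * om k l `^ p^-1 = (A `^ p * om k l) `^ p^-1.
  by rewrite powRM ?powR_ge0 // -powRrM mulfV ?gt_eqF // powRr1.
by apply: ge0_ler_powR; rewrite ?nnegrE ?mulr_ge0 ?powR_ge0.
Qed.

(** * Derivatives and linearity of the operators *)

Section CurveDerivatives.
Context {R : realType}.

Definition der0 (f : R -> R) (df : R) : Prop := is_derive (0 : R) (1 : R) f df.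

Lemma der0_eq f df dg : der0 f df -> df = dg -> der0 f dg.
Proof. by move=> h <-. Qed.

Lemma der0_cst (c : R) : der0 (fun=> c) 0.
Proof. exact: is_derive_cst. Qed.

Lemma der0D f g df dg : der0 f df -> der0 g dg -> der0 (fun h => f h + g h) (df + dg).
Proof. by move=> hf hg; exact: is_deriveD. Qed.

Lemma der0M f g df dg : der0 f df -> der0 g dg ->
  der0 (fun h => f h * g h) (df * g 0 + f 0 * dg).
Proof.
move=> hf hg; apply: der0_eq (is_deriveM hf hg) _.
by rewrite addrC; congr (_ + _); exact: mulrC.
Qed.

Lemma der0_sum n (f : 'I_n -> R -> R) df :
  (forall i, der0 (f i) (df i)) -> der0 (fun h => \sum_i f i h) (\sum_i df i).
Proof.
move=> hf; have := is_derive_sum hf.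
by rewrite (_ : \sum_(i < n) f i = fun h => \sum_i f i h) //; apply/funext => h; rewrite fct_sumE.
Qed.

Lemma der0_id_scale (c : R) : der0 (fun h => h * c) c.
Proof.
by apply: der0_eq (der0M (@is_derive_id _ _ _ _) (der0_cst c)) _; rewrite mul1r mulr0 addr0.
Qed.

Variable m : nat.
Implicit Types (f : 'cV[R]_m -> R).

(** Differentiating a contraction adds one slot for the base point and one term
    for each of the other slots. *)
Lemma der0_D1 f (Y a : R -> 'cV[R]_m) (dY da : 'cV[R]_m) : Cb 3 f ->
  (forall l, der0 (fun h => Y h l 0) (dY l 0)) ->
  (forall l, der0 (fun h => a h l 0) (da l 0)) ->
  der0 (fun h => D1 f (Y h) (a h)) (D2 f (Y 0) dY (a 0) + D1 f (Y 0) da).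
Proof.
move=> fC hY ha; rewrite /D2 {2}/D1 -big_split; apply: der0_sum => l.
apply: der0M => //; apply: is_derive_chain => //; exact: Cb_pder fC.
Qed.

Lemma der0_D2 f (Y a b : R -> 'cV[R]_m) (dY da db : 'cV[R]_m) : Cb 4 f ->
  (forall l, der0 (fun h => Y h l 0) (dY l 0)) ->
  (forall l, der0 (fun h => a h l 0) (da l 0)) ->
  (forall l, der0 (fun h => b h l 0) (db l 0)) ->
  der0 (fun h => D2 f (Y h) (a h) (b h))
    (D3 f (Y 0) dY (a 0) (b 0) + D2 f (Y 0) da (b 0) + D2 f (Y 0) (a 0) db).
Proof.
move=> fC hY ha hb.
apply: der0_eq; first apply: der0_sum => l.
  by apply: der0M (hb l); apply: (der0_D1 _ hY ha); exact: Cb_pder fC.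
rewrite -!big_split; apply: eq_bigr => l _ /=; by rewrite mulrDl.
Qed.

Lemma D1_sum f y q (a : 'I_q -> 'cV[R]_m) :
  D1 f y (\sum_j a j) = \sum_j D1 f y (a j).
Proof.
rewrite exchange_big; apply: eq_bigr => l _ /=.
by rewrite summxE mulr_sumr.
Qed.

Lemma D2_suml f y q (a : 'I_q -> 'cV[R]_m) b :
  D2 f y (\sum_j a j) b = \sum_j D2 f y (a j) b.
Proof.
rewrite exchange_big; apply: eq_bigr => l _ /=.
by rewrite D1_sum mulr_suml.
Qed.

Lemma D3_suml f y q (a : 'I_q -> 'cV[R]_m) b c :
  D3 f y (\sum_j a j) b c = \sum_j D3 f y (a j) b c.
Proof.
rewrite exchange_big; apply: eq_bigr => l _ /=.
by rewrite D2_suml mulr_suml.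
Qed.

End CurveDerivatives.

Section JetDerivatives.
Context {R : realType} {m d : nat}.
Variable V : 'cV[R]_m -> 'M[R]_(m, d).
Hypothesis hV : CbV V 4.

Section Curve.
(* J runs along a curve of driving increments; the hypotheses say that u and z
   are the derivatives along it of y and u'. Then each operator turns into the
   next one, L^M into L^(M+1). *)
Variable J : R -> jet R m.
Hypothesis hy : forall l, der0 (fun h => jy (J h) l 0) (ju (J 0) l 0).
Hypothesis hu' : forall l, der0 (fun h => ju' (J h) l 0) (jz (J 0) l 0).

Lemma der0_opL0 i j : der0 (fun h => opL 0 (J h) (vcoef V i j)) (opL 1 (J 0) (vcoef V i j)).
Proof.
rewrite /opL dapp1; apply: is_derive_chain => //.
by do 2 apply: CbW; exact: hV.
Qed.

Lemma der0_opL1 i j : der0 (fun h => opL 1 (jswap (J h)) (vcoef V i j))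
  (opL 2 (J 0) (vcoef V i j)).
Proof.
rewrite /opL dapp1 dapp2.
under [X in der0 X _]eq_fun do rewrite dapp1 /=.
by apply: der0_D1 => //; apply: CbW; exact: hV.
Qed.

Lemma der0_opLbar0 i j' j : der0 (fun h => opLbar 0 (J h) (vcoef V i j') (vfield V j))
  (opLbar 1 (J 0) (vcoef V i j') (vfield V j)).
Proof.
rewrite /opLbar dapp1 dapp2.
under [X in der0 X _]eq_fun do rewrite dapp1 /=.
apply: der0_D1 => //; first by apply: CbW; exact: hV.
move=> l; rewrite opLvE.
under [X in der0 X _]eq_fun do rewrite vfieldE.
exact: der0_opL0.
Qed.

Lemma der0_opLbar1 i j' j :
  der0 (fun h => opLbar 1 (jswap (J h)) (vcoef V i j') (vfield V j))
  (opLbar 2 (J 0) (vcoef V i j') (vfield V j)).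
Proof.
have g l : der0 (fun h => vfield V j (jy (J h)) l 0) (opLv 1 (J 0) (vfield V j) l 0).
  rewrite opLvE; under [X in der0 X _]eq_fun do rewrite vfieldE.
  exact: der0_opL0.
have Lg l : der0 (fun h => opLv 1 (jswap (J h)) (vfield V j) l 0)
    (opLv 2 (J 0) (vfield V j) l 0).
  rewrite opLvE; under [X in der0 X _]eq_fun do rewrite opLvE.
  exact: der0_opL1.
have C3 : Cb 3 (vcoef V i j') by apply: CbW; exact: hV.
under [X in der0 X _]eq_fun do rewrite /opLbar dapp1 dapp2.
apply: der0_eq; first apply: der0D.
- exact: (der0_D2 (hV i j') hy hu' g).
- exact: (der0_D1 C3 hy Lg).
rewrite /opLbar !dapp1 !dapp2 !dapp3 /= [D2 _ _ (ju' _) _]D2C //; ring.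
Qed.

End Curve.

(* The derivative D_r is the sum of the derivatives in the coordinates, all at
   the same point: linearity in the components that carry D_r passes from the
   coordinates to the sum. *)
Section Additivity.
Variables (q : nat) (J : jet R m) (Js : 'I_q -> jet R m).
Hypothesis ey : forall j, jy (Js j) = jy J.
Hypothesis eu' : forall j, ju' (Js j) = ju' J.
Hypothesis eu : ju J = \sum_j ju (Js j).
Hypothesis ez : jz J = \sum_j jz (Js j).

Lemma opL1_sum f : opL 1 J f = \sum_j opL 1 (Js j) f.
Proof.
rewrite /opL dapp1 eu D1_sum; apply: eq_bigr => j _; by rewrite dapp1 ey.
Qed.

Lemma opL2_sum f : opL 2 J f = \sum_j opL 2 (Js j) f.
Proof.
rewrite /opL dapp1 dapp2 eu ez D1_sum D2_suml -big_split; apply: eq_bigr => j _.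
by rewrite dapp1 dapp2 ey eu'.
Qed.

Lemma opLv1_sum g : opLv 1 J g = \sum_j opLv 1 (Js j) g.
Proof.
apply/colP => i; rewrite summxE mxE opL1_sum.
by apply: eq_bigr => j _; rewrite mxE.
Qed.

Lemma opLv2_sum g : opLv 2 J g = \sum_j opLv 2 (Js j) g.
Proof.
apply/colP => i; rewrite summxE mxE opL2_sum.
by apply: eq_bigr => j _; rewrite mxE.
Qed.

Lemma opLbar1_sum f g : opLbar 1 J f g = \sum_j opLbar 1 (Js j) f g.
Proof.
rewrite /opLbar dapp1 dapp2 eu opLv1_sum D1_sum D2_suml -big_split.
by apply: eq_bigr => j _; rewrite dapp1 dapp2 ey.
Qed.

Lemma opLv1_swap_eq j g : opLv 1 (jswap (Js j)) g = opLv 1 (jswap J) g.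
Proof. by apply/colP => i; rewrite !mxE /opL !dapp1 /= ey eu'. Qed.

Lemma opLbar2_sum f g : opLbar 2 J f g = \sum_j opLbar 2 (Js j) f g.
Proof.
rewrite /opLbar !dapp1 !dapp2 dapp3 eu ez opLv1_sum opLv2_sum !D1_sum !D2_suml D3_suml.
rewrite -!big_split; apply: eq_bigr => j _.
by rewrite !dapp1 !dapp2 dapp3 ey eu' opLv1_swap_eq.
Qed.

End Additivity.

Lemma opL2_swap (J : jet R m) i j : opL 2 (jswap J) (vcoef V i j) = opL 2 J (vcoef V i j).
Proof. by rewrite /opL !dapp1 !dapp2 /= D2C //; apply: CbW; exact: hV. Qed.

Lemma opLbar2_swap (J : jet R m) i j' j : opLbar 2 (jswap J) (vcoef V i j') (vfield V j) =
  opLbar 2 J (vcoef V i j') (vfield V j).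
Proof.
have C3 : Cb 3 (vcoef V i j') by apply: CbW; exact: hV.
have e : opLv 2 (jswap J) (vfield V j) = opLv 2 J (vfield V j).
  by apply/colP => l; rewrite !opLvE opL2_swap.
have ess : jswap (jswap J) = J by case: (J).
rewrite /opLbar !dapp1 !dapp2 !dapp3 ess e /= (D3C12 _ _ _ _ (hV i j')).
rewrite (D2C _ (opLv 1 (jswap J) _) _ C3) (D2C _ (ju' J) _ C3); ring.
Qed.

(** Linearity for an empty sum. *)
Lemma op_zero (J : jet R m) : ju J = 0 -> jz J = 0 ->
  [/\ forall f, opL 1 J f = 0, forall f, opL 2 J f = 0,
      forall f g, opLbar 1 J f g = 0 & forall f g, opLbar 2 J f g = 0].
Proof.
move=> u0 z0; pose Js (j : 'I_0) := J.
have eu : ju J = \sum_j ju (Js j) by rewrite big_ord0.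
have ez : jz J = \sum_j jz (Js j) by rewrite big_ord0.
split=> [f|f|f g|f g].
- by rewrite (@opL1_sum 0 J Js) ?big_ord0.
- by rewrite (@opL2_sum 0 J Js) ?big_ord0.
- by rewrite (@opLbar1_sum 0 J Js) ?big_ord0.
- by rewrite (@opLbar2_sum 0 J Js) ?big_ord0.
Qed.

End JetDerivatives.

(** * The tangent scheme and the Malliavin derivatives *)

Section TangentScheme.
Context {R : realType} {m d : nat}.
Variables (T H : R) (V : 'cV[R]_m -> 'M[R]_(m, d)) (a : 'cV[R]_m) (n : nat).
Hypothesis hV : CbV V 4.

Let c : R := mesh T n `^ (2 * H) / 2.
Implicit Types (zd z : nat -> 'cV[R]_d).

Definition mulop (o : ('cV[R]_m -> R) -> R) (v : 'cV[R]_d) (i : 'I_m) : R :=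
  \sum_j o (vcoef V i j) * v j 0.

Definition trop (o : ('cV[R]_m -> R) -> ('cV[R]_m -> 'cV[R]_m) -> R) (i : 'I_m) : R :=
  \sum_j o (vcoef V i j) (vfield V j).

(** The equations are those obtained by differentiating the scheme formally:
    besides the operators, a derivative in the direction zd creates a term in
    which the noise itself is differentiated, present where zd k <> 0.
    [tjet_der] confirms that the components are the derivatives. *)
Fixpoint tjet zd zd' (k : nat) z : jet R m :=
  if k is k'.+1 then
    let J := tjet zd zd' k' z in
    Jet (\col_i (jy J i 0 + mulop (opL 0 J) (z k') i + c * trop (opLbar 0 J) i))
        (\col_i (ju J i 0 + mulop (opL 1 J) (z k') i + mulop (opL 0 J) (zd k') i
                 + c * trop (opLbar 1 J) i))
        (\col_i (ju' J i 0 + mulop (opL 1 (jswap J)) (z k') i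
                 + mulop (opL 0 J) (zd' k') i + c * trop (opLbar 1 (jswap J)) i))
        (\col_i (jz J i 0 + mulop (opL 2 J) (z k') i
                 + mulop (opL 1 (jswap J)) (zd k') i + mulop (opL 1 J) (zd' k') i
                 + c * trop (opLbar 2 J) i))
  else Jet a 0 0 0.

Lemma tjet_uS zd zd' k z i (J := tjet zd zd' k z) :
  ju (tjet zd zd' k.+1 z) i 0 = ju J i 0 + mulop (opL 1 J) (z k) i
    + mulop (opL 0 J) (zd k) i + c * trop (opLbar 1 J) i.
Proof. by rewrite /= mxE. Qed.

Lemma tjet_zS zd zd' k z i (J := tjet zd zd' k z) :
  jz (tjet zd zd' k.+1 z) i 0 = jz J i 0 + mulop (opL 2 J) (z k) i
    + mulop (opL 1 (jswap J)) (zd k) i + mulop (opL 1 J) (zd' k) i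
    + c * trop (opLbar 2 J) i.
Proof. by rewrite /= mxE. Qed.

Lemma tjet_swap zd zd' k z : tjet zd' zd k z = jswap (tjet zd zd' k z).
Proof.
elim: k => [//|k IH] /=; rewrite IH; set J := tjet zd zd' k z.
have ess : jswap (jswap J) = J by case: (J).
rewrite ess /jswap /=; congr Jet; apply/colP => i; rewrite !mxE //; congr (_ + _).
- rewrite addrAC; congr (_ + _ + _); congr (_ + _).
  by apply: eq_bigr => j _; rewrite (opL2_swap hV).
- by congr (_ * _); apply: eq_bigr => j _; rewrite (opLbar2_swap hV).
Qed.

Lemma euler_jy zd zd' k z : jy (tjet zd zd' k z) = euler T H V a n k z.
Proof.
elim: k => [//|k IH] /=; apply/colP => i; rewrite !mxE IH.
congr (_ + _ + _).
  by apply: eq_bigr => j _; rewrite /opL IH.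
congr (_ * _); rewrite summxE; apply: eq_bigr => j _.
by rewrite /dVV mxE /opLbar IH.
Qed.

Let shiftz z zd (h : R) : nat -> 'cV[R]_d := fun l => z l + h *: zd l.

Lemma shiftz0 z zd : shiftz z zd 0 = z.
Proof. by apply/funext => l; rewrite /shiftz scale0r addr0. Qed.

Lemma der0_mulop (o : R -> ('cV[R]_m -> R) -> R) (do : ('cV[R]_m -> R) -> R)
    (v dv : 'cV[R]_d) i :
  (forall j, der0 (fun h => o h (vcoef V i j)) (do (vcoef V i j))) ->
  der0 (fun h => mulop (o h) (v + h *: dv) i) (mulop do v i + mulop (o 0) dv i).
Proof.
move=> ho; rewrite /mulop -big_split; apply: der0_sum => j /=.
have hv : der0 (fun h => (v + h *: dv) j 0) (dv j 0).
  under [X in der0 X _]eq_fun do rewrite !mxE.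
  by apply: der0_eq (der0D (der0_cst _) (der0_id_scale _)) _; rewrite add0r.
by apply: der0_eq (der0M (ho j) hv) _; rewrite scale0r addr0.
Qed.

Lemma der0_mulopc (o : R -> ('cV[R]_m -> R) -> R) (do : ('cV[R]_m -> R) -> R)
    (v : 'cV[R]_d) i :
  (forall j, der0 (fun h => o h (vcoef V i j)) (do (vcoef V i j))) ->
  der0 (fun h => mulop (o h) v i) (mulop do v i).
Proof.
move=> ho; apply: der0_sum => j; apply: der0_eq (der0M (ho j) (der0_cst _)) _.
by rewrite mulr0 addr0.
Qed.

Lemma der0_trop (o : R -> ('cV[R]_m -> R) -> ('cV[R]_m -> 'cV[R]_m) -> R)
    (do : ('cV[R]_m -> R) -> ('cV[R]_m -> 'cV[R]_m) -> R) i :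
  (forall j, der0 (fun h => o h (vcoef V i j) (vfield V j))
     (do (vcoef V i j) (vfield V j))) ->
  der0 (fun h => c * trop (o h) i) (c * trop do i).
Proof.
move=> ho; have hs := der0_sum ho.
by apply: der0_eq (der0M (der0_cst c) hs) _; rewrite mul0r add0r.
Qed.

(** Only the derivatives in the direction zd, of y and of u', are computed;
    those in the direction zd' follow by symmetry ([tjet_swap]). *)
Lemma tjet_der zd zd' k z :
  (forall i, der0 (fun h => jy (tjet zd zd' k (shiftz z zd h)) i 0)
                  (ju (tjet zd zd' k z) i 0)) /\
  (forall i, der0 (fun h => ju' (tjet zd zd' k (shiftz z zd h)) i 0)
                  (jz (tjet zd zd' k z) i 0)).
Proof.
elim: k => [|k [IHy IHu]] /=.
  by split=> i; rewrite !mxE; exact: der0_cst.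
pose J h := tjet zd zd' k (shiftz z zd h).
have J0 : tjet zd zd' k z = J 0 by rewrite /J shiftz0.
rewrite J0 in IHy IHu *; rewrite -/(J _) in IHy IHu.
split=> i; rewrite mxE; under [X in der0 X _]eq_fun do rewrite mxE -/(J _).
- apply: der0_eq.
    apply: der0D (der0_trop _); last by move=> j; exact: der0_opLbar0.
    by apply: der0D (IHy i) (der0_mulop _ _ _) => j; exact: der0_opL0.
  by rewrite !addrA.
- apply: der0_eq.
    apply: der0D (der0_trop _); last by move=> j; exact: der0_opLbar1.
    apply: der0D.
      by apply: der0D (IHu i) (der0_mulop _ _ _) => j; exact: der0_opL1.
    by apply: der0_mulopc => j; exact: der0_opL0.
  by rewrite !addrA.
Qed.

Lemma mulop_sum q (o : ('cV[R]_m -> R) -> R) (os : 'I_q -> ('cV[R]_m -> R) -> R) v i :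
  (forall f, o f = \sum_s os s f) -> mulop o v i = \sum_s mulop (os s) v i.
Proof.
move=> ho; rewrite exchange_big; apply: eq_bigr => j _ /=.
by rewrite ho mulr_suml.
Qed.

Lemma mulop_sumr q (o : ('cV[R]_m -> R) -> R) (v : 'I_q -> 'cV[R]_d) i :
  mulop o (\sum_s v s) i = \sum_s mulop o (v s) i.
Proof.
rewrite exchange_big; apply: eq_bigr => j _ /=.
by rewrite summxE mulr_sumr.
Qed.

Lemma trop_sum q (o : ('cV[R]_m -> R) -> ('cV[R]_m -> 'cV[R]_m) -> R) os i :
  (forall f g, o f g = \sum_(s < q) os s f g) -> trop o i = \sum_s trop (os s) i.
Proof.
move=> ho; rewrite exchange_big; apply: eq_bigr => j _ /=; exact: ho.
Qed.

Lemma tjet_sum q zd (zds : 'I_q -> nat -> 'cV[R]_d) zd' k z :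
  (forall l, zd l = \sum_s zds s l) ->
  [/\ forall s, jy (tjet (zds s) zd' k z) = jy (tjet zd zd' k z),
      forall s, ju' (tjet (zds s) zd' k z) = ju' (tjet zd zd' k z),
      ju (tjet zd zd' k z) = \sum_s ju (tjet (zds s) zd' k z) &
      jz (tjet zd zd' k z) = \sum_s jz (tjet (zds s) zd' k z)].
Proof.
move=> hz; elim: k => [|k [ey eu' eu ez]] /=.
  by split=> //; rewrite big1.
set J := tjet zd zd' k z in ey eu' eu ez *.
pose Js s := tjet (zds s) zd' k z.
have o0 s : opL 0 (Js s) = opL 0 J by apply/funext => f; rewrite /opL ey.
have o1 s : opL 1 (jswap (Js s)) = opL 1 (jswap J).
  by apply/funext => f; rewrite /opL !dapp1 /= ey eu'.
have b0 s : opLbar 0 (Js s) = opLbar 0 J.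
  by apply/funext => f; apply/funext => g; rewrite /opLbar ey.
have b1 s : opLbar 1 (jswap (Js s)) = opLbar 1 (jswap J).
  apply/funext => f; apply/funext => g; rewrite /opLbar /= ey eu'.
  by congr (_ + dapp _ _ [tuple _]); apply/colP => i; rewrite !mxE o1.
rewrite -/(Js _) in ey eu' eu ez *.
split.
- by move=> s; apply/colP => i; rewrite !mxE o0 b0 ey.
- by move=> s; apply/colP => i; rewrite !mxE o1 o0 b1 eu'.
- apply/colP => i; rewrite summxE mxE.
  under [RHS]eq_bigr do rewrite mxE o0.
  rewrite !big_split /= -mulr_sumr; congr (_ + _ + _ + _ * _).
  + by rewrite {1}eu summxE.
  + by apply: mulop_sum => f; exact: opL1_sum.
  + by rewrite hz mulop_sumr.
  + by apply: trop_sum => f g; exact: opLbar1_sum.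
- apply/colP => i; rewrite summxE mxE.
  under [RHS]eq_bigr do rewrite mxE o1.
  rewrite !big_split /= -mulr_sumr; congr (_ + _ + _ + _ + _ * _).
  + by rewrite {1}ez summxE.
  + by apply: mulop_sum => f; exact: opL2_sum.
  + by rewrite hz mulop_sumr.
  + by apply: mulop_sum => f; exact: opL1_sum.
  + by apply: trop_sum => f g; exact: opLbar2_sum.
Qed.

Lemma mulopv0 o i : mulop o 0 i = 0.
Proof. by apply: big1 => j _; rewrite mxE mulr0. Qed.

(** The equations of u and z are linear in these components, so that they stay
    0 until zd creates them. *)
Lemma tjet_before zd zd' k z : (forall l, (l < k)%N -> zd l = 0) ->
  ju (tjet zd zd' k z) = 0 /\ jz (tjet zd zd' k z) = 0.
Proof.
elim: k => [//|k IH] hz.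
have [u0 z0] : ju (tjet zd zd' k z) = 0 /\ jz (tjet zd zd' k z) = 0.
  by apply: IH => l lk; apply: hz; exact: ltnW.
have [p1 p2 b1 b2] := op_zero u0 z0.
set J := tjet zd zd' k z in u0 z0 p1 p2 b1 b2 *.
have t0 (w : ('cV[R]_m -> R) -> ('cV[R]_m -> 'cV[R]_m) -> R) :
    (forall f g, w f g = 0) -> forall i, trop w i = 0.
  by move=> h i; apply: big1 => j _; exact: h.
have m0 (w : ('cV[R]_m -> R) -> R) :
    (forall f, w f = 0) -> forall v i, mulop w v i = 0.
  by move=> h v i; apply: big1 => j _; rewrite h mul0r.
rewrite /= -/J hz //; split; apply/colP => i.
  by rewrite !mxE u0 mxE mulopv0 m0 // t0 // mulr0 !addr0.
by rewrite !mxE z0 mxE mulopv0 m0 // m0 // t0 // mulr0 !addr0.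
Qed.

(** Where both directions vanish, no differentiated noise is left and the
    tangent scheme is the iterative equation. *)
Lemma tjet_stepE zd zd' k z : zd k = 0 -> zd' k = 0 -> forall c' i,
  jcomp c' (tjet zd zd' k.+1 z) i 0 - jcomp c' (tjet zd zd' k z) i 0 =
  mulop (opc c' (tjet zd zd' k z)) (z k) i + c * trop (opcbar c' (tjet zd zd' k z)) i.
Proof.
move=> h h' c' i; case: c'; rewrite /= mxE ?h ?h' ?mulopv0 ?addr0 addrAC [X in X + _ = _]addrAC;
  by rewrite subrr add0r.
Qed.

End TangentScheme.

Section MalliavinDerivatives.
Context {R : realType} {m d : nat}.
Variables (T H : R) (V : 'cV[R]_m -> 'M[R]_(m, d)) (a : 'cV[R]_m) (n : nat).
Hypotheses (hV : CbV V 4) (T0 : 0 < T) (n0 : (0 < n)%N).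

(** The direction of D_r when r lies in the grid interval with index k0: all
    coordinates at once, since D_r is the sum of the D^(j)_r. *)
Definition dir (k0 : nat) : nat -> 'cV[R]_d :=
  fun l => if l == k0 then const_mx 1 else 0.
Definition unit_dir (k0 : nat) (j : 'I_d) : nat -> 'cV[R]_d :=
  fun l => if l == k0 then delta_mx j 0 else 0.

Lemma dirE k0 l : dir k0 l = \sum_j unit_dir k0 j l.
Proof.
rewrite /dir /unit_dir; case: eqP => _; last by rewrite big1.
apply/colP => i; rewrite summxE mxE (bigD1 i) //= mxE !eqxx big1 ?addr0 // => j ji.
by rewrite mxE eq_sym (negbTE ji).
Qed.

(** The grid intervals are disjoint, so that r meets exactly one of them. *)
Lemma malliavinE (r : R) (k0 : nat) (F : (nat -> 'cV[R]_d) -> R) z :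
  (k0 < n)%N -> tgrid T n k0 < r <= tgrid T n k0.+1 ->
  malliavin T n r F z = \sum_j incr_pder k0 j F z.
Proof.
move=> kn /andP[h1 h2]; apply: eq_bigr => j _.
have hk (k : nat) : (tgrid T n k < r <= tgrid T n k.+1) = (k == k0).
  apply/idP/eqP => [/andP[a1 a2]|->]; last by rewrite h1.
  have := lt_le_trans a1 h2; have := lt_le_trans h1 a2.
  by rewrite !(tgrid_lt T0 n0) !ltnS => x y; apply/eqP; rewrite eqn_leq x y.
rewrite /malliavin_coord (bigD1 (Ordinal kn)) //= [X in _ + X]big1 => [|k kk].
  rewrite addr0 (bigD1 j) //= [X in _ + X]big1 => [|i ij].
    by rewrite /malliavin_incr hk !eqxx mulr1 addr0.
  by rewrite /malliavin_incr (negbTE ij) mulr0.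
rewrite big1 // => i _; rewrite /malliavin_incr hk.
have /negbTE -> : val k != k0 by apply: contra kk => /eqP kk; apply/eqP/val_inj.
by rewrite andbF mulr0.
Qed.

Lemma incr_pder_der0 k0 j (F : (nat -> 'cV[R]_d) -> R) z dF :
  der0 (fun h => F (fun l => z l + h *: unit_dir k0 j l)) dF -> incr_pder k0 j F z = dF.
Proof.
move=> hd; rewrite /incr_pder.
have -> : (fun h : R => F (fun l => z l + (if l == k0 then h *: delta_mx j 0 else 0)))
    = (fun h => F (fun l => z l + h *: unit_dir k0 j l)).
  apply/funext => h; congr (F _); apply/funext => l; congr (_ + _).
  by rewrite /unit_dir; case: eqP => _ //; rewrite scaler0.
by rewrite derive1E; case: hd.
Qed.

Lemma malliavin_jy r k0 zd' k i z : (k0 < n)%N ->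
  tgrid T n k0 < r <= tgrid T n k0.+1 ->
  malliavin T n r (fun z' => euler T H V a n k z' i 0) z =
  ju (tjet T H V a n (dir k0) zd' k z) i 0.
Proof.
move=> kn hr; rewrite (malliavinE _ _ kn hr).
have [_ _ -> _] := tjet_sum T H V a n zd' k z (dirE k0).
rewrite summxE; apply: eq_bigr => j _; apply: incr_pder_der0.
have [h _] := tjet_der T H a n hV (unit_dir k0 j) zd' k z.
by under [X in der0 X _]eq_fun do rewrite -(euler_jy T H V a n (unit_dir k0 j) zd').
Qed.

Lemma malliavin_ju' r k0 zd' k i z : (k0 < n)%N ->
  tgrid T n k0 < r <= tgrid T n k0.+1 ->
  malliavin T n r (fun z' => ju' (tjet T H V a n (dir k0) zd' k z') i 0) z =
  jz (tjet T H V a n (dir k0) zd' k z) i 0.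
Proof.
move=> kn hr; rewrite (malliavinE _ _ kn hr).
have [_ _ _ ->] := tjet_sum T H V a n zd' k z (dirE k0).
rewrite summxE; apply: eq_bigr => j _; apply: incr_pder_der0.
have [_ h] := tjet_der T H a n hV (unit_dir k0 j) zd' k z.
have e z' : ju' (tjet T H V a n (dir k0) zd' k z') =
    ju' (tjet T H V a n (unit_dir k0 j) zd' k z').
  by have [_ -> _ _] := tjet_sum T H V a n zd' k z' (dirE k0).
by under [X in der0 X _]eq_fun do rewrite e.
Qed.

Variables (x : R -> 'cV[R]_d) (r r' : R) (k0 k0' : nat).
Hypothesis hr : tgrid T n k0 < r <= tgrid T n k0.+1.
Hypothesis hr' : tgrid T n k0' < r' <= tgrid T n k0'.+1.

Let z l := grid_incr T n x l l.+1.
Let J := xi_jet T H V a n x r r'.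

(** Here r' may lie beyond the grid, in which case D_r' is not the derivative
    in a direction. The components y and u do not see r', and any second
    direction may be taken, for instance 0. *)
Lemma xi_jet_u k : (k0 < n)%N -> jy (J k) = jy (tjet T H V a n (dir k0) (fun=> 0) k z) /\
  ju (J k) = ju (tjet T H V a n (dir k0) (fun=> 0) k z).
Proof.
move=> kn; split; first by rewrite euler_jy.
by apply/colP => i; rewrite mxE; exact: malliavin_jy.
Qed.

Lemma xi_jetE k : (k0 < n)%N -> (k0' < n)%N ->
  J k = tjet T H V a n (dir k0) (dir k0') k z.
Proof.
move=> kn kn'.
have e z' i : malliavin T n r' (fun z' => euler T H V a n k z' i 0) z' =
    ju' (tjet T H V a n (dir k0) (dir k0') k z') i 0.
  by rewrite (malliavin_jy (dir k0) _ _ _ kn' hr') (tjet_swap _ _ _ _ hV (dir k0)).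
rewrite /J /xi_jet -/z; case E : (tjet _ _ _ _ _ _ _ _ _) => [y1 u1 u1' z1].
congr Jet.
- by rewrite -(euler_jy T H V a n (dir k0) (dir k0')) E.
- by apply/colP => i; rewrite mxE (malliavin_jy (dir k0') _ _ _ kn hr) E.
- by apply/colP => i; rewrite mxE e E.
- apply/colP => i; rewrite mxE.
  rewrite (_ : malliavin T n r' _ = fun z' =>
      ju' (tjet T H V a n (dir k0) (dir k0') k z') i 0); last exact/funext.
  by rewrite (malliavin_ju' _ _ _ _ kn hr) E.
Qed.

End MalliavinDerivatives.

(** * Assembly along the greedy times *)

Section GridPath.
Context {R : realType} {m d : nat}.
Variables (T H p : R) (V : 'cV[R]_m -> 'M[R]_(m, d)) (a : 'cV[R]_m).
Hypotheses (T0 : 0 < T) (H0 : 0 < H) (p0 : 0 < p) (hV : CbV V 4).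

Variables (C K1 K : R).
Hypotheses (C0 : 0 <= C) (K11 : 1 <= K1).
Hypothesis hC : forall (J : jet R m) c i j j',
  `|opc c J (vcoef V i j)| <= C * csc c J /\
  `|opcbar c J (vcoef V i j') (vfield V j)| <= C * csc c J.
Hypothesis hK1 : forall n X B om (J : nat -> jet R m) s N, grid_driver p n X B om ->
  (s <= N)%N -> (N <= n)%N ->
  (forall k, (s <= k)%N -> (k < N)%N -> jet_step V X B J k) ->
  om s N <= 1 -> p < 3 \/ om s N = 0 ->
  let h := om s N `^ p^-1 in forall c i, c <> Cy ->
  `|jcomp c (J N) i 0 - jcomp c (J s) i 0 - \sum_j opc c (J s) (vcoef V i j) * X j s N|
    <= K1 * h ^+ 2 * csc c (J s) /\
  `|jcomp c (J N) i 0 - jcomp c (J s) i 0| <= K1 * h * csc c (J s).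

Variable alpha : R.
Hypotheses (al0 : 0 <= alpha) (al1 : alpha <= 1) (pal : p < 3 \/ alpha = 0).

Let dm : R := d%:R.
Let mm : R := m%:R.
Let A : R := K1 + dm * C + dm ^+ 2 * C * (2 + T `^ (2 * H)).
Let cc : R := (1 + mm * K1) ^+ 2.
Hypothesis hK : mm * K1 + mm * (dm * C + dm ^+ 2 * C) <= K.

Variables (n : nat) (x b : R -> 'cV[R]_d) (w2 : R -> R -> 'M[R]_(d + d)).
Hypothesis n0 : (0 < n)%N.
Let w t := col_mx (x t) (b t).
Hypothesis chen : forall s u t, 0 <= s -> s <= u -> u <= t -> t <= T ->
  w2 s t = w2 s u + w2 u t + (w u - w s) *m (w t - w u)^T.

Let om := control p T H n w w2.
Let X := drvX T n x.
Let B := drvB T H n w2.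
Let z l := grid_incr T n x l l.+1.
Let gd : grid_driver p n X B om. Proof. exact: grid_driverP. Qed.
Let next := gnext alpha n om.
Let h k l := om k l `^ p^-1.

(* The factor of one greedy interval in the product of the M_i. *)
Let f k : R := if S2 alpha n om k
  then K * enorm (grid_incr T n w k (next k)) + K * mesh T n `^ (2 * H) + 1
  else K * h k (next k) + 1.
Let F := gprod alpha n om f.

Lemma mm0 : 0 <= mm. Proof. exact: ler0n. Qed.
Lemma dm0 : 0 <= dm. Proof. exact: ler0n. Qed.
Lemma dmC0 : 0 <= dm * C /\ 0 <= dm ^+ 2 * C.
Proof. by split; apply: mulr_ge0 => //; rewrite ?exprn_ge0 ?dm0. Qed.
Lemma K0 : 0 <= K.
Proof.
apply: le_trans hK; have [h1 h2] := dmC0.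
have k1 : 0 <= K1 := le_trans ler01 K11.
exact: addr_ge0 (mulr_ge0 mm0 k1) (mulr_ge0 mm0 (addr_ge0 h1 h2)).
Qed.
Lemma A0 : 0 <= A.
Proof.
have [h1 h2] := dmC0; have k1 : 0 <= K1 := le_trans ler01 K11.
by apply: addr_ge0; [exact: addr_ge0|rewrite mulr_ge0 // addr_ge0 // powR_ge0].
Qed.
Lemma K1A : K1 <= A.
Proof.
have [h1 h2] := dmC0; rewrite /A -addrA lerDl addr_ge0 // mulr_ge0 //.
by rewrite addr_ge0 // powR_ge0.
Qed.
Lemma cc1 : 1 <= cc.
Proof. by rewrite exprn_ege1 // lerDl mulr_ge0 ?mm0 // (le_trans ler01 K11). Qed.

Lemma hge0 k l : 0 <= h k l. Proof. exact: powR_ge0. Qed.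

Lemma h_mono k l k' l' : (k' <= k)%N -> (k <= l)%N -> (l <= l')%N -> (l' <= n)%N ->
  h k l <= h k' l'.
Proof. exact: (om_powR_mono p0 gd). Qed.

Lemma f_ge1 k : 1 <= f k.
Proof.
have k0 := K0; rewrite /f; case: ifP => _; rewrite lerDr.
  by rewrite addr_ge0 ?mulr_ge0 ?enorm_ge0 ?powR_ge0.
by rewrite mulr_ge0 ?powR_ge0.
Qed.

Lemma f_ge0 k : 0 <= f k. Proof. exact: le_trans ler01 (f_ge1 k). Qed.

Lemma calME : calM p alpha n om T H w K = F n.
Proof.
rewrite /calM /calM01 /calM2 /F /gprod big_mkord.
rewrite (big_mkcond (fun k : 'I_n => S0 alpha n om k)) /=.
rewrite (big_mkcond (fun k : 'I_n => S1 alpha n om k)) /=.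
rewrite (big_mkcond (fun k : 'I_n => S2 alpha n om k)) /= -!big_split /=.
apply: eq_bigr => k _; rewrite /f /S0 /S1 /S2 -/next /h.
case: (is_greedy alpha n om k) => /=; last by rewrite !mulr1.
have [h1|h1] := ltP alpha (om k (next k)).
  have h2 : alpha / 2 <= om k (next k).
    by have a0 := al0; have := ltW h1; move: (om _ _) => o1; lra.
  by rewrite andbF ltNge h2 /= !mul1r.
by rewrite andbT; case: ltP; rewrite /= ?mulr1 ?mul1r.
Qed.

Lemma mesh_powR_le : mesh T n `^ (2 * H) <= T `^ (2 * H).
Proof.
have t0 : 0 <= T := ltW T0; have e0 : 0 <= mesh T n := ltW (mesh_gt0 T0 n0).
have h0 : 0 <= 2 * H by rewrite mulr_ge0 // ltW.
apply: ge0_ler_powR; rewrite ?nnegrE //.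
rewrite /mesh ler_pdivrMr ?ltr0n // ler_peMr ?ler1n //; exact: ltW.
Qed.

Lemma X_le k j : `|X j k k.+1| <= enorm (grid_incr T n w k k.+1).
Proof.
have -> : X j k k.+1 = grid_incr T n w k k.+1 (lshift d j) 0.
  by rewrite /X /drvX /grid_incr /w opp_col_mx add_col_mx col_mxEu !mxE.
exact: coord_le_enorm.
Qed.

Lemma B_le k j j' : `|B j j' k k.+1| <= mesh T n `^ (2 * H).
Proof.
have m0 := powR_ge0 (mesh T n) (2 * H).
rewrite /B drvB_step normrM (ger0_norm (_ : 0 <= _ / 2)) ?divr_ge0 //.
by case: (j == j'); rewrite ?normr1 ?normr0; lra.
Qed.

(** For h <= 1 this is the bound of order h ^ 2; otherwise the constant bound
    from the mesh suffices. *)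
Lemma B_le_h k j j' : (k < n)%N -> `|B j j' k k.+1| <= (2 + T `^ (2 * H)) * h k k.+1.
Proof.
move=> kn; have h0 := hge0 k k.+1; have t0 := powR_ge0 T (2 * H).
have [h1|h1] := leP (h k k.+1) 1.
  apply: le_trans (gd_B gd j j' (leqnSn k) kn) _; rewrite -/(h k k.+1).
  apply: (@le_trans _ _ (2 * h k k.+1)).
    by rewrite ler_wpM2l // expr2 ler_piMl.
  by rewrite ler_wpM2r // lerDl.
apply: le_trans (B_le k j j') _; apply: le_trans mesh_powR_le _.
by apply: (@le_trans _ _ (T `^ (2 * H) * h k k.+1)); [rewrite ler_peMr // ltW|rewrite ler_wpM2r // lerDr].
Qed.

Section ActiveJets.
Variables (J : nat -> jet R m) (e : nat).
Hypothesis st : forall k, (e <= k)%N -> (k < n)%N -> jet_step V X B J k.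

Lemma interval01 s k l c i : S0 alpha n om s || S1 alpha n om s ->
  (s <= k)%N -> (e <= k)%N -> (k <= l)%N -> (l <= next s)%N -> c <> Cy ->
  `|jcomp c (J l) i 0 - jcomp c (J k) i 0 - \sum_j opc c (J k) (vcoef V i j) * X j k l|
    <= K1 * h k l ^+ 2 * csc c (J k) /\
  `|jcomp c (J l) i 0 - jcomp c (J k) i 0| <= K1 * h k l * csc c (J k).
Proof.
move=> s01 sk ek kl ls hc.
have [gs oms] := S01_le s01 al0; have /andP[sn _] := gs.
have /andP[_ nn] := gnext_bounds alpha om sn.
have ln := leq_trans ls nn.
have omkl : om k l <= alpha by apply: le_trans oms; exact: (om_mono gd).
apply: (hK1 gd) => //.
- by move=> k' kk' k'l; apply: st; [exact: leq_trans kk'|exact: leq_trans ln].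
- exact: le_trans omkl al1.
- case: pal => [|al]; [by left|right].
  by apply/eqP; rewrite eq_le (gd_ge0 gd kl ln) andbT -al.
Qed.

Lemma interval2 s c i : S2 alpha n om s -> (e <= s)%N ->
  `|jcomp c (J s.+1) i 0 - jcomp c (J s) i 0| <= A * h s s.+1 * csc c (J s).
Proof.
move=> s2 es; have /andP[/andP[sn _] _] := s2.
have h0 := hge0 s s.+1; have t0 := powR_ge0 T (2 * H).
have t2 : 0 <= (2 + T `^ (2 * H)) * h s s.+1 by rewrite mulr_ge0 // addr_ge0.
apply: le_trans (one_step C0 h0 t2 hC (st es sn) _ _ c i) _.
- by move=> j; exact: (gd_X gd).
- by move=> j j'; exact: B_le_h.
rewrite ler_wpM2r ?csc_ge0 //.
have -> : dm * C * h s s.+1 + dm ^+ 2 * C * ((2 + T `^ (2 * H)) * h s s.+1) =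
  (A - K1) * h s s.+1 by rewrite /A; ring.
by rewrite ler_wpM2r // lerBlDr lerDl (le_trans ler01 K11).
Qed.

Lemma interval_increment s k l c i : is_greedy alpha n om s ->
  (s <= k)%N -> (e <= k)%N -> (k <= l)%N -> (l <= next s)%N -> c <> Cy ->
  `|jcomp c (J l) i 0 - jcomp c (J k) i 0| <= A * h k l * csc c (J k).
Proof.
move=> gs sk ek kl ls hc.
case: (greedy_cases gs) => [s2|/andP[s01 _]]; last first.
  have [_ hh] := interval01 i s01 sk ek kl ls hc.
  apply: le_trans hh _; rewrite ler_wpM2r ?csc_ge0 // ler_wpM2r ?hge0 //; exact: K1A.
rewrite /next (S2_next s2) in ls.
have [->|kl'] := eqVneq k l.
  by rewrite subrr normr0 !mulr_ge0 ?A0 ?hge0 ?csc_ge0.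
have {}kl' : (k < l)%N by rewrite ltn_neqAle kl'.
have e1 : k = s by apply/eqP; rewrite eqn_leq sk andbT -ltnS (leq_trans kl' ls).
have -> : l = s.+1 by apply/eqP; rewrite eqn_leq ls -e1.
by rewrite e1; apply: interval2 => //; rewrite -e1.
Qed.

(** On an interval of S_0 or S_1 the relative increment is at most K1 * h, on
    the single step of S_2 it is linear in the increment of the path and in
    the correction: these are the factors of the M_i. *)
Lemma interval_growth s l c : is_greedy alpha n om s ->
  (e <= s)%N -> (s <= l)%N -> (l <= next s)%N ->
  csc c (J l) <= f s ^+ cdeg c * csc c (J s).
Proof.
move=> gs es sl ls.
have f1 := f_ge1 s; have s0 := csc_ge0 c (J s).
have [<-|sl'] := eqVneq s l.
  by rewrite ler_peMl // exprn_ege1.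
have /andP[sn _] := gs; have /andP[_ nn] := gnext_bounds alpha om sn.
suff [eta eta0 [he hf]] : exists2 eta : R, 0 <= eta &
    (forall c i, c <> Cy -> `|jcomp c (J l) i 0 - jcomp c (J s) i 0| <= eta * csc c (J s))
    /\ 1 + mm * eta <= f s.
  apply: le_trans (csc_growth eta0 he c) _; rewrite ler_wpM2r //.
  by rewrite lerXn2r ?nnegrE ?f_ge0 // addr_ge0 // mulr_ge0.
have [d1 d2] := dmC0; have m0 := mm0.
case: (greedy_cases gs) => [s2|/andP[s01 ns2]].
  have el : l = s.+1.
    rewrite /next (S2_next s2) in ls.
    by apply/eqP; rewrite eqn_leq ls ltn_neqAle sl' sl.
  pose W := enorm (grid_incr T n w s s.+1); pose M := mesh T n `^ (2 * H).
  have W0 : 0 <= W by exact: enorm_ge0.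
  have M0 : 0 <= M by exact: powR_ge0.
  exists (dm * C * W + dm ^+ 2 * C * M); first by rewrite addr_ge0 ?mulr_ge0.
  split.
    move=> c' i _; rewrite el.
    by apply: one_step => //; [exact: st|exact: X_le|exact: B_le].
  rewrite /f s2 /next (S2_next s2) -/W -/M [leRHS]addrC lerD2l.
  have q1 : mm * (dm * C) <= K.
    apply: le_trans hK; rewrite mulrDr addrA.
    have := mulr_ge0 m0 d2; have := mulr_ge0 m0 (le_trans ler01 K11).
    by move: (mm * _) (mm * _) (mm * _) => u v w' *; lra.
  have q2 : mm * (dm ^+ 2 * C) <= K.
    apply: le_trans hK; rewrite mulrDr addrA.
    have := mulr_ge0 m0 d1; have := mulr_ge0 m0 (le_trans ler01 K11).
    by move: (mm * _) (mm * _) (mm * _) => u v w' *; lra.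
  have -> : mm * (dm * C * W + dm ^+ 2 * C * M) =
      mm * (dm * C) * W + mm * (dm ^+ 2 * C) * M by ring.
  exact: lerD (ler_wpM2r W0 q1) (ler_wpM2r M0 q2).
have K10 : 0 <= K1 := le_trans ler01 K11.
exists (K1 * h s (next s)); first by rewrite mulr_ge0 ?hge0.
split.
  move=> c' i hc; have [_ hh] := interval01 i s01 (leqnn s) es sl ls hc.
  apply: le_trans hh _; apply: ler_wpM2r; first exact: csc_ge0.
  by apply: (ler_wpM2l K10); exact: h_mono.
rewrite /f (negbTE ns2) addrC lerD2r mulrA ler_wpM2r ?hge0 //.
apply: le_trans hK; rewrite lerDl mulr_ge0 //; exact: addr_ge0.
Qed.

(** An interval of S_2 is a single step; one with a grid point strictly inside
    belongs to S_0 or S_1, and its control is at most 1. *)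
Lemma interval_growth_inside s l c : is_greedy alpha n om s ->
  (s < e)%N -> (e <= l)%N -> (l <= next s)%N ->
  csc c (J l) <= cc * csc c (J e).
Proof.
move=> gs se el ls.
have s0 := csc_ge0 c (J e).
have [<-|el'] := eqVneq e l; first by rewrite ler_peMl // cc1.
have /andP[sn _] := gs; have /andP[_ nn] := gnext_bounds alpha om sn.
case: (greedy_cases gs) => [s2|/andP[s01 ns2]].
  have {}el' : (e < l)%N by rewrite ltn_neqAle el'.
  rewrite /next (S2_next s2) in ls.
  by have := leq_trans el' ls; rewrite ltnS leqNgt se.
have K10 : 0 <= K1 := le_trans ler01 K11.
have he c' i : c' <> Cy -> `|jcomp c' (J l) i 0 - jcomp c' (J e) i 0| <= K1 * csc c' (J e).
  move=> hc; have [_ hh] := interval01 i s01 (ltnW se) (leqnn e) el ls hc.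
  apply: le_trans hh _; apply: ler_wpM2r; first exact: csc_ge0.
  apply: ler_piMr; first exact: K10.
  have [_ oms] := S01_le s01 al0.
  have ip : 0 <= p^-1 by rewrite invr_ge0 ltW.
  have e1 : (1 : R) `^ p^-1 = 1 by rewrite powR1.
  have omel : om e l <= om s (next s) by apply: (om_mono gd) => //; exact: ltnW.
  rewrite -[leRHS]e1; apply: ge0_ler_powR => //; rewrite ?nnegrE //.
    by apply: (gd_ge0 gd) => //; exact: leq_trans nn.
  by apply: le_trans omel _; exact: le_trans al1.
apply: le_trans (csc_growth K10 he c) _; rewrite ler_wpM2r //.
have q1 : 1 <= 1 + mm * K1 by rewrite lerDl mulr_ge0 ?mm0.
by rewrite /cc; case: c {s0} => /=; apply: ler_weXn2l.
Qed.

Lemma global_growth c (C2 : R) : 0 <= C2 ->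
  csc c (J e) <= C2 * F e ^+ cdeg c -> forall l, (e <= l)%N -> (l <= n)%N ->
  csc c (J l) <= cc * C2 * F l ^+ cdeg c.
Proof.
move=> C20 he; apply: (greedy_growth n0 f_ge1 C20 cc1 (fun k => csc_ge0 c (J k)) he).
- by move=> s l gs es sl ls; exact: interval_growth.
- by move=> s l gs se el ls; exact: (interval_growth_inside c gs).
Qed.

Lemma global_increment c (Q : R) : c <> Cy -> 0 <= Q ->
  (forall l, (e <= l)%N -> (l <= n)%N -> csc c (J l) <= Q) ->
  forall u v, (e <= u)%N -> (u <= v)%N -> (v <= n)%N ->
  enorm (jcomp c (J v) - jcomp c (J u)) <=
    mm * (A * Q * (card_S alpha n om)%:R) * h u v.
Proof.
move=> hc Q0 hQ u v eu uv vn.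
have AQ : 0 <= A * Q by rewrite mulr_ge0 ?A0.
rewrite -mulrA; apply: enorm_cV_le.
  by apply: mulr_ge0; [exact: mulr_ge0|exact: hge0].
move=> i; rewrite !mxE.
have := @greedy_increment _ alpha n om n0 (fun k => jcomp c (J k) i 0) h e (A * Q) AQ
  hge0 h_mono _ u v eu uv vn.
move=> /(_ _)/le_trans; apply.
  move=> s k l gs sk ek kl ls.
  have /andP[sn _] := gs; have /andP[_ nn] := gnext_bounds alpha om sn.
  apply: le_trans (interval_increment i gs sk ek kl ls hc) _.
  rewrite -!mulrA ler_wpM2l ?A0 // mulrC ler_wpM2r ?hge0 //.
  by apply: hQ => //; exact: leq_trans kl (leq_trans ls nn).
rewrite ler_wpM2r ?hge0 // ler_wpM2l // ler_nat card_SE; exact: gcount_mono.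
Qed.

End ActiveJets.

(** The correction of the scheme, a diagonal sum, is the contraction with B on
    a single grid interval. *)
Lemma tjet_active zd zd' e : (forall k, (e <= k)%N -> zd k = 0) ->
  (forall k, (e <= k)%N -> zd' k = 0) ->
  forall k, (e <= k)%N -> (k < n)%N ->
  jet_step V X B (fun k => tjet T H V a n zd zd' k z) k.
Proof.
move=> h1 h2 k ek kn c i; rewrite tjet_stepE ?h1 ?h2 //; congr (_ + _).
rewrite mulr_sumr; apply: eq_bigr => j _.
rewrite (bigD1 j) //= big1 ?addr0 => [|j' jj'].
  by rewrite /B drvB_step eqxx mulr1 mulrC.
by rewrite /B drvB_step eq_sym (negbTE jj') !mulr0.
Qed.

Lemma mulop_le (o : ('cV[R]_m -> R) -> R) (Q : R) (v : 'cV[R]_d) i :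
  (forall j, `|o (vcoef V i j)| <= Q) -> (forall j, `|v j 0| <= 1) ->
  `|mulop V o v i| <= dm * Q.
Proof.
move=> ho hv; apply: norm_sum_le => j.
by rewrite normrM -[leRHS]mulr1 ler_pM.
Qed.

Lemma dir_le1 k0 l j : `|(dir k0 l : 'cV[R]_d) j 0| <= 1.
Proof. by rewrite /dir; case: ifP => _; rewrite mxE ?normr1 ?normr0. Qed.

Lemma dir_after k0 l : (k0 < l)%N -> dir k0 l = 0 :> 'cV[R]_d.
Proof. by rewrite /dir ltn_neqAle eq_sym => /andP[/negbTE ->]. Qed.

Lemma dir_before k0 l : (l < k0)%N -> dir k0 l = 0 :> 'cV[R]_d.
Proof. by rewrite /dir ltn_neqAle => /andP[/negbTE ->]. Qed.

Let C3 : R := cc * (1 + mm * (dm * C)).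

Lemma C3_ge1 : 1 <= C3.
Proof.
have [d1 _] := dmC0; have q : 1 <= 1 + mm * (dm * C) by rewrite lerDl mulr_ge0 ?mm0.
by have := ler_pM ler01 ler01 cc1 q; rewrite mulr1.
Qed.

Lemma F_ge1 k : 1 <= F k. Proof. exact: gprod_ge1 f_ge1 k. Qed.

(** The first derivative is 0 up to time k0 and is created at time k0 + 1 with
    the value of V at the previous point, which is bounded. From there on
    [global_growth] applies. *)
Lemma first_growth k0 zd' : (k0 < n)%N -> forall k, (k <= n)%N ->
  csc Cu (tjet T H V a n (dir k0) zd' k z) <= C3 * F k.
Proof.
move=> kn k kle.
have indep k' : ju (tjet T H V a n (dir k0) zd' k' z) =
    ju (tjet T H V a n (dir k0) (fun=> 0) k' z) /\
    jy (tjet T H V a n (dir k0) zd' k' z) = jy (tjet T H V a n (dir k0) (fun=> 0) k' z).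
  split; last by rewrite !euler_jy.
  elim: k' => [//|k' IH] /=; apply/colP => i; rewrite !mxE IH.
  have ey : jy (tjet T H V a n (dir k0) zd' k' z) =
    jy (tjet T H V a n (dir k0) (fun=> 0) k' z) by rewrite !euler_jy.
  have o0 : opL 0 (tjet T H V a n (dir k0) zd' k' z) =
    opL 0 (tjet T H V a n (dir k0) (fun=> 0) k' z) by rewrite /opL ey.
  have o1 : opL 1 (tjet T H V a n (dir k0) zd' k' z) =
    opL 1 (tjet T H V a n (dir k0) (fun=> 0) k' z).
    by apply/funext => g; rewrite /opL !dapp1 ey IH.
  have b1 : opLbar 1 (tjet T H V a n (dir k0) zd' k' z) =
    opLbar 1 (tjet T H V a n (dir k0) (fun=> 0) k' z).
    apply/funext => g; apply/funext => g'; rewrite /opLbar ey IH.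
    by congr (_ + dapp _ _ [tuple _]); apply/colP => j; rewrite !mxE o1.
  by rewrite o0 o1 b1.
rewrite (_ : csc Cu _ = csc Cu (tjet T H V a n (dir k0) (fun=> 0) k z)); last first.
  by rewrite /csc /Pmax (indep k).1.
have [kk0|k0k] := leqP k k0.
  have hz l : (l < k)%N -> dir k0 l = 0 :> 'cV[R]_d.
    by move=> lk; apply: dir_before; exact: leq_trans kk0.
  have [u0 _] := tjet_before T H V a n (fun=> 0) z hz.
  rewrite /csc /Pmax u0 enorm0 maxEle ler10 /=.
  by have := ler_pM ler01 ler01 C3_ge1 (F_ge1 k); rewrite mulr1.
pose J k := tjet T H V a n (dir k0) (fun=> 0) k z.
have st := @tjet_active (dir k0) (fun=> 0) k0.+1 (fun k hk => dir_after hk) (fun _ _ => erefl).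
have [d1 _] := dmC0.
have C20 : 0 <= 1 + mm * (dm * C) by rewrite addr_ge0 ?mulr_ge0 ?mm0.
have he : csc Cu (J k0.+1) <= (1 + mm * (dm * C)) * F k0.+1 ^+ cdeg Cu.
  apply: (@le_trans _ _ (1 + mm * (dm * C))); last first.
    by rewrite ler_peMr // expr1 F_ge1.
  rewrite /csc /Pmax ge_max lerDl mulr_ge0 ?mm0 //=.
  apply: (@le_trans _ _ (mm * (dm * C))); last by rewrite lerDr.
  apply: enorm_cV_le => // i.
  have [u0 z0] := tjet_before T H V a n (fun=> 0) z (dir_before (k0 := k0)).
  have [p1 _ b1 _] := op_zero u0 z0.
  rewrite /J tjet_uS u0 -/(J k0) in p1 b1 *.
  have e1 : mulop V (opL 1 (J k0)) (z k0) i = 0 by apply: big1 => j _; rewrite p1 mul0r.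
  have e2 : trop V (opLbar 1 (J k0)) i = 0 by apply: big1 => j _; rewrite b1.
  rewrite e1 e2 mulr0 mxE addr0 !add0r.
  apply: mulop_le => j; last exact: dir_le1.
  by have [+ _] := hC (J k0) Cy i j j; rewrite mulr1.
exact: (global_growth st C20 he k0k kle).
Qed.

Let C4 : R := C3 ^+ 2 + mm * (dm * (C * C3) + dm * (C * C3)).

(** At the creation time z consists of the terms with differentiated noise,
    which are linear in the first derivatives and hence bounded by F. The
    square enters through |u| |u'| in P^2. *)
Lemma second_growth k0 k0' : (k0 < n)%N -> (k0' < n)%N ->
  forall k, (maxn k0 k0' < k)%N -> (k <= n)%N ->
  csc Cz (tjet T H V a n (dir k0) (dir k0') k z) <= cc * C4 * F k ^+ 2.
Proof.
move=> kn kn' k mk kle.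
pose J k := tjet T H V a n (dir k0) (dir k0') k z.
pose M := maxn k0 k0'.
have Mn : (M < n)%N by rewrite gtn_max kn.
have [d1 _] := dmC0; have c31 := C3_ge1; have c30 : 0 <= C3 := le_trans ler01 c31.
have st := @tjet_active (dir k0) (dir k0') M.+1
   (fun k hk => dir_after (leq_ltn_trans (leq_maxl _ _) hk))
   (fun k hk => dir_after (leq_ltn_trans (leq_maxr _ _) hk)).
have b0 : 0 <= dm * (C * C3) by rewrite mulr_ge0 ?dm0 // mulr_ge0.
have C40 : 0 <= C4.
  exact: addr_ge0 (sqr_ge0 _) (mulr_ge0 mm0 (addr_ge0 b0 b0)).
have hu k' : (k' <= n)%N -> csc Cu (J k') <= C3 * F k' by exact: first_growth.
have hu' k' : (k' <= n)%N -> csc Cu' (J k') <= C3 * F k'.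
  move=> hk'; have := @first_growth k0' (dir k0) kn' k' hk'.
  by rewrite (tjet_swap _ _ _ _ hV (dir k0)).
have F0 k' : 0 <= F k' := le_trans ler01 (F_ge1 k').
have hz i : `|jz (J M.+1) i 0| <= (dm * (C * C3) + dm * (C * C3)) * F M.+1.
  (* The operators are linear in the derivative that is created last. *)
  have zero : [/\ jz (J M) = 0, forall j, opL 2 (J M) (vcoef V i j) = 0 &
      forall j, opLbar 2 (J M) (vcoef V i j) (vfield V j) = 0].
    have [h1|h1] := leqP k0 k0'.
      have e1 : M = k0' by apply/maxn_idPr.
      have hb l : (l < M)%N -> dir k0' l = 0 :> 'cV[R]_d.
        by rewrite e1; exact: dir_before.
      have [u0 z0] := tjet_before T H V a n (dir k0) z hb.
      have [_ o2 _ b2] := op_zero u0 z0.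
      rewrite (tjet_swap _ _ _ _ hV (dir k0)) in z0 o2 b2.
      split=> [|j|j]; first exact: z0.
        by rewrite -(opL2_swap hV); exact: o2.
      by rewrite -(opLbar2_swap hV); exact: b2.
    have e1 : M = k0 by apply/maxn_idPl; exact: ltnW.
    have hb l : (l < M)%N -> dir k0 l = 0 :> 'cV[R]_d.
      by rewrite e1; exact: dir_before.
    have [u0 z0] := tjet_before T H V a n (dir k0') z hb.
    have [_ o2 _ b2] := op_zero u0 z0.
    by split=> [|j|j]; [exact: z0|exact: o2|exact: b2].
  have [z0 o2 b2] := zero.
  rewrite /J tjet_zS -/(J M) z0.
  have e1 : mulop V (opL 2 (J M)) (z M) i = 0 by apply: big1 => j _; rewrite o2 mul0r.
  have e2 : trop V (opLbar 2 (J M)) i = 0 by apply: big1 => j _; rewrite b2.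
  rewrite e1 e2 mulr0 mxE addr0 !add0r mulrDl; apply: le_trans (ler_normD _ _) _.
  have FM : F M <= F M.+1 by exact: gprod_mono f_ge1 _ _ (leqnSn M).
  have q : C3 * F M <= C3 * F M.+1 by rewrite ler_wpM2l.
  have -> : dm * (C * C3) * F M.+1 = dm * (C * (C3 * F M.+1)) by ring.
  apply: lerD; apply: mulop_le => j; try exact: dir_le1.
    have [+ _] := hC (J M) Cu' i j j; move/le_trans; apply.
    by apply: ler_wpM2l => //; exact: le_trans (hu' M (ltnW Mn)) q.
  have [+ _] := hC (J M) Cu i j j; move/le_trans; apply.
  by apply: ler_wpM2l => //; exact: le_trans (hu M (ltnW Mn)) q.
have he : csc Cz (J M.+1) <= C4 * F M.+1 ^+ cdeg Cz.
  have a1 := le_trans (csc_ge1 Cu _) (hu M.+1 Mn).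
  have a2 : enorm (ju (J M.+1)) <= C3 * F M.+1.
    by apply: le_trans (hu M.+1 Mn); apply: (@enorm_le_csc _ _ Cu (J M.+1)).
  have a2' : enorm (ju' (J M.+1)) <= C3 * F M.+1.
    by apply: le_trans (hu' M.+1 Mn); apply: (@enorm_le_csc _ _ Cu' (J M.+1)).
  set G := F M.+1 in a1 a2 a2' hz *; have G1 : 1 <= G := F_ge1 _.
  have q0 : 0 <= mm * (dm * (C * C3) + dm * (C * C3)).
    exact: mulr_ge0 mm0 (addr_ge0 b0 b0).
  have G0 : 0 <= G by exact: le_trans G1.
  have CG0 : 0 <= C3 * G by exact: mulr_ge0.
  have sq : C3 * G <= C3 ^+ 2 * G ^+ 2.
    by rewrite -exprMn expr2 ler_peMl.
  have l1 : C3 ^+ 2 * G ^+ 2 <= C4 * G ^+ 2.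
    by rewrite ler_wpM2r ?sqr_ge0 // /C4 lerDl.
  have t1 t : t <= C3 * G -> t <= C4 * G ^+ 2.
    by move=> ht; exact: le_trans ht (le_trans sq l1).
  rewrite /csc /Pmax !ge_max; apply/andP; split; first (apply/andP; split).
  - by rewrite !t1.
  - apply: le_trans (ler_pM (enorm_ge0 _) (enorm_ge0 _) a2 a2') _.
    by apply: le_trans l1; rewrite -exprMn expr2.
  - have bz : 0 <= (dm * (C * C3) + dm * (C * C3)) * G.
      exact: mulr_ge0 (addr_ge0 b0 b0) G0.
    apply: le_trans (enorm_cV_le bz hz) _; rewrite mulrA.
    apply: (@le_trans _ _ (C4 * G)).
      by rewrite ler_wpM2r // /C4 lerDr sqr_ge0.
    by rewrite ler_wpM2l // expr2 ler_peMl.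
exact: (global_growth st C40 he mk kle).
Qed.

Variables (r r' : R) (k0 k0' : nat).
Hypothesis hr : tgrid T n k0 < r <= tgrid T n k0.+1.
Hypothesis hr' : tgrid T n k0' < r' <= tgrid T n k0'.+1.

Let Jn := xi_jet T H V a n x r r'.

Lemma after1E u : after T n r r' 1 u = (k0 < u)%N.
Proof.
have /andP[h1 h2] := hr; rewrite /after; apply/idP/idP => hu.
  by rewrite -(tgrid_lt T0 n0); exact: lt_le_trans hu.
by apply: le_trans h2 _; rewrite (tgrid_le T0 n0).
Qed.

Lemma after2E u : after T n r r' 2 u = (maxn k0 k0' < u)%N.
Proof.
have /andP[h1 h2] := hr'; rewrite /after ge_max gtn_max -after1E /after; congr andb.
apply/idP/idP => hu.
  by rewrite -(tgrid_lt T0 n0); exact: lt_le_trans hu.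
by apply: le_trans h2 _; rewrite (tgrid_le T0 n0).
Qed.

Lemma F0 k : 0 <= F k. Proof. exact: le_trans ler01 (F_ge1 k). Qed.

Lemma F_mono k l : (k <= l)%N -> F k <= F l.
Proof. exact: gprod_mono f_ge1 k l. Qed.

Lemma C3_ge0 : 0 <= C3. Proof. exact: le_trans ler01 C3_ge1. Qed.

Lemma cc0 : 0 <= cc. Proof. exact: le_trans ler01 cc1. Qed.

Lemma C4_ge0 : 0 <= C4.
Proof.
have b0 : 0 <= dm * (C * C3) := mulr_ge0 dm0 (mulr_ge0 C0 C3_ge0).
exact: addr_ge0 (sqr_ge0 _) (mulr_ge0 mm0 (addr_ge0 b0 b0)).
Qed.

Let N : R := (card_S alpha n om)%:R.

Lemma xi1_pvar k l : (k <= l)%N -> (l <= n)%N ->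
  xi_pvar p T n r r' Jn 1 k l <= mm * (A * (C3 * F n) * N) * om k l `^ p^-1.
Proof.
move=> kl ln.
have Q0 : 0 <= C3 * F n := mulr_ge0 C3_ge0 (F0 n).
apply: xi_pvar_le => //.
- by apply: mulr_ge0 mm0 _; apply: mulr_ge0 => //; exact: mulr_ge0 A0 Q0.
- by move=> u v _ uv vl; apply: (gd_ge0 gd) => //; exact: leq_trans vl ln.
- by move=> u v t _ uv vt tl; apply: (gd_super gd) => //; exact: leq_trans tl ln.
move=> u v ku uv vl; rewrite !after1E => k0u k0v.
have kn : (k0 < n)%N by apply: leq_trans k0v (leq_trans vl ln).
have eu j : ju (Jn j) = ju (tjet T H V a n (dir k0) (fun=> 0) j z) :=
  (xi_jet_u H a hV T0 n0 x r' hr j kn).2.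
have e1 : jxi 1 (Jn v) - jxi 1 (Jn u) =
    jcomp Cu (tjet T H V a n (dir k0) (fun=> 0) v z)
    - jcomp Cu (tjet T H V a n (dir k0) (fun=> 0) u z).
  exact: (f_equal2 (fun s t => s - t) (eu v) (eu u)).
rewrite e1.
have st := @tjet_active (dir k0) (fun=> 0) k0.+1 (fun k hk => dir_after hk) (fun _ _ => erefl).
apply: (@global_increment _ _ st Cu) => //; last exact: leq_trans vl ln.
move=> j k0j jn; apply: le_trans (first_growth (fun=> 0) kn jn) _.
exact: ler_wpM2l C3_ge0 _ _ (F_mono jn).
Qed.

Lemma xi2_pvar k l : (k <= l)%N -> (l <= n)%N ->
  xi_pvar p T n r r' Jn 2 k l <= mm * (A * (cc * C4 * F n ^+ 2) * N) * om k l `^ p^-1.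
Proof.
move=> kl ln.
have q0 : 0 <= cc * C4 := mulr_ge0 cc0 C4_ge0.
have Q0 : 0 <= cc * C4 * F n ^+ 2 := mulr_ge0 q0 (sqr_ge0 _).
apply: xi_pvar_le => //.
- by apply: mulr_ge0 mm0 _; apply: mulr_ge0 => //; exact: mulr_ge0 A0 Q0.
- by move=> u v _ uv vl; apply: (gd_ge0 gd) => //; exact: leq_trans vl ln.
- by move=> u v t _ uv vt tl; apply: (gd_super gd) => //; exact: leq_trans tl ln.
move=> u v ku uv vl; rewrite !after2E => mu mv.
have := leq_trans mv (leq_trans vl ln); rewrite gtn_max => /andP[kn kn'].
have eJ j : Jn j = tjet T H V a n (dir k0) (dir k0') j z :=
  xi_jetE H a hV T0 n0 x hr hr' j kn kn'.
rewrite (eJ v) (eJ u).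
have st := @tjet_active (dir k0) (dir k0') (maxn k0 k0').+1
   (fun k hk => dir_after (leq_ltn_trans (leq_maxl _ _) hk))
   (fun k hk => dir_after (leq_ltn_trans (leq_maxr _ _) hk)).
apply: (@global_increment _ _ st Cz) => //; last exact: leq_trans vl ln.
move=> j mj jn; apply: le_trans (second_growth kn kn' mj jn) _.
apply: (ler_wpM2l q0); rewrite lerXn2r ?nnegrE ?F0 //; exact: F_mono jn.
Qed.

Lemma path_pvar_bound k l : mm * A * C3 + mm * A * (cc * C4) <= K ->
  (k <= l)%N -> (l <= n)%N ->
  xi_pvar p T n r r' Jn 1 k l + xi_pvar p T n r r' Jn 2 k l <=
    K * om k l `^ p^-1 * N * calM p alpha n om T H w K ^+ 2.
Proof.
move=> hK2 kl ln; rewrite calME.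
apply: le_trans (lerD (xi1_pvar kl ln) (xi2_pvar kl ln)) _.
have N0 : 0 <= N by exact: ler0n.
have h0 := hge0 k l; rewrite -/(h k l).
have FF : F n <= F n ^+ 2 by rewrite expr2 ler_peMl ?F0 ?F_ge1.
have c0 : 0 <= mm * A * C3 * N * h k l.
  by apply: mulr_ge0 h0; apply: mulr_ge0 N0; exact: mulr_ge0 (mulr_ge0 mm0 A0) C3_ge0.
have s0 : 0 <= N * F n ^+ 2 * h k l.
  by apply: mulr_ge0 h0; exact: mulr_ge0 N0 (sqr_ge0 _).
have b1 := ler_wpM2l c0 FF; have b2 := ler_wpM2r s0 hK2.
move: b1 b2; move: A C3 C4 cc mm N (F n) (h k l) K => A' c3 c4 c m' N' f' h' K' b1 b2.
have -> : m' * (A' * (c3 * f') * N') * h' + m' * (A' * (c * c4 * f' ^+ 2) * N') * h' =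
  m' * A' * c3 * N' * h' * f' + m' * A' * (c * c4) * (N' * f' ^+ 2 * h') by ring.
have -> : K' * h' * N' * f' ^+ 2 = K' * (N' * f' ^+ 2 * h') by ring.
apply: le_trans b2; rewrite mulrDl; apply: lerD => //.
by apply: le_trans b1 _; rewrite le_eqVlt; apply/orP; left; apply/eqP; ring.
Qed.

Lemma path_local_bound sj k l L : mm * K1 <= K ->
  S0 alpha n om sj || S1 alpha n om sj ->
  (sj <= k)%N -> (k <= l)%N -> (l <= next sj)%N -> (1 <= L <= 2)%N ->
  after T n r r' L k ->
  enorm (jxi L (Jn l) - jxi L (Jn k) - opLV V L (Jn k) *m grid_incr T n x k l) <=
    K * om k l `^ (2 / p) * Pmax L (Jn k).
Proof.
move=> hK2 s01 sk kl ls hL.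
have [gs _] := S01_le s01 al0; have /andP[sn _] := gs.
have /andP[_ nn] := gnext_bounds alpha om sn.
have kn0 : (k <= n)%N by exact: leq_trans kl (leq_trans ls nn).
have e2 : om k l `^ (2 / p) = h k l ^+ 2.
  by rewrite /h -powR_mulrn ?powR_ge0 // -powRrM mulrC.
rewrite e2.
have fin c (J : nat -> jet R m) M : c <> Cy -> (forall J' : jet R m, jxi M J' = jcomp c J') ->
    (forall J' : jet R m, opL M J' = opc c J') ->
    (forall i, `|jcomp c (J l) i 0 - jcomp c (J k) i 0
       - \sum_j opc c (J k) (vcoef V i j) * X j k l| <= K1 * h k l ^+ 2 * csc c (J k)) ->
    enorm (jxi M (J l) - jxi M (J k) - opLV V M (J k) *m grid_incr T n x k l) <=
      K * h k l ^+ 2 * csc c (J k).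
  move=> hc eM oM hb; rewrite !eM.
  have q0 : 0 <= h k l ^+ 2 * csc c (J k) := mulr_ge0 (sqr_ge0 _) (csc_ge0 c (J k)).
  rewrite -[leRHS]mulrA; apply: le_trans (ler_wpM2r q0 hK2); rewrite -[leRHS]mulrA.
  apply: enorm_cV_le; first exact: mulr_ge0 (le_trans ler01 K11) q0.
  move=> i; rewrite [leRHS]mulrA; have := hb i; rewrite !mxE.
  by under [X in _ -> `|_ - X| <= _]eq_bigr do rewrite mxE oM.
case: L hL => [//|[|[|//]]] _; rewrite ?after1E ?after2E => ak.
- have kn : (k0 < n)%N by exact: leq_trans ak kn0.
  have st := @tjet_active (dir k0) (fun=> 0) k0.+1 (fun k hk => dir_after hk) (fun _ _ => erefl).
  have [ey eu] : jy (Jn k) = jy (tjet T H V a n (dir k0) (fun=> 0) k z) /\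
      ju (Jn k) = ju (tjet T H V a n (dir k0) (fun=> 0) k z).
    exact: (xi_jet_u H a hV T0 n0 x r' hr k kn).
  have eul : ju (Jn l) = ju (tjet T H V a n (dir k0) (fun=> 0) l z).
    exact: (xi_jet_u H a hV T0 n0 x r' hr l kn).2.
  have -> : opLV V 1 (Jn k) = opLV V 1 (tjet T H V a n (dir k0) (fun=> 0) k z).
    by apply/matrixP => i j; rewrite !mxE /opL !dapp1 ey eu.
  pose J k := tjet T H V a n (dir k0) (fun=> 0) k z.
  have e1 : jxi 1 (Jn l) - jxi 1 (Jn k) = jxi 1 (J l) - jxi 1 (J k).
    exact: (f_equal2 (fun s t => s - t) eul eu).
  have e3 : Pmax 1 (Jn k) = csc Cu (J k) by exact: (congr1 (fun v => Num.max 1 (enorm v)) eu).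
  rewrite e1 e3.
  apply: (@fin Cu J 1%N) => // i.
  by have [] := interval01 st i s01 sk ak kl ls (_ : Cu <> Cy).
- have := leq_trans ak kn0; rewrite gtn_max => /andP[kn kn'].
  have st := @tjet_active (dir k0) (dir k0') (maxn k0 k0').+1
    (fun k hk => dir_after (leq_ltn_trans (leq_maxl _ _) hk))
    (fun k hk => dir_after (leq_ltn_trans (leq_maxr _ _) hk)).
  have eJ j : Jn j = tjet T H V a n (dir k0) (dir k0') j z :=
    xi_jetE H a hV T0 n0 x hr hr' j kn kn'.
  rewrite (eJ l) (eJ k).
  apply: (@fin Cz (fun k => tjet T H V a n (dir k0) (dir k0') k z) 2%N) => // i.
  by have [] := interval01 st i s01 sk ak kl ls (_ : Cz <> Cy).
Qed.

End GridPath.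

(** * The iterative equation *)

Section Equation.
Context {R : realType} {m d : nat}.
Variables (T H : R) (V : 'cV[R]_m -> 'M[R]_(m, d)) (a : 'cV[R]_m) (n : nat).
Hypotheses (hV : CbV V 4) (T0 : 0 < T) (n0 : (0 < n)%N).
Variables (x : R -> 'cV[R]_d) (r r' : R) (k0 k0' : nat).
Hypothesis hr : tgrid T n k0 < r <= tgrid T n k0.+1.
Hypothesis hr' : tgrid T n k0' < r' <= tgrid T n k0'.+1.

Let z l := grid_incr T n x l l.+1.
Let Jn := xi_jet T H V a n x r r'.

Lemma xi_equation L k : (1 <= L <= 2)%N -> (k < n)%N -> after T n r r' L k ->
  jxi L (Jn k.+1) - jxi L (Jn k) =
    opLV V L (Jn k) *m grid_incr T n x k k.+1
    + (mesh T n `^ (2 * H) / 2) *: \sum_(j < d) opLbarVV V L (Jn k) j j.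
Proof.
move=> hL kn.
have fin c (J : nat -> jet R m) M : (forall J' : jet R m, jxi M J' = jcomp c J') ->
    (forall J' : jet R m, opL M J' = opc c J') ->
    (forall J' : jet R m, opLbar M J' = opcbar c J') ->
    (forall i, jcomp c (J k.+1) i 0 - jcomp c (J k) i 0 =
       mulop V (opc c (J k)) (z k) i
       + mesh T n `^ (2 * H) / 2 * trop V (opcbar c (J k)) i) ->
    jxi M (J k.+1) - jxi M (J k) = opLV V M (J k) *m grid_incr T n x k k.+1
      + (mesh T n `^ (2 * H) / 2) *: \sum_(j < d) opLbarVV V M (J k) j j.
  move=> eM oM bM hb; apply/colP => i; have := hb i; rewrite !mxE !eM => ->.
  congr (_ + _ * _).
    by apply: eq_bigr => j _; rewrite [opLV _ _ _ _ _]mxE oM.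
  by rewrite summxE; apply: eq_bigr => j _; rewrite [RHS]mxE bM.
case: L hL => [//|[|[|//]]] _.
- rewrite (after1E T0 n0 r' hr) => ak.
  have kn0 : (k0 < n)%N by exact: ltn_trans ak kn.
  pose J k := tjet T H V a n (dir k0) (fun=> 0) k z.
  have [ey eu] : jy (Jn k) = jy (J k) /\ ju (Jn k) = ju (J k).
    exact: (xi_jet_u H a hV T0 n0 x r' hr k kn0).
  have euS : ju (Jn k.+1) = ju (J k.+1).
    exact: (xi_jet_u H a hV T0 n0 x r' hr k.+1 kn0).2.
  have o1 : opL 1 (Jn k) = opL 1 (J k).
    by apply/funext => g; rewrite /opL !dapp1 ey eu.
  have -> : opLV V 1 (Jn k) = opLV V 1 (J k).
    by apply/matrixP => i j; rewrite !mxE o1.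
  have eb j : opLbarVV V 1 (Jn k) j j = opLbarVV V 1 (J k) j j.
    apply/colP => i; rewrite !mxE /opLbar !dapp1 !dapp2 ey eu; congr (_ + D1 _ _ _).
    by apply/colP => l; rewrite !mxE o1.
  under [X in _ = _ + _ *: X]eq_bigr do rewrite eb.
  have e1 : jxi 1 (Jn k.+1) - jxi 1 (Jn k) = jxi 1 (J k.+1) - jxi 1 (J k).
    exact: (f_equal2 (fun s t => s - t) euS eu).
  rewrite e1; apply: (fin Cu J 1%N) => // i.
  apply: tjet_stepE => //; exact: dir_after.
- rewrite (after2E T0 n0 hr hr') => ak.
  have := ltn_trans ak kn; rewrite gtn_max => /andP[kn0 kn0'].
  have eJ j : Jn j = tjet T H V a n (dir k0) (dir k0') j z :=
    xi_jetE H a hV T0 n0 x hr hr' j kn0 kn0'.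
  rewrite (eJ k.+1) (eJ k).
  apply: (fin Cz (fun k => tjet T H V a n (dir k0) (dir k0') k z) 2%N) => // i.
  apply: tjet_stepE; apply: dir_after.
    exact: leq_ltn_trans (leq_maxl _ _) ak.
  exact: leq_ltn_trans (leq_maxr _ _) ak.
Qed.

End Equation.

(** * The threshold and the estimates for one path *)

(** The constants come from [op_bounds] and [unit_interval], which are uniform
    in the driver and in the grid; the growth and the increment estimates each
    impose a lower bound on K, and K is the sum of these bounds. *)
Lemma path_estimates (R : realType) (m d : nat) (T H p : R)
    (V : 'cV[R]_m -> 'M[R]_(m, d)) (a : 'cV[R]_m) (alpha : R) :
  0 < T -> 0 < H -> 0 < p -> CbV V 4 ->
  0 <= alpha -> alpha <= 1 -> p < 3 \/ alpha = 0 ->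
  exists2 K : R, 0 < K &
  forall (n : nat) (x b : R -> 'cV[R]_d) (w2 : R -> R -> 'M[R]_(d + d))
    (r r' : R) (k0 k0' : nat),
  let w t := col_mx (x t) (b t) in
  let om := control p T H n w w2 in
  let Jn := xi_jet T H V a n x r r' in
  (0 < n)%N ->
  (forall s u t, 0 <= s -> s <= u -> u <= t -> t <= T ->
    w2 s t = w2 s u + w2 u t + (w u - w s) *m (w t - w u)^T) ->
  tgrid T n k0 < r <= tgrid T n k0.+1 ->
  tgrid T n k0' < r' <= tgrid T n k0'.+1 ->
  (forall k l : nat, (k <= l <= n)%N ->
     xi_pvar p T n r r' Jn 1 k l + xi_pvar p T n r r' Jn 2 k l <=
       K * om k l `^ p^-1 * (card_S alpha n om)%:R
         * calM p alpha n om T H w K ^+ 2) /\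
  (forall sj k l : nat, S0 alpha n om sj || S1 alpha n om sj ->
     (sj <= k)%N -> (k <= l)%N -> (l <= gnext alpha n om sj)%N ->
     forall L : nat, (1 <= L <= 2)%N -> after T n r r' L k ->
       enorm (jxi L (Jn l) - jxi L (Jn k)
              - opLV V L (Jn k) *m grid_incr T n x k l) <=
         K * om k l `^ (2 / p) * Pmax L (Jn k)).
Proof.
move=> T0 H0 p0 hV al0 al1 pal.
have [C C0 hC] := op_bounds hV.
have [K1 K11 hK1] := unit_interval hV p0.
pose u1 : R := m%:R * K1 + m%:R * (d%:R * C + d%:R ^+ 2 * C).
pose A : R := K1 + d%:R * C + d%:R ^+ 2 * C * (2 + T `^ (2 * H)).
pose cc : R := (1 + m%:R * K1) ^+ 2.
pose C3 : R := cc * (1 + m%:R * (d%:R * C)).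
pose C4 : R := C3 ^+ 2 + m%:R * (d%:R * (C * C3) + d%:R * (C * C3)).
pose u2 : R := m%:R * A * C3 + m%:R * A * (cc * C4).
have K10 : 0 <= K1 := le_trans ler01 K11.
have u10 : 0 <= m%:R * K1 /\ 0 <= m%:R * (d%:R * C + d%:R ^+ 2 * C).
  split; first exact: mulr_ge0.
  by apply: mulr_ge0 => //; apply: addr_ge0; apply: mulr_ge0 => //; exact: exprn_ge0.
have cc0 : 0 <= cc by exact: sqr_ge0.
have C30 : 0 <= C3.
  by apply: mulr_ge0 => //; apply: addr_ge0 => //; do 2 apply: mulr_ge0 => //.
have C40 : 0 <= C4.
  apply: addr_ge0; first exact: sqr_ge0.
  by apply: mulr_ge0 => //; apply: addr_ge0; do 2 apply: mulr_ge0 => //.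
have A0 : 0 <= A.
  apply: addr_ge0; first by apply: addr_ge0 => //; exact: mulr_ge0.
  apply: mulr_ge0; first by apply: mulr_ge0 => //; exact: exprn_ge0.
  by rewrite addr_ge0 // powR_ge0.
have mA : 0 <= m%:R * A by exact: mulr_ge0.
have u20 : 0 <= u2.
  by apply: addr_ge0; apply: mulr_ge0 => //; exact: mulr_ge0.
have hu1 : u1 <= u1 + u2 + 1 by rewrite -addrA lerDl addr_ge0.
have [v1 v2] := u10.
have hu2 : u2 <= u1 + u2 + 1.
  by rewrite addrAC lerDr addr_ge0 // addr_ge0.
have hu3 : m%:R * K1 <= u1 + u2 + 1.
  by apply: le_trans hu1; rewrite /u1 lerDl.
exists (u1 + u2 + 1); first by rewrite ltr_wpDl // addr_ge0 // addr_ge0.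
move=> n x b w2 r r' k0 k0' w om Jn n0 chen hr hr'; split.
  move=> k l /andP[kl ln].
  exact: (path_pvar_bound a T0 H0 p0 hV C0 K11 hC hK1 al0 al1 pal hu1 n0 chen
    hr hr' hu2 kl ln).
move=> sj k l s01 sk kl ls L hL ak.
exact: (path_local_bound a T0 p0 hV K11 hK1 al0 al1 pal n0 chen hr hr' hu3 s01 sk kl ls hL ak).
Qed.

Section ThresholdFacts.
Context {R : realType}.
Variables (p C0 : R) (C6 C7 : nat -> R).
Hypotheses (p0 : 0 < p) (C00 : 0 <= C0).

Lemma threshold_ge0 : 0 <= threshold p C0 C6 C7.
Proof. exact: powR_ge0. Qed.

Lemma threshold_le1 : threshold p C0 C6 C7 <= 1.
Proof.
rewrite /threshold; set t := alpha_root p C0 C6 C7.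
have t2 : t <= 2^-1.
  rewrite /t /alpha_root; set e := \big[_/_]_(_ < _) _.
  have : (e <= (2^-1)%:E)%E by exact: bigmin_le_id.
  by case: e => [y| |] //=; rewrite ?lee_fin // => _; rewrite invr_ge0.
have [t0|t0] := ltP t 0; first by rewrite lt0_powR1.
have e1 : (1 : R) `^ p = 1 by rewrite powR1.
rewrite -[leRHS]e1; apply: ge0_ler_powR; rewrite ?nnegrE // ?(ltW p0) //.
by apply: le_trans t2 _; lra.
Qed.

(** For mu = 3 / p <= 1 the series defining K_mu is a divergent Riemann
    series. *)
Lemma Kmu_infinite : 3 <= p -> Kmu p = +oo%E.
Proof.
move=> p3; rewrite /Kmu; set mu := 3 / p.
have mu01 : 0 <= mu <= 1.
  by rewrite divr_ge0 ?(ltW p0) //= ler_pdivrMr // mul1r.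
have u0 l : (0 <= ((l%:R : R) `^ (- mu))%:E)%E by rewrite lee_fin powR_ge0.
suff -> : (\sum_(1 <= l <oo) ((l%:R : R) `^ (- mu))%:E = +oo)%E.
  by rewrite gt0_muley // lte_fin powR_gt0.
have := @nneseries_ge0 R (fun l => ((l%:R : R) `^ (- mu))%:E) xpredT 1%N (fun l _ _ => u0 l).
have hge k := @nneseries_lim_ge R (fun l => ((l%:R : R) `^ (- mu))%:E) xpredT 1%N k
  (fun l _ _ => u0 l).
move: hge; case: (\sum_(1 <= l <oo) _)%E => [y hge _| |] //.
exfalso; apply: (dvg_riemannR mu01); apply: nondecreasing_is_cvgn.
  apply: nondecreasing_series => i _ _; apply: ltW; apply: riemannR_gt0.
  by case/andP: mu01.
exists y => _ [i _ <-].
have := hge i.+1; rewrite big_add1 /= sumEFin lee_fin; apply: le_trans.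
rewrite le_eqVlt; apply/orP; left; apply/eqP; apply: eq_bigr => j _.
by rewrite powRN.
Qed.

Lemma C123_ge0 M : [/\ 0 <= C1 C0 M, 0 <= C2 C0 M & 0 <= C3 C0 M].
Proof.
have c1 k : 0 <= C1 C0 k by case: k => [//|k]; apply: sumr_ge0.
split=> //.
  case: M => [|M]; first by rewrite /C2 mulr_ge0 ?sqr_ge0.
  apply: sumr_ge0 => i _; rewrite mulr_ge0 // addr_ge0 // sumr_ge0 //.
case: M => [//|M]; apply: sumr_ge0 => i _; apply: sumr_ge0 => l _.
exact: mulr_ge0.
Qed.

Lemma K2_gt0 M : 0 < K2 C0 M.
Proof.
have [_ a1 a2] := C123_ge0 M.
have b1 : 0 <= prevC (C2 C0) M by case: M {a1 a2} => [//|M]; case: (C123_ge0 M).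
have b2 : 0 <= prevC (C3 C0) M by case: M {a1 a2 b1} => [//|M]; case: (C123_ge0 M).
rewrite /K2; lra.
Qed.

Lemma threshold_eq0 : 3 <= p -> threshold p C0 C6 C7 = 0.
Proof.
move=> p3; rewrite /threshold.
suff -> : alpha_root p C0 C6 C7 = 0 by rewrite powR0 // gt_eqF.
have K3y M : K3 p C0 C6 C7 M = +oo%E.
  rewrite /K3 Kmu_infinite // gt0_mulye ?maxye //.
  by rewrite lte_fin /K4 lt_max ltr01 orbT.
rewrite /alpha_root.
suff -> : \big[Order.min/((2^-1 : R)%:E)%E]_(M < 3)
    Order.min ((K2 C0 M)^-1)%:E (K3 p C0 C6 C7 M)^-1%E = 0%E by [].
apply/eqP; rewrite eq_le; apply/andP; split.
  apply: le_trans (bigmin_le _ ord0 _) _.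
  by rewrite K3y invey ge_min lexx orbT.
apply: le_bigmin => [|M _]; first by rewrite lee_fin invr_ge0.
by rewrite le_min K3y invey lexx andbT lee_fin invr_ge0 ltW // K2_gt0.
Qed.

(** Together with [threshold_le1]: on an interval of S_0 or S_1 the control is
    at most 1, and it vanishes unless the sewing argument is available. *)
Lemma threshold_cases : p < 3 \/ threshold p C0 C6 C7 = 0.
Proof.
by case: (ltP p 3) => p3; [left|right; exact: threshold_eq0].
Qed.

End ThresholdFacts.

Lemma C0sup_ge0 (R : realType) (m d : nat) (V : 'cV[R]_m -> 'M[R]_(m, d)) :
  0 <= C0sup V.
Proof. by apply: sup_nonneg => _ [tau [y [_ ->]]]; exact: sqrtr_ge0. Qed.

Theorem theorem4p13 (R : realType) (m d : nat) (T H p : R)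
    (hT : 0 < T) (hH : 3^-1 < H < 2^-1) (hp : H^-1 < p)
    (disp : measure_display) (Omega : measurableType disp)
    (P : probability Omega R)
    (x b : 'I_d -> R -> {RV P >-> R})
    (hx : is_fbm T H x) (hb : is_fbm T H b)
    (hxb : independent_processes T x b)
    (w2 : Omega -> R -> R -> 'M[R]_(d + d)) :
  let w := fun o t => col_mx (path_of x o t) (path_of b o t) in
  {ae P, forall o, geometric_lift T (w o) (w2 o)} ->
  forall (V : 'cV[R]_m -> 'M[R]_(m, d)) (a : 'cV[R]_m),
  CbV V 4 ->
  let J := fun o n r r' => xi_jet T H V a n (path_of x o) r r' in
  let omega := fun o n => control p T H n (w o) (w2 o) in
  (forall (o : Omega) (n : nat) (r r' : R) (k0 k0' : nat), (0 < n)%N ->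
     0 <= r -> 0 <= r' ->
     tgrid T n k0 < r <= tgrid T n k0.+1 ->
     tgrid T n k0' < r' <= tgrid T n k0'.+1 ->
     forall L k : nat, (1 <= L <= 2)%N -> (k < n)%N -> after T n r r' L k ->
       let Jk := J o n r r' k in
       jxi L (J o n r r' k.+1) - jxi L Jk =
         opLV V L Jk *m grid_incr T n (path_of x o) k k.+1
         + (mesh T n `^ (2 * H) / 2) *: \sum_(j < d) opLbarVV V L Jk j j)
  /\
  (forall C6 C7 : nat -> R,
     {ae P, forall o, forall (n : nat) (r r' : R) (k0 k0' : nat), (0 < n)%N ->
        0 <= r -> 0 <= r' ->
        tgrid T n k0 < r <= tgrid T n k0.+1 ->
        tgrid T n k0' < r' <= tgrid T n k0'.+1 ->
        forall M : nat, (M <= 2)%N ->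
          increment_const p V n (omega o n) (J o n r r') M (opLbar M) (C6 M) /\
          increment_const p V n (omega o n) (J o n r r') M (opLtilde M) (C7 M)}
     ->
     let alpha := threshold p (C0sup V) C6 C7 in
     exists2 K : R, 0 < K &
     {ae P, forall o, forall (n : nat) (r r' : R) (k0 k0' : nat), (0 < n)%N ->
        0 <= r -> 0 <= r' ->
        tgrid T n k0 < r <= tgrid T n k0.+1 ->
        tgrid T n k0' < r' <= tgrid T n k0'.+1 ->
        let om := omega o n in
        let Jn := J o n r r' in
        (forall k l : nat, (k <= l <= n)%N ->
           xi_pvar p T n r r' Jn 1 k l + xi_pvar p T n r r' Jn 2 k l <=
             K * om k l `^ p^-1 * (card_S alpha n om)%:R
               * calM p alpha n om T H (w o) K ^+ 2) /\
        (forall sj k l : nat, S0 alpha n om sj || S1 alpha n om sj ->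
           (sj <= k)%N -> (k <= l)%N -> (l <= gnext alpha n om sj)%N ->
           forall L : nat, (1 <= L <= 2)%N -> after T n r r' L k ->
             enorm (jxi L (Jn l) - jxi L (Jn k)
                    - opLV V L (Jn k) *m grid_incr T n (path_of x o) k l) <=
               K * om k l `^ (2 / p) * Pmax L (Jn k))}).
Proof.
move=> w hgeo V a hV J omega.
have H0 : 0 < H by have /andP[h _] := hH; apply: lt_trans h; rewrite invr_gt0.
have p0 : 0 < p by apply: lt_trans hp; rewrite invr_gt0.
split.
  move=> o n r r' k0 k0' n0 _ _ hr hr' L k hL kn ak Jk.
  exact: (xi_equation H a hV hT n0 (path_of x o) hr hr' hL kn ak).
move=> C6 C7 _ alpha.
have [K K0 hK] := path_estimates a hT H0 p0 hV (threshold_ge0 p (C0sup V) C6 C7)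
  (threshold_le1 (C0sup V) C6 C7 p0)
  (threshold_cases C6 C7 p0 (C0sup_ge0 V)).
exists K => //; move: hgeo; apply: filterS => o [chen _].
move=> n r r' k0 k0' n0 _ _ hr hr'.
exact: (hK n (path_of x o) (path_of b o) (w2 o) r r' k0 k0' n0 chen hr hr').
Qed.
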